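(* Let $0<T<\infty$ and let $u=(u_1,u_2)$ be a weak solution on $(0,T)\times\mathbb{R}^2$ to the two-dimensional anisotropic incompressible Navier--Stokes equations $\partial_t u+\operatorname{div}(u\otimes u)+\nabla p=\partial_{x_1}^2u$, $\operatorname{div}u=0$ (in the sense defined in the context), with associated pressure $p\in L^2(0,T;L^2(\mathbb{R}^2))$. Then the unique representative of $u_1$ in $C_w([0,T];L^2(\mathbb{R}^2))$ is a renormalized solution, i.e. for every $\beta\in C^2(\mathbb{R})$ with $\beta(0)=\beta'(0)=0$ and $\beta',\beta''\in L^\infty(\mathbb{R})$, and every $0\le s<t\le T$, $$\int_{\mathbb{R}^2}\beta(u_1(t))\,dx+\int_s^t\int_{\mathbb{R}^2}\beta''(u_1)(\partial_{x_1}u_1)^2\,dx\,d\tau=\int_{\mathbb{R}^2}\beta(u_1(s))\,dx+\int_s^t\int_{\mathbb{R}^2}p\,\beta''(u_1)\,\partial_{x_1}u_1\,dx\,d\tau.$$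
   Context: Definition (weak solution). A vector field $u=(u_1,u_2):(0,T)\times\mathbb{R}^2\to\mathbb{R}^2$ is called a weak solution if: (i) $u\in L^\infty(0,T;L^2(\mathbb{R}^2))$ and the weak derivative $\partial_{x_1}u\in L^2(0,T;L^2(\mathbb{R}^2))$; (ii) $u$ is weakly divergence-free, i.e. $\int_{\mathbb{R}^2}u\cdot\nabla\psi\,dx=0$ for all $\psi\in C_c^\infty(\mathbb{R}^2)$ and almost every $t\in(0,T)$; (iii) for every divergence-free vector field $\phi\in C_c^\infty((0,T)\times\mathbb{R}^2)$ (with values in $\mathbb{R}^2$), $$\int_0^T\int_{\mathbb{R}^2}\partial_t\phi\cdot u+\nabla\phi:(u\otimes u)-\partial_{x_1}\phi\cdot\partial_{x_1}u\,dx\,dt=0,$$ where $\nabla\phi:(u\otimes u)=\sum_{i,j=1}^2\partial_{x_j}\phi_i\,u_iu_j$. Pressure: for every weak solution $u$ there is a unique $p\in L^2(0,T;L^2(\mathbb{R}^2))$ such that $\partial_tu+\operatorname{div}(u\otimes u)+\nabla p=\partial_{x_1}^2u$ holds in the sense of distributions on $(0,T)\times\mathbb{R}^2$; this is the associated pressure $p$. Time continuity: $C_w([0,T];L^2(\mathbb{R}^2))$ denotes the functions $[0,T]\to L^2(\mathbb{R}^2)$ continuous with respect to the weak topology of $L^2(\mathbb{R}^2)$. Every weak solution has a unique representative (agreeing with it for almost every $t$) in this space, and pointwise-in-time values refer to it. *)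

(* Defs.v *)
From HB Require Import structures.
From mathcomp Require Import all_boot all_order all_algebra.
From mathcomp Require Import all_classical all_reals all_analysis.

Set Implicit Arguments.
Unset Strict Implicit.
Unset Printing Implicit Defensive.
Import Order.TTheory GRing.Theory Num.Theory.
Import numFieldNormedType.Exports.

Local Open Scope classical_set_scope.
Local Open Scope ring_scope.

Section anisotropic_navier_stokes.
Context {R : realType}.

(* Points of R^2 are pairs (x1, x2), points of space-time are (t, (x1, x2)). *)
Definition leb2 := ((@lebesgue_measure R) \x (@lebesgue_measure R))%E.

Definition et : R * (R * R) := (1, (0, 0)).
(* Components are indexed by 'I_2: the index 0 stands for x_1, 1 for x_2. *)
Definition ex2 (j : 'I_2) : R * R := ((j == 0)%:R, (j == 1)%:R).
Definition ex (j : 'I_2) : R * (R * R) := (0, ex2 j).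

(* Class C^n through continuity of the iterated directional derivatives; this is
   the usual notion when V is finite dimensional, the only case used here. *)
Fixpoint classC {V : normedModType R} (n : nat) (f : V -> R) : Prop :=
  continuous f /\
  if n is m.+1 then
    forall v : V, (forall x, derivable f x v) /\ classC m ('D_v f)
  else True.

Definition smooth {V : normedModType R} (f : V -> R) : Prop :=
  forall n, classC n f.

Definition supp {V : normedModType R} (f : V -> R) : set V :=
  closure [set x | f x != 0].

Definition test_fun {V : normedModType R} (f : V -> R) : Prop :=
  smooth f /\ compact (supp f).

Definition slab (T : R) : set (R * (R * R)) := `]0, T[ `*` setT.

(* C_c^oo((0,T) x R^2), its elements being extended by 0 to R x R^2. *)
Definition test_slab (T : R) (f : R * (R * R) -> R) : Prop :=
  test_fun f /\ supp f `<=` slab T.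

Definition slab_int (s t : R) (f : R * (R * R) -> R) : \bar R :=
  (\int[lebesgue_measure]_(tau in `]s, t[) \int[leb2]_x (f (tau, x))%:E)%E.

(* f belongs to L^p(0,T; L^2(R^2)). *)
Definition LpL2 (T : R) (p : \bar R) (f : R * (R * R) -> R) : Prop :=
  measurable_fun
    (T := (measurableTypeR R * (measurableTypeR R * measurableTypeR R))%type)
    (U := measurableTypeR R) (slab T) f /\
  (Lnorm lebesgue_measure p
    ((fun t => Lnorm leb2 2%:E (fun x => (f (t, x))%:E)) \_ [set` `]0%R, T[]) < +oo)%E.

(* g is the weak derivative of f in direction x_1 on (0,T) x R^2. *)
Definition weak_dx1 (T : R) (f g : R * (R * R) -> R) : Prop :=
  forall psi, test_slab T psi ->
    slab_int 0 T (fun z => f z * 'D_(ex 0) psi z) =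
    (- slab_int 0 T (fun z => (g z * psi z)%R))%E.

(* u is a weak solution on (0,T) x R^2 and du its weak derivative in
   direction x_1 (which is determined by u up to a null set). *)
Record weak_solution (T : R) (u du : 'I_2 -> R * (R * R) -> R) : Prop := {
  ws_LooL2 : forall i, LpL2 T +oo%E (u i) ;
  ws_dx1 : forall i, weak_dx1 T (u i) (du i) ;
  ws_dx1_L2L2 : forall i, LpL2 T 2%:E (du i) ;
  ws_div : forall psi : R * R -> R, test_fun psi ->
    {ae lebesgue_measure, forall t : R, t \in `]0, T[ ->
      (\int[leb2]_x (\sum_(j < 2) u j (t, x) * 'D_(ex2 j) psi x)%R%:E = 0)%E} ;
  ws_eq : forall phi : 'I_2 -> R * (R * R) -> R,
    (forall i, test_slab T (phi i)) ->
    (forall z, \sum_(j < 2) 'D_(ex j) (phi j) z = 0) ->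
    slab_int 0 T (fun z =>
      \sum_(i < 2) 'D_et (phi i) z * u i z
      + \sum_(i < 2) \sum_(j < 2) 'D_(ex j) (phi i) z * (u i z * u j z)
      - \sum_(i < 2) 'D_(ex 0) (phi i) z * du i z) = 0%E
}.

(* The momentum equation in distributions, i.e. tested componentwise with all
   derivatives moved to the test function (and the overall sign changed). *)
Definition associated_pressure (T : R) (u : 'I_2 -> R * (R * R) -> R)
    (p : R * (R * R) -> R) : Prop :=
  LpL2 T 2%:E p /\
  forall (i : 'I_2) phi, test_slab T phi ->
    slab_int 0 T (fun z =>
      u i z * 'D_et phi z
      + \sum_(j < 2) u i z * u j z * 'D_(ex j) phi z
      + p z * 'D_(ex i) phi z
      + u i z * 'D_(ex 0) ('D_(ex 0) phi) z) = 0%E.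

(* v belongs to C_w([0,T]; L^2(R^2)); the dual of L^2 is identified with L^2. *)
Definition weakly_continuous (T : R) (v : R -> R * R -> R) : Prop :=
  (forall t, t \in `[0, T] -> v t \in Lfun leb2 2%:E) /\
  forall g : R * R -> R, g \in Lfun leb2 2%:E ->
    {within `[0, T], continuous (fun t => \int[leb2]_x (v t x * g x))}.

Definition Cw_representative (T : R) (f : R * (R * R) -> R)
    (v : R -> R * R -> R) : Prop :=
  weakly_continuous T v /\
  {ae lebesgue_measure, forall t : R, t \in `]0, T[ ->
    {ae leb2, forall x, v t x = f (t, x)}}.

End anisotropic_navier_stokes.

(* Main.v *)
(** The equation for the first component is mollified in space with the kernel
    [e(x1) kappa(x2)], where [e] is a mollifier at scale [d] and [kappa] is the
    difference quotient at step [h] of a smoothed Heaviside function, so that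
    [kappa'(x2) = (e(x2) - e(x2 - h)) / h]. Write [w], [v], [q] for the mollified
    [u1], [d1 u1], [p], and [U1], [U2] for the components of the velocity mollified
    with [e(x1) e(x2)]. Since [d1 u1] is square integrable and [d2 u2 = - d1 u1],
    every derivative of [u1] that the convective term produces can be moved onto
    [d1 u1], except in the mollification of [u1 u2]. There the difference quotient
    in [kappa'] splits exactly, by a discrete Leibniz rule, into
    [U2 d2 w], a multiple of [v], and a defect divided by [h]; the defect is
    the difference between the mollified product [u1 u2] and the product of the
    mollified factors. The term [beta'(w) (U1 d1 w + U2 d2 w)] integrates to zero
    because [U] is divergence free, and the remaining terms cancel in [L1] when
    [d] tends to zero so fast, compared with [h], that the defect is at most
    [h ^ 2]. Multiplying the mollified equation by [beta'(w)], integrating by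
    parts in [x1] and letting [h] tend to zero gives the identity; at the end
    points it is the weakly continuous representative that is mollified. *)

Require Import Defs.
From HB Require Import structures.
From mathcomp Require Import all_boot all_order all_algebra.
From mathcomp Require Import all_classical all_reals all_analysis.
From mathcomp Require Import measurable_realfun ess_sup_inf.
From mathcomp Require Import ring lra.

Import Order.TTheory GRing.Theory Num.Theory.
Import numFieldNormedType.Exports.
Local Open Scope classical_set_scope.
Local Open Scope ring_scope.

Set Implicit Arguments.
Unset Strict Implicit.
Unset Printing Implicit Defensive.

(** * Integrable and square-integrable functions *)

(** The weak derivative [d2 u1] is not a function, so the equation cannot be multiplied by
    [beta'(u1)] directly, and a commutator estimate using the full gradient of the transporting
    field is out of reach, since [u1] is itself a component of that field. Two scales replace such
    an estimate. Once [h] is fixed, the defect tends to zero with [d] merely because mollification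
    converges in [L2]; no derivative and no rate are involved, so [d] can be chosen after [h].
    Everything else is a product of two factors converging in [L2], so all limits are taken in [L1]:
    the term [2 u1 d1 u1] coming from [d1 (u1 ^ 2)] is balanced by one copy of [u1 d1 u1] from the
    transport term and one from the Leibniz rule. The factors [beta'(w)] and [beta''(w)] are bounded
    but converge only almost everywhere, which is why a subsequence of scales is extracted. No
    mollification in time is needed: at a fixed point of space the mollified representative is
    absolutely continuous in time, and the ordinary chain rule applies. *)

Section product_sigma_finite.
Context d1 d2 (X : measurableType d1) (Y : measurableType d2) (R : realType).
Variables (mu : {sigma_finite_measure set X -> \bar R}).
Variables (nu : {sigma_finite_measure set Y -> \bar R}).

(** Both exhaustions are taken increasing, so that a point whose coordinates enter at stages [m] and
    [n] lies in the rectangle of stage [maxn m n]. *)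
Lemma product_sigma_finite : sigma_finite setT (mu \x nu)%E.
Proof.
have /sigma_finiteP[F [FT Fnd Fi]] := sigma_finiteT mu.
have /sigma_finiteP[G [GT Gnd Gi]] := sigma_finiteT nu.
exists (fun n => F n `*` G n).
  apply/esym; rewrite -subTset => -[x y] _.
  have [m _ Fx] : (\bigcup_k F k) x by rewrite -FT.
  have [n _ Gy] : (\bigcup_k G k) y by rewrite -GT.
  exists (maxn m n) => //; split => /=.
  - by move: x Fx; apply/subsetPset/Fnd/leq_maxl.
  - by move: y Gy; apply/subsetPset/Gnd/leq_maxr.
move=> n; have [mF Fn] := Fi n; have [mG Gn] := Gi n.
split; first exact: measurableX.
by rewrite product_measure1E// lte_mul_pinfty// ge0_fin_numE.
Qed.

End product_sigma_finite.

(* Iterated products are named constants, so that each of them carries a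
   sigma-finite instance. *)
HB.instance Definition _ (R : realType) := Measure.on (@leb2 R).
HB.instance Definition _ (R : realType) :=
  Measure_isSigmaFinite.Build _ _ _ (@leb2 R) (@product_sigma_finite _ _ _ _ _ lebesgue_measure lebesgue_measure).

Definition leb3 {R : realType} := ((@lebesgue_measure R) \x (@leb2 R))%E.
HB.instance Definition _ (R : realType) := Measure.on (@leb3 R).
HB.instance Definition _ (R : realType) :=
  Measure_isSigmaFinite.Build _ _ _ (@leb3 R) (@product_sigma_finite _ _ _ _ _ lebesgue_measure leb2).
Definition leb4 {R : realType} := ((@leb2 R) \x (@leb2 R))%E.
HB.instance Definition _ (R : realType) := Measure.on (@leb4 R).
HB.instance Definition _ (R : realType) :=
  Measure_isSigmaFinite.Build _ _ _ (@leb4 R) (@product_sigma_finite _ _ _ _ _ leb2 leb2).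

Section integrable_functions.
Context d (X : measurableType d) (R : realType) (mu : {measure set X -> \bar R}).
Implicit Types f g h : X -> R.

Definition L1 f := mu.-integrable setT (EFin \o f).
(** Measurability is a separate clause because the square forgets the sign of [f]. *)
Definition L2 f := measurable_fun setT f /\ L1 (fun x => f x ^+ 2).

Lemma L1_meas f : L1 f -> measurable_fun setT f.
Proof. by move=> /integrableP[/measurable_EFinP]. Qed.

Lemma measurable_enorm f : measurable_fun setT f ->
  measurable_fun setT (fun x => `|f x|%:E).
Proof. by move=> mf; apply/measurable_EFinP; exact: measurableT_comp. Qed.

Lemma L1_le f g : measurable_fun setT f -> (forall x, `|f x| <= `|g x|) ->
  L1 g -> L1 f.
Proof.
move=> mf fg; apply: le_integrable => //; first exact/measurable_EFinP.
by move=> x _ /=; rewrite lee_fin.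
Qed.

Lemma L1D f g : L1 f -> L1 g -> L1 (fun x => f x + g x).
Proof.
move=> fi gi; have := integrableD measurableT fi gi.
by apply: eq_integrable => // x _.
Qed.

Lemma L1Z c f : L1 f -> L1 (fun x => c * f x).
Proof.
move=> fi; have := integrableZl measurableT c fi.
by apply: eq_integrable => // x _.
Qed.

Lemma L1N f : L1 f -> L1 (fun x => - f x).
Proof. by move=> /(L1Z (-1)); under eq_fun do rewrite mulN1r. Qed.

Lemma L1B f g : L1 f -> L1 g -> L1 (fun x => f x - g x).
Proof. by move=> fi gi; apply: L1D => //; apply: L1N. Qed.

Lemma L1_norm f : L1 f -> L1 (fun x => `|f x|).
Proof. exact: integrable_norm. Qed.

Lemma L1_bound h g C : measurable_fun setT h -> (forall x, `|h x| <= C) ->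
  L1 g -> L1 (fun x => h x * g x).
Proof.
move=> mh hC gi; apply: (@L1_le _ (fun x => C * g x)).
- by apply: measurable_funM => //; exact: L1_meas.
- move=> x; rewrite !normrM ler_wpM2r//.
  by rewrite (le_trans (hC x))// ler_norm.
- exact: L1Z.
Qed.

Lemma L1_lty f : measurable_fun setT f ->
  (\int[mu]_x `|f x|%:E < +oo)%E -> L1 f.
Proof. by move=> mf h; apply/integrableP; split; [exact/measurable_EFinP|]. Qed.

Lemma L2_meas f : L2 f -> measurable_fun setT f. Proof. by case. Qed.

Lemma L2_mul f g : L2 f -> L2 g -> L1 (fun x => f x * g x).
Proof.
move=> [mf fi] [mg gi]; apply: (@L1_le _ (fun x => f x ^+ 2 + g x ^+ 2)).
- exact: measurable_funM.
- move=> x; rewrite normrM [leRHS]ger0_norm; last by rewrite addr_ge0 ?sqr_ge0.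
  rewrite -(real_normK (num_real (f x))) -(real_normK (num_real (g x))).
  by have := sqr_ge0 (`|f x| - `|g x|); nra.
- exact: L1D.
Qed.

Lemma L2_le f g : measurable_fun setT f -> (forall x, `|f x| <= `|g x|) ->
  L2 g -> L2 f.
Proof.
move=> mf fg [mg gi]; split=> //.
apply: (L1_le _ _ gi); first exact: measurable_funX.
by move=> x; rewrite !normrX lerXn2r// nnegrE.
Qed.

Lemma L2D f g : L2 f -> L2 g -> L2 (fun x => f x + g x).
Proof.
move=> fi gi; split; first by apply: measurable_funD; apply: L2_meas.
have := L1D (L1D fi.2 gi.2) (L1Z 2 (L2_mul fi gi)).
by congr L1; apply/funext => x; ring.
Qed.

Lemma L2Z c f : L2 f -> L2 (fun x => c * f x).
Proof.
move=> fi; split; first by apply: measurable_funM => //; apply: L2_meas.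
by have := L1Z (c ^+ 2) fi.2; congr L1; apply/funext => x; ring.
Qed.

Lemma L2B f g : L2 f -> L2 g -> L2 (fun x => f x - g x).
Proof.
by move=> fi gi; apply: L2D => //; under eq_fun do rewrite -mulN1r; apply: L2Z.
Qed.

Lemma L2_norm f : L2 f -> L2 (fun x => `|f x|).
Proof.
move=> fi; apply: (L2_le _ _ fi); last by move=> x; rewrite normr_id.
by apply: measurableT_comp => //; exact: L2_meas.
Qed.

Definition nrm1 f := \int[mu]_x `|f x|.
(* The square of the L2 norm. *)
Definition nrm2 f := \int[mu]_x (f x ^+ 2).

Lemma nrm1_ge0 f : 0 <= nrm1 f.
Proof. exact: Rintegral_ge0. Qed.

Lemma nrm2_ge0 f : 0 <= nrm2 f.
Proof. by apply: Rintegral_ge0 => x _; exact: sqr_ge0. Qed.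

Lemma Rint_le f g : L1 f -> L1 g -> (forall x, f x <= g x) ->
  \int[mu]_x f x <= \int[mu]_x g x.
Proof. by move=> fi gi fg; apply: le_Rintegral. Qed.

Lemma RintD f g : L1 f -> L1 g ->
  \int[mu]_x (f x + g x) = \int[mu]_x f x + \int[mu]_x g x.
Proof. exact: RintegralD. Qed.

Lemma RintB f g : L1 f -> L1 g ->
  \int[mu]_x (f x - g x) = \int[mu]_x f x - \int[mu]_x g x.
Proof. exact: RintegralB. Qed.

Lemma RintZ c f : L1 f -> \int[mu]_x (c * f x) = c * \int[mu]_x f x.
Proof. exact: RintegralZl. Qed.

Lemma RintN f : L1 f -> \int[mu]_x (- f x) = - \int[mu]_x f x.
Proof. by move=> /(RintZ (-1)); rewrite mulN1r; under eq_fun do rewrite mulN1r. Qed.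

Lemma RintE f : L1 f -> (\int[mu]_x (f x)%:E)%E = (\int[mu]_x f x)%:E.
Proof. by move=> fi; rewrite fineK//; exact: integrable_fin_num. Qed.

Lemma nrm1_fin f : L1 f -> (\int[mu]_x `|f x|%:E)%E = (nrm1 f)%:E.
Proof. by move=> /L1_norm/RintE. Qed.

Lemma nrm1_tri f g : L1 f -> L1 g -> nrm1 (fun x => f x + g x) <= nrm1 f + nrm1 g.
Proof.
move=> fi gi; rewrite -RintD; [|exact: L1_norm..].
apply: Rint_le; last by move=> x; exact: ler_normD.
  by apply: L1_norm; apply: L1D.
by apply: L1D; apply: L1_norm.
Qed.

(** The integral of [(l |f| - |g|) ^ 2] is a non-negative quadratic polynomial in [l], evaluated at
    its minimiser [P / nrm2 f]. If [nrm2 f = 0] the polynomial is affine, which forces [P = 0]. *)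
Lemma cauchy_schwarz f g : L2 f -> L2 g ->
  nrm1 (fun x => f x * g x) ^+ 2 <= nrm2 f * nrm2 g.
Proof.
move=> fi gi; set P := nrm1 _.
have key l : 0 <= l ^+ 2 * nrm2 f - 2 * l * P + nrm2 g.
  have : 0 <= \int[mu]_x ((l * `|f x| - `|g x|) ^+ 2).
    by apply: Rintegral_ge0 => x _; exact: sqr_ge0.
  rewrite [X in _ <= X -> _](_ : _ = \int[mu]_x
    (l ^+ 2 * f x ^+ 2 - 2 * l * `|f x * g x| + g x ^+ 2)); last first.
    apply: eq_Rintegral => x _; rewrite normrM.
    rewrite -(real_normK (num_real (f x))) -(real_normK (num_real (g x))).
    ring.
  have h1 : L1 (fun x => l ^+ 2 * f x ^+ 2) by exact/L1Z/fi.2.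
  have h2 : L1 (fun x => 2 * l * `|f x * g x|) by exact/L1Z/L1_norm/L2_mul.
  rewrite RintD//; [|exact: L1B|exact: gi.2].
  by rewrite RintB// !RintZ//; [exact/L1_norm/L2_mul|exact: fi.2].
have P0 : 0 <= P by exact: nrm1_ge0.
have [A0|A0] := eqVneq (nrm2 f) 0.
  rewrite A0 mul0r; have [->|Pn0] := eqVneq P 0; first by rewrite expr0n.
  have Pp : 0 < P by rewrite lt_neqAle eq_sym Pn0.
  (* This [l] is large enough to make the affine expression equal to [- nrm2 g - 2], a
     contradiction. *)
  have := key ((nrm2 g + 1) / P); rewrite A0 mulr0 add0r.
  rewrite -[2 * _ * _]mulrA divfK//.
  by have := nrm2_ge0 g; lra.
have Ap : 0 < nrm2 f by rewrite lt_neqAle eq_sym A0 nrm2_ge0.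
have := key (P / nrm2 f).
rewrite [X in _ <= X -> _](_ : _ = (nrm2 f * nrm2 g - P ^+ 2) / nrm2 f).
  by rewrite pmulr_lge0 ?invr_gt0// subr_ge0.
by field.
Qed.

Lemma nrm1_mul f g : L2 f -> L2 g ->
  nrm1 (fun x => f x * g x) <= Num.sqrt (nrm2 f) * Num.sqrt (nrm2 g).
Proof.
move=> fi gi; rewrite -sqrtrM ?nrm2_ge0//.
rewrite -[leLHS]ger0_norm ?nrm1_ge0// -sqrtr_sqr ler_sqrt ?cauchy_schwarz//.
by rewrite mulr_ge0// nrm2_ge0.
Qed.

Definition cvg1 (F : (X -> R)^nat) f := [/\ forall n, L1 (F n), L1 f &
  nrm1 (fun x => F n x - f x) @[n --> \oo] --> 0].
Definition cvg2 (F : (X -> R)^nat) f := [/\ forall n, L2 (F n), L2 f &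
  nrm2 (fun x => F n x - f x) @[n --> \oo] --> 0].

Lemma cvg1_squeeze F f (c : R^nat) : (forall n, L1 (F n)) -> L1 f ->
  (forall n, nrm1 (fun x => F n x - f x) <= c n) -> c @ \oo --> 0 ->
  cvg1 F f.
Proof.
move=> iF fi Fc c0; split => //.
apply: (squeeze_cvgr _ (cvg_cst 0) c0).
by apply: nearW => n; rewrite nrm1_ge0 Fc.
Qed.

Lemma cvg2_squeeze F f (c : R^nat) : (forall n, L2 (F n)) -> L2 f ->
  (forall n, nrm2 (fun x => F n x - f x) <= c n) -> c @ \oo --> 0 ->
  cvg2 F f.
Proof.
move=> iF fi Fc c0; split => //.
apply: (squeeze_cvgr _ (cvg_cst 0) c0).
by apply: nearW => n; rewrite nrm2_ge0 Fc.
Qed.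

Lemma cvg1D F f G g : cvg1 F f -> cvg1 G g ->
  cvg1 (fun n x => F n x + G n x) (fun x => f x + g x).
Proof.
move=> [iF fi Ff] [iG gi Gg].
apply: (@cvg1_squeeze _ _ (fun n => nrm1 (fun x => F n x - f x) +
  nrm1 (fun x => G n x - g x))).
- by move=> n; apply: L1D.
- exact: L1D.
- move=> n; apply: le_trans (nrm1_tri _ _); [|exact: L1B..].
  by rewrite le_eqVlt; apply/orP; left; apply/eqP; congr nrm1; apply/funext => x; ring.
- by rewrite -[0]addr0; apply: cvgD.
Qed.

Lemma cvg1Z c F f : cvg1 F f -> cvg1 (fun n x => c * F n x) (fun x => c * f x).
Proof.
move=> [iF fi Ff].
apply: (@cvg1_squeeze _ _ (fun n => `|c| * nrm1 (fun x => F n x - f x))).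
- by move=> n; apply: L1Z.
- exact: L1Z.
- move=> n; rewrite -RintZ; last exact/L1_norm/L1B.
  apply: Rint_le => [||x]; last by rewrite -mulrBr normrM.
    by apply: L1_norm; apply: L1B; apply: L1Z.
  by apply: L1Z; apply: L1_norm; apply: L1B.
- by rewrite -[0](mulr0 `|c|); apply: cvgMr.
Qed.

Lemma cvg1B F f G g : cvg1 F f -> cvg1 G g ->
  cvg1 (fun n x => F n x - G n x) (fun x => f x - g x).
Proof.
move=> cF /(cvg1Z (-1)) cG; have := cvg1D cF cG.
congr cvg1; first by apply/funext => n; apply/funext => x; ring.
by apply/funext => x; ring.
Qed.

Lemma cvg2_cst f : L2 f -> cvg2 (fun=> f) f.
Proof.
move=> fi; split => //; rewrite [X in X @ _ --> _](_ : _ = fun=> 0); first exact: cvg_cst.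
apply/funext => n; rewrite /nrm2 (@eq_Rintegral _ _ _ _ _ (fun=> 0)).
  by rewrite Rintegral_cst// mul0r.
by move=> x _; rewrite subrr expr0n.
Qed.

Lemma cvg_sqrt0 (u : R^nat) : (forall n, 0 <= u n) -> u @ \oo --> 0 ->
  Num.sqrt (u n) @[n --> \oo] --> 0.
Proof.
move=> u0 uc; rewrite -(@sqrtr0 R).
by apply: (@continuous_cvg _ _ _ _ _ _ _ _ _ uc); exact: sqrt_continuous.
Qed.

Lemma cvg1_mul F f G g : cvg2 F f -> cvg2 G g ->
  cvg1 (fun n x => F n x * G n x) (fun x => f x * g x).
Proof.
move=> [iF fi Ff] [iG gi Gg].
pose a n := Num.sqrt (nrm2 (fun x => F n x - f x)).
pose b n := Num.sqrt (nrm2 (fun x => G n x - g x)).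
have a0 : a @ \oo --> 0 by apply: cvg_sqrt0 => // n; exact: nrm2_ge0.
have b0 : b @ \oo --> 0 by apply: cvg_sqrt0 => // n; exact: nrm2_ge0.
apply: (@cvg1_squeeze _ _ (fun n => a n * b n + Num.sqrt (nrm2 f) * b n +
  a n * Num.sqrt (nrm2 g))).
- by move=> n; apply: L2_mul.
- exact: L2_mul.
- move=> n; rewrite (_ : (fun x => _) = fun x =>
    ((F n x - f x) * (G n x - g x) + f x * (G n x - g x)) + (F n x - f x) * g x); last first.
    by apply/funext => x; ring.
  have h1 : L2 (fun x => F n x - f x) by exact: L2B.
  have h2 : L2 (fun x => G n x - g x) by exact: L2B.
  apply: (le_trans (nrm1_tri _ _)); [by apply: L1D; apply: L2_mul|exact: L2_mul|].
  rewrite lerD//; last exact: nrm1_mul.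
  apply: (le_trans (nrm1_tri _ _)); [exact: L2_mul|exact: L2_mul|].
  by rewrite lerD//; exact: nrm1_mul.
- rewrite [X in _ --> X](_ : _ = 0 * 0 + Num.sqrt (nrm2 f) * 0 + 0 * Num.sqrt (nrm2 g)).
    by apply: cvgD; [apply: cvgD|]; [apply: cvgM|apply: cvgMr|apply: cvgMl].
  by rewrite !mul0r mulr0 !addr0.
Qed.

Lemma cvg1_int F f : cvg1 F f ->
  (\int[mu]_x F n x) @[n --> \oo] --> \int[mu]_x f x.
Proof.
move=> [iF fi Ff]; apply/cvgrPdistC_lt => e e0.
have /cvgr0Pnorm_lt/(_ e e0) := Ff; apply: filterS => n.
apply: le_lt_trans; rewrite (ger0_norm (nrm1_ge0 _)).
rewrite -RintB//.
by apply: le_normr_Rintegral => //; exact: L1B.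
Qed.

Lemma L1_dct (F : (X -> R)^nat) f g : (forall n, measurable_fun setT (F n)) ->
  measurable_fun setT f -> L1 g ->
  {ae mu, forall x, forall n, `|F n x| <= g x} ->
  {ae mu, forall x, F n x @[n --> \oo] --> f x} -> cvg1 F f.
Proof.
move=> mF mf gi Fg Ff.
have iF n : L1 (F n).
  apply: L1_lty => //; apply: (@le_lt_trans _ _ (\int[mu]_x `|g x|%:E)%E).
    apply: ae_ge0_le_integral => //.
    - exact: measurable_enorm.
    - exact/measurable_enorm/L1_meas.
    - by apply: filterS Fg => x h _; rewrite lee_fin (le_trans (h n))// ler_norm.
  by rewrite nrm1_fin// ltry.
have Ff' : {ae mu, forall x, setT x -> (F n x)%:E @[n --> \oo] --> (f x)%:E}.
  by apply: filterS Ff => x h _; apply: cvg_EFin; [exact: nearW|exact: h].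
have Fg' : {ae mu, forall x n, setT x -> (`|(F n x)%:E| <= (g x)%:E)%E}.
  by apply: filterS Fg => x h n _; rewrite /= lee_fin.
have [fi h _] := @dominated_convergence _ _ _ mu setT measurableT
  (fun n x => (F n x)%:E) (EFin \o f) (EFin \o g)
  (fun n => iffRL (measurable_EFinP _ _) (mF n))
  (iffRL (measurable_EFinP _ _) mf) Ff' gi Fg'.
split => //; apply/fine_cvg; move: h; apply: cvg_trans; apply: near_eq_cvg.
by apply: nearW => n /=; apply: eq_integral.
Qed.

Lemma nrm1_eq0_ae f : L1 f -> nrm1 f = 0 -> {ae mu, forall x, f x = 0}.
Proof.
move=> fi f0.
have : (\int[mu]_(x in setT) `|(f x)%:E| = 0)%E by rewrite /= nrm1_fin// f0.
move/ae_eq_integral_abs => /(_ measurableT (iffRL (measurable_EFinP _ _) (L1_meas fi))).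
by apply: filterS => x /= /(_ I) -[].
Qed.

Lemma cvg1_unique F f g : cvg1 F f -> cvg1 F g -> {ae mu, forall x, f x = g x}.
Proof.
move=> cf cg; have [iF fi _] := cf; have [_ gi _] := cg.
have [_ _ h] := cvg1B cf cg.
have : nrm1 (fun x => f x - g x) = 0.
  have : (fun=> nrm1 (fun x => f x - g x)) @ \oo --> (0 : R).
    rewrite (_ : (fun=> _) = (fun n : nat => nrm1 (fun x => F n x - F n x - (f x - g x))))//.
    apply/funext => n; apply: eq_Rintegral => x _.
    by rewrite subrr sub0r normrN.
  by move/(cvg_lim (@Rhausdorff R)); rewrite lim_cst.
move/nrm1_eq0_ae => /(_ (L1B fi gi)); apply: filterS => x /eqP.
by rewrite subr_eq0 => /eqP.
Qed.

End integrable_functions.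

(** * Translations and convolution *)

Section measure_preserving.
Context d1 d2 (X : measurableType d1) (Y : measurableType d2) (R : realType).
Variables (mu : {measure set X -> \bar R}) (nu : {measure set Y -> \bar R}).

Definition mpres (phi : X -> Y) := measurable_fun setT phi /\
  forall A, measurable A -> nu A = mu (phi @^-1` A).

Variable phi : X -> Y.
Hypothesis hphi : mpres phi.

Lemma mpres_ge0_integral (f : Y -> \bar R) : measurable_fun setT f ->
  (forall y, (0 <= f y)%E) -> (\int[nu]_y f y = \int[mu]_x f (phi x))%E.
Proof.
move=> mf f0; have [mphi nuE] := hphi.
have := @ge0_integral_pushforward _ _ _ _ _ _ mphi mu setT f measurableT mf (fun y _ => f0 y).
rewrite preimage_setT => <-.
by apply: eq_measure_integral => A mA _; exact: nuE.
Qed.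

Lemma mpres_L1 (f : Y -> R) : L1 nu f -> L1 mu (f \o phi).
Proof.
move=> fi; have mf := L1_meas fi; have [mphi nuE] := hphi.
apply: L1_lty; first exact: measurableT_comp.
rewrite -(@mpres_ge0_integral (fun y => `|f y|%:E)).
- by rewrite nrm1_fin// ltry.
- by apply/measurable_EFinP; exact: measurableT_comp.
- by move=> y; rewrite lee_fin.
Qed.

Lemma mpres_Rint (f : Y -> R) : L1 nu f ->
  \int[nu]_y f y = \int[mu]_x f (phi x).
Proof.
move=> fi; have mf := L1_meas fi; have [mphi nuE] := hphi.
congr fine.
have := @integral_pushforward _ _ _ _ _ _ mphi mu setT (EFin \o f).
rewrite preimage_setT => /(_ _ _ measurableT) <-.
- by apply: eq_measure_integral => A mA _; exact: nuE.
- exact/measurable_EFinP.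
- exact: (mpres_L1 fi).
Qed.

End measure_preserving.

Section mpres_prod.
Context d1 d2 (X : measurableType d1) (Y : measurableType d2) (R : realType).
Variables (mu : {sigma_finite_measure set X -> \bar R}).
Variables (nu : {sigma_finite_measure set Y -> \bar R}).

(** Uniqueness of the product measure: the push-forward has the right value on measurable
    rectangles. *)
Lemma mpres_prod (phi : X -> X) (psi : Y -> Y) : mpres mu mu phi -> mpres nu nu psi ->
  mpres (mu \x nu)%E (mu \x nu)%E (fun z => (phi z.1, psi z.2)).
Proof.
move=> [mphi muE] [mpsi nuE].
have mf : measurable_fun setT (fun z : X * Y => (phi z.1, psi z.2)).
  by apply: measurable_fun_pair; apply: measurableT_comp.
split => // A mA.
apply: (@product_measure_unique _ _ _ _ _ mu nu
  (pushforward (mu \x nu)%E (fun z => (phi z.1, psi z.2)) : {measure set _ -> \bar R})) => // B C mB mC.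
rewrite /= /pushforward.
rewrite (_ : _ @^-1` _ = (phi @^-1` B) `*` (psi @^-1` C))//.
rewrite product_measure1E//.
- by rewrite -muE// -nuE.
- by rewrite -[X in measurable X]setTI; exact: mphi.
- by rewrite -[X in measurable X]setTI; exact: mpsi.
Qed.

Lemma mpres_swap : mpres (mu \x nu)%E (nu \x mu)%E (fun z => (z.2, z.1)).
Proof.
have mf : measurable_fun setT (fun z : X * Y => (z.2, z.1)).
  by apply: measurable_fun_pair.
split => // A mA.
apply: (@product_measure_unique _ _ _ _ _ nu mu
  (pushforward (mu \x nu)%E (fun z => (z.2, z.1)) : {measure set _ -> \bar R})) => // B C mB mC.
rewrite /= /pushforward.
rewrite (_ : _ @^-1` _ = C `*` B); last by apply/seteqP; split => -[x y] [].
by rewrite product_measure1E// muleC.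
Qed.

Lemma mpres_id : mpres mu mu idfun.
Proof. by split => //; exact: measurable_id. Qed.

End mpres_prod.

Section fubini_real.
Context d1 d2 (X : measurableType d1) (Y : measurableType d2) (R : realType).
Variables (mu : {sigma_finite_measure set X -> \bar R}).
Variables (nu : {sigma_finite_measure set Y -> \bar R}).

Lemma L1_slice (f : X * Y -> R) : L1 (mu \x nu)%E f ->
  {ae mu, forall x, L1 nu (fun y => f (x, y))}.
Proof. by move=> fi; exact: (ae_integrable1 fi). Qed.

Lemma L1_int (f : X * Y -> R) : L1 (mu \x nu)%E f ->
  L1 mu (fun x => \int[nu]_y f (x, y)).
Proof.
move=> fi; have := integrable_fubini_F fi; rewrite /fubini_F => h.
have mF : measurable_fun setT (fun x => \int[nu]_y f (x, y)).
  by apply: measurableT_comp (measurable_int _ h).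
apply: L1_lty => //.
have [_] := integrableP _ _ _ h; apply: le_lt_trans.
apply: ae_ge0_le_integral => //.
- exact: measurable_enorm.
- by apply: measurableT_comp => //; exact: measurable_int h.
- have := L1_slice fi; apply: filterS => x fx _.
  by rewrite RintE.
Qed.

Lemma fubini_Rint (f : X * Y -> R) : L1 (mu \x nu)%E f ->
  \int[(mu \x nu)%E]_z f z = \int[mu]_x \int[nu]_y f (x, y).
Proof.
move=> fi; rewrite /Rintegral -(integral12_prod_meas1 fi); congr fine.
apply: ae_eq_integral => //.
- exact: measurable_fubini_F fi.
- by apply/measurable_EFinP; apply: L1_meas; exact: (L1_int fi).
- have := L1_slice fi; apply: filterS => x fx _.
  by rewrite /fubini_F -RintE.
Qed.

(** Tonelli's criterion. The slice condition is asked only almost everywhere, because slices of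
    integrable functions satisfy no more than that. *)
Lemma L1_prod (f : X * Y -> R) (g : X -> R) : measurable_fun setT f ->
  L1 mu g -> {ae mu, forall x, L1 nu (fun y => f (x, y)) /\
    \int[nu]_y `|f (x, y)| <= g x} -> L1 (mu \x nu)%E f.
Proof.
move=> mf gi fg; apply: L1_lty => //.
rewrite fubini_tonelli1//=; last by apply/measurable_EFinP; apply: measurableT_comp.
apply: (@le_lt_trans _ _ (\int[mu]_x `|g x|%:E)%E); last by rewrite nrm1_fin// ltry.
apply: ae_ge0_le_integral => //.
- by move=> x _; apply: integral_ge0 => y _; rewrite lee_fin.
- apply: (measurable_fun_fubini_tonelli_F (fun z => `|f z|%:E)) => //.
    by apply/measurable_EFinP; apply: measurableT_comp.
- exact: measurable_enorm (L1_meas gi).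
- move: fg; apply: filterS => x [fx fgx] _.
  by rewrite /fubini_F nrm1_fin// lee_fin (le_trans fgx)// ler_norm.
Qed.

(** Dominated convergence applied to the norms of the slices. It lifts limits known on one line, or
    at one time, to the plane or to space-time. *)
Lemma fubini_dominated (f : nat -> X * Y -> R) (g : X -> R) :
  (forall n, measurable_fun setT (f n)) -> L1 mu g ->
  {ae mu, forall x, forall n, L1 nu (fun y => f n (x, y)) /\
     nrm1 nu (fun y => f n (x, y)) <= g x} ->
  {ae mu, forall x, nrm1 nu (fun y => f n (x, y)) @[n --> \oo] --> 0} ->
  (forall n, L1 (mu \x nu)%E (f n)) /\
  nrm1 (mu \x nu)%E (f n) @[n --> \oo] --> 0.
Proof.
move=> mf gi fg f0.
have fi n : L1 (mu \x nu)%E (f n).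
  by apply: (L1_prod (mf n) gi); apply: filterS fg => x /(_ n).
split => //.
pose F n x := nrm1 nu (fun y => f n (x, y)).
have Fi n : L1 mu (F n) by apply: (@L1_int (fun z => `|f n z|)); exact: L1_norm.
have /cvg1_int : cvg1 mu F (fun=> 0).
  apply: (L1_dct (fun n => L1_meas (Fi n)) _ gi) => //.
  by apply: filterS fg => x h n; rewrite ger0_norm ?nrm1_ge0//; case: (h n).
rewrite Rintegral_cst// mul0r; apply: cvg_trans; apply: near_eq_cvg.
by apply: nearW => n /=; rewrite /F -(fubini_Rint (L1_norm (fi n))).
Qed.

End fubini_real.

(** * Continuity of translations in [L1] *)

Section translation.
Context {R : realType}.
Local Notation mR := (measurableTypeR R).
Local Notation leb := (@lebesgue_measure R).

Lemma mpres_reflect (c : R) : mpres leb leb (fun x : mR => c - x : mR).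
Proof.
have mf : measurable_fun setT (fun x : mR => c - x : mR).
  exact: measurable_funB.
split => // A mA.
apply: (@lebesgue_measure_unique R
  (pushforward leb (fun x : mR => c - x : mR) : {measure set _ -> \bar R})) => //.
move=> _ [[a b]] _ <-; rewrite /= /pushforward.
(* Reflection exchanges the open and the closed end; the length does not notice. *)
rewrite (_ : _ @^-1` _ = `[c - b, c - a[%classic).
  rewrite !lebesgue_measure_itv/= !lte_fin; case: ifPn => ab.
    by rewrite ifT; [rewrite -!EFinB; congr EFin; ring|lra].
  by rewrite ifF//; apply/negbTE; lra.
by apply/seteqP; split => x /=; rewrite !in_itv/= => /andP[? ?]; apply/andP; split; lra.
Qed.

Lemma mpres_shift (c : R) : mpres leb leb (fun x : mR => x - c : mR).
Proof.
have mf : measurable_fun setT (fun x : mR => x - c : mR).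
  exact: measurable_funB.
split => // A mA.
apply: (@lebesgue_measure_unique R
  (pushforward leb (fun x : mR => x - c : mR) : {measure set _ -> \bar R})) => //.
move=> _ [[a b]] _ <-; rewrite /= /pushforward.
rewrite (_ : _ @^-1` _ = `]a + c, b + c]%classic).
  rewrite !lebesgue_measure_itv/= !lte_fin; case: ifPn => ab.
    by rewrite ifT; [rewrite -!EFinB; congr EFin; ring|lra].
  by rewrite ifF//; apply/negbTE; lra.
by apply/seteqP; split => x /=; rewrite !in_itv/= => /andP[? ?]; apply/andP; split; lra.
Qed.

Lemma ae_neq (c : R) : {ae leb, forall x : mR, (x : R) != c}.
Proof.
exists [set c]; split; [exact: measurable_set1|exact: lebesgue_measure_set1|].
by move=> x /= /negP; rewrite negbK => /eqP.
Qed.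

Lemma indic_sym (N x : R) : \1_(`[- N, N]%classic : set R) x = (`|x| <= N)%R%:R :> R.
Proof. by rewrite indicE mem_setE in_itv/= ler_norml. Qed.

Lemma L1_truncate (g : R -> R) : L1 leb g ->
  cvg1 leb (fun n x => \1_(`[- n%:R, n%:R]%classic : set R) x * g x) g.
Proof.
move=> gi; have mg := L1_meas gi.
apply: (@L1_dct _ _ _ leb _ _ (fun x => `|g x|)) => //.
- by move=> n; apply: measurable_funM => //; exact: measurable_indic.
- exact: L1_norm.
- apply: aeW => x n; rewrite normrM ler_piMl// indicE.
  by case: (_ \in _); rewrite ?normr1 ?normr0.
- apply: aeW => x; apply: cvg_near_cst.
  have [n0 _ h] := nbhs_infty_ger `|x|.
  exists n0 => // n /= /h xn; rewrite indicE mem_set ?mul1r//= in_itv/=.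
  by rewrite -ler_norml.
Qed.

(** Here [psi] is a continuous function cut off sharply at [|x| = N]. It may jump at those two
    points, whence the restriction [|x| != N], which is harmless under dominated convergence. *)
Lemma L1_dense (g : R -> R) (e : R) : L1 leb g -> 0 < e ->
  exists psi : R -> R, exists M N : R,
    [/\ L1 leb psi, forall x, `|psi x| <= M,
      forall x, N < `|x| -> psi x = 0,
      (forall x (s : R^nat), `|x| != N -> s @ \oo --> 0 ->
        psi (x - s n) @[n --> \oo] --> psi x) &
      nrm1 leb (fun x => g x - psi x) <= e].
Proof.
move=> gi e0; have mg := L1_meas gi.
have [iF _ /cvgr0Pnorm_lt/(_ (e / 2))] := L1_truncate gi.
rewrite divr_gt0// => /(_ isT)[n _ /(_ n (leqnn n))]; set E := (`[_, _]%classic : set R).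
rewrite (ger0_norm (nrm1_ge0 _ _)) => gE.
have mE : measurable (E : set mR) by exact: measurable_itv.
have Efin : (leb E < +oo)%E by rewrite lebesgue_measure_itv/=; case: ifP => _; rewrite ltry.
have gEi : leb.-integrable E (EFin \o g) by exact: integrableS gi.
have [phi_ [cphi iphi phig]] := approximation_continuous_integrable mE Efin gEi.
have [m hm] : exists m, (\int[leb]_(z in E) `|(g z - phi_ m z)%:E| < (e / 2)%:E)%E.
  have e2 : 0 < e / 2 by rewrite divr_gt0.
  move/fine_cvgP : phig => [fphi /cvgr0Pnorm_lt/(_ _ e2)/= hphi].
  have [m _ /(_ m (leqnn m)) [h1 h2]] := filterI fphi hphi.
  exists m; rewrite -(fineK h1) lte_fin (le_lt_trans _ h2)//; exact: ler_norm.
pose phi := phi_ m; pose psi x := \1_E x * phi x.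
have mphi : measurable_fun setT (phi : mR -> mR).
  by apply: continuous_measurable_fun; exact: cphi.
have mpsi : measurable_fun setT (psi : mR -> mR).
  by apply: measurable_funM => //; exact: measurable_indic.
have ipsi : L1 leb psi.
  have : L1 leb (phi \_ E).
    by rewrite /L1 -restrict_EFin -integrable_mkcond//; exact: iphi.
  congr L1; apply/funext => x; rewrite /psi patchE indicE.
  by case: (x \in E); rewrite ?mul1r ?mul0r.
have /compact_bounded[M [_ hM]] : compact (phi @` E).
  apply: continuous_compact; last exact: segment_compact.
  exact/continuous_subspaceT/cphi.
exists psi, (`|M| + 1), n%:R; split => //.
- move=> x; rewrite /psi indicE; case: (boolP (x \in E)) => [/set_mem xE|_]; last first.
    by rewrite mul0r normr0 addr_ge0.
  rewrite mul1r; apply: hM; last by exists x.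
  by rewrite (le_lt_trans (ler_norm _))// ltrDl.
- by move=> x nx; rewrite /psi indic_sym leNgt nx mul0r.
- move=> x s xn s0.
  have xs : (x - s n) @[n --> \oo] --> x.
    by rewrite -[X in _ --> X]subr0; apply: cvgB => //; exact: cvg_cst.
  have nxs : `|x - s n| @[n --> \oo] --> `|x| by exact: cvg_norm.
  have [xlt|xgt] := ltP `|x| n%:R.
    have -> : psi x = phi x.
      by rewrite /psi indic_sym ltW ?mul1r.
    apply: (@cvg_trans _ (phi (x - s k) @[k --> \oo])).
      apply: near_eq_cvg.
      have hk : \forall k \near \oo, `|x - s k| < n%:R by exact: cvgr_lt nxs _ xlt.
      apply: filterS hk => k kn.
      by rewrite /psi indic_sym ltW ?mul1r.
    by apply: continuous_cvg => //; exact: cphi.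
  have {}xgt : n%:R < `|x| by rewrite lt_neqAle eq_sym xn.
  have -> : psi x = 0.
    by rewrite /psi indic_sym leNgt ?xgt ?kn mul0r.
  apply: cvg_near_cst; have hk : \forall k \near \oo, n%:R < `|x - s k| by exact: cvgr_gt nxs _ xgt.
  apply: filterS hk => k kn.
  by rewrite /psi indic_sym leNgt ?xgt ?kn mul0r.
- rewrite (_ : (fun x => _) = fun x => (g x - \1_E x * g x) + (\1_E x * g x - psi x)); last first.
    by apply/funext => x; ring.
  have iEg : L1 leb (fun x => \1_E x * g x) by exact: iF.
  apply: (le_trans (nrm1_tri _ _)); [exact: L1B|exact: L1B|].
  rewrite (splitr e) lerD//.
    rewrite ltW//; apply: le_lt_trans gE; rewrite le_eqVlt; apply/orP; left; apply/eqP.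
    by apply: eq_Rintegral => x _; rewrite distrC.
  rewrite -lee_fin -nrm1_fin; last exact: L1B.
  apply: le_trans (ltW hm); rewrite [leRHS]integral_mkcond.
  rewrite le_eqVlt; apply/orP; left; apply/eqP; apply: eq_integral => x _.
  rewrite /psi patchE indicE; case: (x \in E); last by rewrite !mul0r subr0 normr0.
  by rewrite !mul1r.
Qed.

(** Density argument: the claim holds for [psi] by dominated convergence, and the two errors made in
    replacing [g] by [psi] are equal by translation invariance. *)
Lemma shift_cvg1 (g : R -> R) (s : R^nat) : L1 leb g -> s @ \oo --> 0 ->
  nrm1 leb (fun x => g (x - s n) - g x) @[n --> \oo] --> 0.
Proof.
move=> gi s0; apply/cvgr0Pnorm_lt => e e0.
have e4 : 0 < e / 4 by rewrite divr_gt0.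
have [psi [M [N [ipsi psiM psiN psic gpsi]]]] := L1_dense gi e4.
have sh c f : L1 leb f -> L1 leb (fun x => f (x - c)).
  by move=> fi; exact: (mpres_L1 (mpres_shift c) fi).
have [_ _ /cvgr0Pnorm_lt/(_ _ e4)] : cvg1 leb (fun n x => psi (x - s n)) psi.
  pose G x := M * \1_(`[- (N + 1), N + 1]%classic : set R) x.
  have iG : L1 leb G.
    apply: L1Z; rewrite /L1 -[EFin \o _]/(EFin \o \1_ _).
    by apply: integrable_indic_itv.
  (* Shifts longer than [1] occur finitely often. Suppressing them gives a dominating function
     supported in [[-(N + 1), N + 1]], up to [|psi|], that is valid for every [n]. *)
  pose F n x := if `|s n| <= 1 then psi (x - s n) else psi x.
  have [h1 h2 h3] : cvg1 leb F psi.
    apply: (@L1_dct _ _ _ leb _ _ (fun x => `|psi x| + G x)).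
    - move=> n; apply: (@L1_meas _ _ _ leb); rewrite /F.
      by have [_|_] := boolP (`|s n| <= 1) => //=; exact: sh.
    - exact: (L1_meas ipsi).
    - by apply: L1D => //; exact: L1_norm.
    - have M0 : 0 <= M by exact: le_trans (psiM 0).
      apply: aeW => x n; rewrite /F; case: ifP => sn; last first.
        by rewrite lerDl /G mulr_ge0// indicE.
      apply: (@le_trans _ _ (G x)); last by rewrite lerDr.
      rewrite /G indic_sym; case: (leP `|x| (N + 1)) => xN; first by rewrite mulr1.
      rewrite psiN ?normr0 ?mulr0//; have := lerB_dist x (s n); lra.
    - have := ae_neq N; apply: filter_app; have := ae_neq (- N); apply: filterS => x xN' xN.
      apply: (@cvg_trans _ (psi (x - s n) @[n --> \oo])).
        apply: near_eq_cvg; have /cvgr0Pnorm_le/(_ 1 ltr01) := s0.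
        by apply: filterS => n sn; rewrite /F sn.
      apply: psic => //; apply: contra_neq xN => xN''.
      move: xN'; rewrite -xN''; by case: (ger0P x) => // x0; rewrite opprK eqxx.
  split; [by move=> n; exact: sh|by []|].
  apply: cvg_trans h3; apply: near_eq_cvg; have /cvgr0Pnorm_le/(_ 1 ltr01) := s0.
  by apply: filterS => n sn; rewrite /F sn.
apply: filterS => n; rewrite !(ger0_norm (nrm1_ge0 _ _)) => hn.
have i1 : L1 leb (fun x => g x - psi x) by exact: L1B.
have i2 : L1 leb (fun x => g (x - s n) - psi (x - s n)) by exact: (sh _ _ i1).
have i3 : L1 leb (fun x => psi (x - s n) - psi x) by apply: L1B => //; exact: sh.
have -> : (fun x => g (x - s n) - g x) = (fun x => (g (x - s n) - psi (x - s n)) +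
    (psi (x - s n) - psi x) + - (g x - psi x)) by apply/funext => x; ring.
have e1 : nrm1 leb (fun x => g (x - s n) - psi (x - s n)) = nrm1 leb (fun x => g x - psi x).
  by apply/esym; exact: (mpres_Rint (mpres_shift (s n)) (L1_norm i1)).
have e2 : nrm1 leb (fun x => - (g x - psi x)) = nrm1 leb (fun x => g x - psi x).
  by apply: eq_Rintegral => x _; rewrite normrN.
have := nrm1_tri (L1D i2 i3) (L1N i1); have := nrm1_tri i2 i3.
rewrite e1 e2; lra.
Qed.

Local Notation leb2 := (@leb2 R).

Lemma L1_swap2 (g : R * R -> R) : L1 leb2 g -> L1 leb2 (fun x => g (x.2, x.1)).
Proof. by move=> gi; exact: (mpres_L1 (mpres_swap leb leb) gi). Qed.

Lemma mpres_shift2 (c : R * R) :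
  mpres leb2 leb2 (fun x => (x.1 - c.1, x.2 - c.2)).
Proof. exact: (mpres_prod (mpres_shift c.1) (mpres_shift c.2)). Qed.

Lemma mpres_reflect2 (c : R * R) :
  mpres leb2 leb2 (fun x => (c.1 - x.1, c.2 - x.2)).
Proof. exact: (mpres_prod (mpres_reflect c.1) (mpres_reflect c.2)). Qed.

Lemma shift2r_cvg1 (g : R * R -> R) (s : R^nat) : L1 leb2 g -> s @ \oo --> 0 ->
  nrm1 leb2 (fun x => g (x.1, x.2 - s n) - g x) @[n --> \oo] --> 0.
Proof.
move=> gi s0; pose f n (x : R * R) := g (x.1, x.2 - s n) - g x.
have fi n : L1 leb2 (f n).
  apply: L1B => //; have := mpres_L1 (mpres_shift2 (0, s n)) gi.
  by congr L1; apply/funext => x /=; rewrite subr0.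
have [] := @fubini_dominated _ _ _ _ _ leb leb f
  (fun x => 2 * nrm1 leb (fun y => g (x, y))).
- by move=> n; exact: L1_meas.
- by apply: L1Z; exact: (L1_int (L1_norm gi)).
- have := L1_slice gi; apply: filterS => x gx n.
  have gx' : L1 leb (fun y => g (x, y - s n)) by exact: (mpres_L1 (mpres_shift (s n)) gx).
  split; first exact: L1B.
  have := nrm1_tri gx' (L1N gx).
  have -> : nrm1 leb (fun y => g (x, y - s n)) = nrm1 leb (fun y => g (x, y)).
    by apply/esym; exact: (mpres_Rint (mpres_shift (s n)) (L1_norm gx)).
  have -> : nrm1 leb (fun y => - g (x, y)) = nrm1 leb (fun y => g (x, y)).
    by apply: eq_Rintegral => y _; rewrite normrN.
  by move=> h; apply: (le_trans h); lra.
- have := L1_slice gi; apply: filterS => x gx.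
  exact: (shift_cvg1 gx s0).
- by [].
Qed.

(** One coordinate is shifted at a time. The error of the first shift, computed after the second
    one, is the same without it by invariance, and exchanging the coordinates reduces it to the
    previous lemma. *)
Lemma shift2_cvg1 (g : R * R -> R) (s1 s2 : R^nat) : L1 leb2 g ->
  s1 @ \oo --> 0 -> s2 @ \oo --> 0 ->
  nrm1 leb2 (fun x => g (x.1 - s1 n, x.2 - s2 n) - g x) @[n --> \oo] --> 0.
Proof.
move=> gi s10 s20.
have h2 := shift2r_cvg1 gi s20; have h1 := shift2r_cvg1 (L1_swap2 gi) s10.
set F1 := (X in X @ _ --> _) in h1; set F2 := (X in X @ _ --> _) in h2.
have h12 : F1 n + F2 n @[n --> \oo] --> 0 by rewrite -[X in _ --> X]addr0; apply: cvgD.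
apply: (squeeze_cvgr _ (cvg_cst 0) h12).
apply: nearW => n; rewrite nrm1_ge0/=.
have sh1 : L1 leb2 (fun x => g (x.1 - s1 n, x.2)).
  have := mpres_L1 (mpres_shift2 (s1 n, 0)) gi.
  by congr L1; apply/funext => x /=; rewrite subr0.
have sh2 : L1 leb2 (fun x => g (x.1, x.2 - s2 n)).
  have := mpres_L1 (mpres_shift2 (0, s2 n)) gi.
  by congr L1; apply/funext => x /=; rewrite subr0.
have sh12 : L1 leb2 (fun x => g (x.1 - s1 n, x.2 - s2 n)).
  exact: (mpres_L1 (mpres_shift2 (s1 n, s2 n)) gi).
have i1 : L1 leb2 (fun x => g (x.1 - s1 n, x.2) - g x).
  by apply: L1B.
have e1 : nrm1 leb2 (fun x => g (x.1 - s1 n, x.2 - s2 n) - g (x.1, x.2 - s2 n)) =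
    nrm1 leb2 (fun x => g (x.2 - s1 n, x.1) - g (x.2, x.1)).
  transitivity (nrm1 leb2 (fun x => g (x.1 - s1 n, x.2) - g x)).
    rewrite [RHS](mpres_Rint (mpres_shift2 (0, s2 n)) (L1_norm i1)).
    by apply: eq_Rintegral => x _ /=; rewrite subr0.
  rewrite [LHS](mpres_Rint (mpres_swap leb leb) (L1_norm i1)).
  by apply: eq_Rintegral => x _.
have {}e1 : F1 n = _ := esym e1; rewrite e1.
apply: le_trans (nrm1_tri _ _); [|exact: L1B|exact: L1B].
by rewrite le_eqVlt; apply/orP; left; apply/eqP; congr nrm1; apply/funext => x; ring.
Qed.

(** Averaging over shifts needs uniformity in the shift. It follows by contradiction: a bad shift of
    size at most [1 / (n + 1)] for each [n] would violate the sequential statement. *)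
Lemma shift2_small (g : R * R -> R) (e : R) : L1 leb2 g -> 0 < e ->
  exists2 r : R, 0 < r & forall s1 s2, `|s1| <= r -> `|s2| <= r ->
    nrm1 leb2 (fun x => g (x.1 - s1, x.2 - s2) - g x) <= e.
Proof.
move=> gi e0; apply: contrapT => hn.
have key (n : nat) : exists s : R * R, [/\ `|s.1| <= n.+1%:R^-1, `|s.2| <= n.+1%:R^-1 &
    e < nrm1 leb2 (fun x => g (x.1 - s.1, x.2 - s.2) - g x)].
  apply: contrapT => hs; apply: hn; exists n.+1%:R^-1 => // s1 s2 h1 h2.
  by rewrite leNgt; apply/negP => h; apply: hs; exists (s1, s2).
have [s hs] := choice key.
have inv0 : (n.+1%:R^-1 : R) @[n --> \oo] --> 0 by exact: cvg_harmonic.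
have h1 : (s n).1 @[n --> \oo] --> 0.
  apply/norm_cvg0P; apply: (squeeze_cvgr _ (cvg_cst 0) inv0).
  by apply: nearW => n; rewrite normr_ge0; case: (hs n).
have h2 : (s n).2 @[n --> \oo] --> 0.
  apply/norm_cvg0P; apply: (squeeze_cvgr _ (cvg_cst 0) inv0).
  by apply: nearW => n; rewrite normr_ge0; case: (hs n).
have /cvgr0Pnorm_lt/(_ _ e0)[n _ /(_ n (leqnn n))] := shift2_cvg1 gi h1 h2.
rewrite ger0_norm ?nrm1_ge0//; case: (hs n) => _ _.
by move=> ? ?; lra.
Qed.

End translation.

Section measurable_Rint.
Context d1 d2 (X : measurableType d1) (Y : measurableType d2) (R : realType).
Variable nu : {sigma_finite_measure set Y -> \bar R}.

(** No integrability is assumed: positive and negative parts are handled by Tonelli, and [fine] is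
    measurable. Thus a convolution is measurable before anything is known about its convergence. *)
Lemma measurable_Rint (F : X * Y -> R) : measurable_fun setT F ->
  measurable_fun setT (fun x => \int[nu]_y F (x, y)).
Proof.
move=> mF.
apply: (@measurableT_comp _ _ _ _ _ _ fine _ (fun x => (\int[nu]_y (F (x, y))%:E)%E)) => //.
have mF' : measurable_fun setT (EFin \o F) by exact/measurable_EFinP.
under eq_fun do rewrite integralE.
apply: emeasurable_funB.
- have h : measurable_fun setT (fubini_F nu (EFin \o F)^\+%E).
    by apply: measurable_fun_fubini_tonelli_F => //; exact: measurable_funepos.
  apply: eq_measurable_fun h => x _; apply: eq_integral => y _.
  by rewrite !funeposE.
- have h : measurable_fun setT (fubini_F nu (EFin \o F)^\-%E).
    by apply: measurable_fun_fubini_tonelli_F => //; exact: measurable_funeneg.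
  apply: eq_measurable_fun h => x _; apply: eq_integral => y _.
  by rewrite !funenegE.
Qed.

End measurable_Rint.

(** * Convolution with bounded integrable kernels, and approximate identities *)

Section convolution.
Context {R : realType}.
Local Notation mR := (measurableTypeR R).
Local Notation mR2 := (mR * mR)%type.
Local Notation leb := (@lebesgue_measure R).
Local Notation leb2 := (@leb2 R).

Definition sub2 (x y : R * R) : R * R := (x.1 - y.1, x.2 - y.2).

(** Convolution of [g] with [K], defined at every point: [fine] supplies a value even where the
    integral does not converge. *)
Definition cv (K g : R * R -> R) (x : R * R) := \int[leb2]_y (g y * K (sub2 x y)).

(** Integrable and bounded, hence also square integrable: convolution with an [L1] or an [L2]
    function converges at every point, not just almost everywhere. *)
Record kern (K : R * R -> R) : Prop := Kern {
  kern_L1 : L1 leb2 K ;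
  kern_bounded : exists C, forall s, `|K s| <= C }.

Lemma measurable_sub2 : measurable_fun setT (fun z : mR2 * mR2 => sub2 z.1 z.2 : mR2).
Proof.
apply: measurable_fun_pair; apply: measurable_funB;
  by apply: measurableT_comp => //; apply: measurableT_comp.
Qed.

Lemma measurable_sub2r x : measurable_fun setT (fun y : mR2 => sub2 x y : mR2).
Proof. exact: (mpres_reflect2 x).1. Qed.

Lemma kern_norm K : kern K -> kern (fun s => `|K s|).
Proof.
move=> [iK [C KC]]; split; first exact: L1_norm.
by exists C => s; rewrite normr_id.
Qed.

Lemma kern_subr K x : kern K -> L1 leb2 (fun y => K (sub2 x y)).
Proof. by move=> [iK _]; exact: (mpres_L1 (mpres_reflect2 x) iK). Qed.

Lemma kern_subr_int K x : kern K -> \int[leb2]_y K (sub2 x y) = \int[leb2]_s K s.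
Proof. by move=> [iK _]; apply/esym; exact: (mpres_Rint (mpres_reflect2 x) iK). Qed.

Lemma kern_subl K y : kern K -> L1 leb2 (fun x => K (sub2 x y)).
Proof. by move=> [iK _]; exact: (mpres_L1 (mpres_shift2 y) iK). Qed.

Lemma kern_subl_int K y : kern K -> \int[leb2]_x K (sub2 x y) = \int[leb2]_s K s.
Proof. by move=> [iK _]; apply/esym; exact: (mpres_Rint (mpres_shift2 y) iK). Qed.

Lemma cv_L1ok K g x : kern K -> L1 leb2 g -> L1 leb2 (fun y => g y * K (sub2 x y)).
Proof.
move=> kK gi; have [_ [C KC]] := kK; under eq_fun do rewrite mulrC.
apply: (@L1_bound _ _ _ _ _ _ C) => //.
exact: (L1_meas (kern_subr x kK)).
Qed.

Lemma kern_subr_L2 K x : kern K -> L2 leb2 (fun y => K (sub2 x y)).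
Proof.
move=> kK; have [_ [C KC]] := kK.
have iK := kern_subr x kK; split; first exact: (L1_meas iK).
by apply: (cv_L1ok _ kK).
Qed.

Lemma cv_L2ok K g x : kern K -> L2 leb2 g -> L1 leb2 (fun y => g y * K (sub2 x y)).
Proof. by move=> kK gi; apply: L2_mul => //; exact: kern_subr_L2. Qed.

Lemma cv_prod_L1 K g : kern K -> L1 leb2 g ->
  L1 (@leb4 R) (fun z => g z.2 * K (sub2 z.1 z.2)) /\
  nrm1 (@leb4 R) (fun z => g z.2 * K (sub2 z.1 z.2)) = nrm1 leb2 g * nrm1 leb2 K.
Proof.
move=> kK gi; pose H (z : mR2 * mR2) := g z.1 * K (sub2 z.2 z.1).
have mH : measurable_fun setT H.
  apply: measurable_funM; first by apply: measurableT_comp (L1_meas gi) _.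
  apply: (measurableT_comp (L1_meas kK.(kern_L1))).
  apply: measurable_fun_pair; apply: measurable_funB;
    by apply: measurableT_comp => //; apply: measurableT_comp.
have eH y : \int[leb2]_x `|H (y, x)| = nrm1 leb2 K * `|g y|.
  rewrite /H /=; under eq_Rintegral do rewrite normrM.
  rewrite RintZ; last exact/L1_norm/kern_subl.
  by rewrite (kern_subl_int y (kern_norm kK)) mulrC.
have iH : L1 (@leb4 R) H.
  apply: (@L1_prod _ _ _ _ _ leb2 leb2 _ (fun y => nrm1 leb2 K * `|g y|)) => //.
  - by apply: L1Z; exact: L1_norm.
  - apply: aeW => y; split; first by rewrite /H/=; apply: L1Z; exact: kern_subl.
    by rewrite eH.
have -> : (fun z => g z.2 * K (sub2 z.1 z.2)) = (fun z : mR2 * mR2 => H (z.2, z.1)) by [].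
split; first exact: (mpres_L1 (mpres_swap leb2 leb2) iH).
transitivity (nrm1 (@leb4 R) H).
  by apply/esym; exact: (mpres_Rint (mpres_swap leb2 leb2) (L1_norm iH)).
rewrite /nrm1 [LHS](fubini_Rint (L1_norm iH)); under eq_Rintegral do rewrite eH.
by rewrite (RintZ (nrm1 leb2 K) (L1_norm gi)) mulrC.
Qed.

Lemma cv_L1 K g : kern K -> L1 leb2 g ->
  L1 leb2 (cv K g) /\ nrm1 leb2 (cv K g) <= nrm1 leb2 K * nrm1 leb2 g.
Proof.
move=> kK gi; have [iH eH] := cv_prod_L1 kK gi.
have i1 : L1 leb2 (cv K g) by exact: (L1_int iH).
split => //; rewrite mulrC -eH /nrm1 (fubini_Rint (L1_norm iH)).
apply: Rint_le; [exact: L1_norm|exact: (L1_int (L1_norm iH))|].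
move=> x; apply: le_normr_Rintegral => //; exact: cv_L1ok.
Qed.

(** Cauchy-Schwarz for the factors [f sqrt(w)] and [sqrt(w)]; for a weight of mass one this is
    Jensen's inequality for the square. *)
Lemma weighted_cauchy_schwarz (w f : R * R -> R) : (forall y, 0 <= w y) ->
  L1 leb2 w -> measurable_fun setT (f : mR2 -> mR) -> L1 leb2 (fun y => f y ^+ 2 * w y) ->
  (\int[leb2]_y (f y * w y)) ^+ 2 <=
  (\int[leb2]_y (f y ^+ 2 * w y)) * \int[leb2]_y w y.
Proof.
move=> w0 wi mf fwi; have mw := L1_meas wi.
have msw : measurable_fun setT (fun y : mR2 => Num.sqrt (w y)).
  by apply: measurableT_comp => //; apply: continuous_measurable_fun; exact: sqrt_continuous.
have sw : L2 leb2 (fun y => Num.sqrt (w y)).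
  split => //; move: wi; congr L1; apply/funext => y.
  by rewrite sqr_sqrtr.
have fsw : L2 leb2 (fun y => f y * Num.sqrt (w y)).
  split; first exact: measurable_funM.
  by move: fwi; congr L1; apply/funext => y; rewrite exprMn sqr_sqrtr.
have e y : f y * Num.sqrt (w y) * Num.sqrt (w y) = f y * w y.
  by rewrite -mulrA -expr2 sqr_sqrtr.
have := cauchy_schwarz fsw sw.
rewrite /nrm2 (_ : \int[leb2]_x _ = \int[leb2]_y (f y ^+ 2 * w y)); last first.
  by apply: eq_Rintegral => y _; rewrite exprMn sqr_sqrtr.
rewrite (_ : \int[leb2]_x (Num.sqrt (w x) ^+ 2) = \int[leb2]_y w y); last first.
  by apply: eq_Rintegral => y _; rewrite sqr_sqrtr.
apply: le_trans; rewrite -[leLHS]real_normK ?num_real// lerXn2r ?nnegrE ?nrm1_ge0//.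
have ifw : L1 leb2 (fun y => f y * w y).
  by have := L2_mul fsw sw; congr L1; apply/funext => y; exact: e.
rewrite (_ : nrm1 leb2 _ = \int[leb2]_y `|f y * w y|); last first.
  by apply: eq_Rintegral => y _; rewrite e.
exact: le_normr_Rintegral.
Qed.

Lemma cv_measurable K g : kern K -> measurable_fun setT (g : mR2 -> mR) ->
  measurable_fun setT (cv K g : mR2 -> mR).
Proof.
move=> kK mg.
apply: (@measurable_Rint _ _ _ _ _ leb2 (fun z => g z.2 * K (sub2 z.1 z.2))).
apply: measurable_funM; first exact: measurableT_comp mg _.
exact: (measurableT_comp (L1_meas kK.(kern_L1)) measurable_sub2).
Qed.

(** Young's inequality. The weighted Cauchy-Schwarz inequality bounds the squared convolution
    pointwise by [nrm1 K] times the convolution of [g ^ 2] with [|K|], and the [L1] case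
    finishes. *)
Lemma cv_L2 K g : kern K -> L2 leb2 g ->
  L2 leb2 (cv K g) /\ nrm2 leb2 (cv K g) <= nrm1 leb2 K ^+ 2 * nrm2 leb2 g.
Proof.
move=> kK gi; have kaK := kern_norm kK.
have [ic ec] := cv_L1 kaK gi.2.
have le x : cv K g x ^+ 2 <= nrm1 leb2 K * cv (fun s => `|K s|) (fun y => g y ^+ 2) x.
  have i2 : L1 leb2 (fun y => `|g y| ^+ 2 * `|K (sub2 x y)|).
    have := cv_L1ok x kaK gi.2; congr L1; apply/funext => y.
    by rewrite real_normK ?num_real.
  have := weighted_cauchy_schwarz (fun y => normr_ge0 _) (kern_subr x kaK)
    (measurableT_comp (@normr_measurable R setT) (L2_meas gi)) i2.
  rewrite (kern_subr_int x kaK) mulrC.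
  rewrite (_ : \int[leb2]_y (`|g y| ^+ 2 * _) =
      cv (fun s => `|K s|) (fun y => g y ^+ 2) x); last first.
    by apply: eq_Rintegral => y _; rewrite real_normK ?num_real.
  apply: le_trans; rewrite -[leLHS]real_normK ?num_real// lerXn2r ?nnegrE//.
    by apply: Rintegral_ge0 => y _; rewrite mulr_ge0//=.
  rewrite (_ : \int[leb2]_y _ = \int[leb2]_y `|g y * K (sub2 x y)|); last first.
    by apply: eq_Rintegral => y _; rewrite normrM.
  by apply: le_normr_Rintegral => //; exact: cv_L2ok.
have mc := cv_measurable kK (L2_meas gi).
have l2 : L2 leb2 (cv K g).
  split => //; apply: (L1_le _ _ (L1Z (nrm1 leb2 K) ic)); first exact: measurable_funX.
  by move=> x; rewrite ger0_norm ?sqr_ge0// (le_trans (le x))// ler_norm.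
split => //.
apply: (@le_trans _ _ (nrm1 leb2 K * nrm1 leb2 (cv (fun s => `|K s|) (fun y => g y ^+ 2)))).
  rewrite -RintZ; last exact: L1_norm.
  apply: Rint_le; [exact: l2.2|by apply: L1Z; exact: L1_norm|].
  move=> x; apply: (le_trans (le x)); rewrite ler_wpM2l ?nrm1_ge0//.
  exact: ler_norm.
rewrite expr2 -mulrA ler_wpM2l ?nrm1_ge0//; apply: (le_trans ec).
rewrite le_eqVlt; apply/orP; left; apply/eqP; congr (_ * _).
  by apply: eq_Rintegral => s _; rewrite normr_id.
by apply: eq_Rintegral => s _; rewrite ger0_norm// sqr_ge0.
Qed.

(** Probability densities concentrated on a square of half-width [r] around the origin. The square
    need not be filled symmetrically, which admits the one-sided profile [kap]. *)
Record pker (r : R) (K : R * R -> R) : Prop := PKer {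
  pker_kern : kern K ;
  pker_ge0 : forall s, 0 <= K s ;
  pker_int : \int[leb2]_s K s = 1 ;
  pker_supp : forall s, K s != 0 -> `|s.1| <= r /\ `|s.2| <= r }.

Lemma pker_nrm1 r K : pker r K -> nrm1 leb2 K = 1.
Proof.
move=> kK; rewrite -kK.(pker_int); apply: eq_Rintegral => s _.
by rewrite ger0_norm// kK.(pker_ge0).
Qed.

Lemma pker_avg_L1 r K g : pker r K -> L1 leb2 g ->
  L1 (@leb4 R) (fun z => K (sub2 z.1 z.2) * (g z.2 - g z.1)).
Proof.
move=> pK gi; have kK := pK.(pker_kern).
have [h1 _] := cv_prod_L1 kK gi.
have h2 : L1 (@leb4 R) (fun z => g z.1 * K (sub2 z.1 z.2)).
  apply: (@L1_prod _ _ _ _ _ leb2 leb2 _ (fun y => nrm1 leb2 K * `|g y|)).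
  - apply: measurable_funM; first exact: measurableT_comp (L1_meas gi) _.
    exact: (measurableT_comp (L1_meas kK.(kern_L1)) measurable_sub2).
  - by apply: L1Z; exact: L1_norm.
  - apply: aeW => x; split => /=; first by apply: L1Z; exact: kern_subr.
    under eq_Rintegral do rewrite normrM.
    rewrite RintZ; last exact/L1_norm/kern_subr.
    by rewrite (kern_subr_int x (kern_norm kK)) mulrC.
by have := L1B h1 h2; congr L1; apply/funext => z; ring.
Qed.

(* The double integral is an average over [s] of translation defects of [g]. *)
Lemma pker_avg_le r K g e : pker r K -> L1 leb2 g -> 0 <= e ->
  (forall s1 s2, `|s1| <= r -> `|s2| <= r ->
    nrm1 leb2 (fun x => g (x.1 - s1, x.2 - s2) - g x) <= e) ->
  nrm1 (@leb4 R) (fun z => K (sub2 z.1 z.2) * (g z.2 - g z.1)) <= e.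
Proof.
move=> pK gi e0 ge; have kK := pK.(pker_kern); have iH := pker_avg_L1 pK gi.
have mg := L1_meas gi; have mK := L1_meas kK.(kern_L1).
rewrite -lee_fin -nrm1_fin// fubini_tonelli1; last 2 first.
- exact: measurable_enorm (L1_meas iH).
- by move=> z; rewrite lee_fin.
rewrite /fubini_F /=.
pose F (z : mR2 * mR2) := `|K z.2 * (g (sub2 z.1 z.2) - g z.1)|%:E.
have mF : measurable_fun setT F.
  apply: measurable_enorm; apply: measurable_funM; first exact: measurableT_comp.
  apply: measurable_funB; last exact: measurableT_comp.
  by apply: measurableT_comp => //; exact: measurable_sub2.
have sub2K x y : sub2 x (sub2 x y) = y.
  by case: x y => [x1 x2] [y1 y2]; rewrite /sub2/=; congr pair; ring.
rewrite (_ : (\int[leb2]_x _)%E = (\int[leb2]_x \int[leb2]_s F (x, s))%E); last first.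
  apply: eq_integral => x _.
  rewrite (mpres_ge0_integral (mpres_reflect2 x)); last 2 first.
  - apply: measurable_enorm; apply: measurable_funM; first exact: (L1_meas (kern_subr x kK)).
    by apply: measurable_funB.
  - by move=> y; rewrite lee_fin.
  by apply: eq_integral => s _; rewrite /F /= -/(sub2 x s) sub2K.
rewrite fubini_tonelli//; last by move=> z; rewrite lee_fin.
apply: (@le_trans _ _ (\int[leb2]_s (e * K s)%:E)%E); last first.
  rewrite RintE; last exact/L1Z/kern_L1.
  by rewrite RintZ ?pK.(pker_int) ?mulr1//; exact: kern_L1.
apply: ge0_le_integral => //.
- by move=> s _; apply: integral_ge0 => x _; rewrite lee_fin.
- by apply: (measurable_fun_fubini_tonelli_G F) => // z; rewrite lee_fin.
- by apply/measurable_EFinP; apply: measurable_funM.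
move=> s _; rewrite /F /=.
have i1 : L1 leb2 (fun x => g (sub2 x s) - g x).
  by apply: L1B => //; exact: (mpres_L1 (mpres_shift2 s) gi).
have -> : (\int[leb2]_x `|K s * (g (sub2 x s) - g x)|%:E)%E =
    (K s * nrm1 leb2 (fun x => g (sub2 x s) - g x))%:E.
  rewrite nrm1_fin; last exact: L1Z.
  congr EFin; rewrite -RintZ; last exact: L1_norm.
  by apply: eq_Rintegral => x _; rewrite normrM ger0_norm// pK.(pker_ge0).
rewrite lee_fin mulrC; have [->|Ks] := eqVneq (K s) 0; first by rewrite !mulr0.
rewrite ler_wpM2r ?pK.(pker_ge0)//.
by have [s1 s2] := pK.(pker_supp) Ks; exact: ge.
Qed.

Section approximate_identity.
Variables (r : R^nat) (K : nat -> R * R -> R).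
Hypothesis r0 : r @ \oo --> 0.
Hypothesis pK : forall n, pker (r n) (K n).

Lemma pker_avg_cvg g : L1 leb2 g ->
  nrm1 (@leb4 R) (fun z => K n (sub2 z.1 z.2) * (g z.2 - g z.1)) @[n --> \oo] --> 0.
Proof.
move=> gi; apply/cvgr0Pnorm_le => e e0.
have [d d0 hd] := shift2_small gi e0.
have /cvgr0Pnorm_le/(_ _ d0) := r0; apply: filterS => n rn.
rewrite ger0_norm ?nrm1_ge0//; apply: (pker_avg_le (pK n) gi (ltW e0)) => s1 s2 h1 h2.
by apply: hd; [apply: (le_trans h1)|apply: (le_trans h2)]; apply: le_trans rn; exact: ler_norm.
Qed.

Lemma pker_cvB n g x : L1 leb2 (fun y => g y * K n (sub2 x y)) ->
  cv (K n) g x - g x = \int[leb2]_y (K n (sub2 x y) * (g y - g x)).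
Proof.
move=> gK; have kK := (pK n).(pker_kern); have iK := kern_subr x kK.
rewrite (_ : (fun y => _) = (fun y => g y * K n (sub2 x y) - g x * K n (sub2 x y))); last first.
  by apply/funext => y; ring.
rewrite RintB//; last exact: L1Z.
by rewrite RintZ// (kern_subr_int x kK) (pK n).(pker_int) mulr1.
Qed.

Lemma cv_cvg1 g : L1 leb2 g -> cvg1 leb2 (fun n => cv (K n) g) g.
Proof.
move=> gi; apply: (cvg1_squeeze _ gi _ (pker_avg_cvg gi)).
  by move=> n; exact: (cv_L1 (pK n).(pker_kern) gi).1.
move=> n; have kK := (pK n).(pker_kern); have iH := pker_avg_L1 (pK n) gi.
rewrite /nrm1 [leRHS](fubini_Rint (L1_norm iH)).
apply: Rint_le.
- by apply: L1_norm; apply: L1B => //; exact: (cv_L1 kK gi).1.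
- exact: (L1_int (L1_norm iH)).
- move=> x; rewrite pker_cvB; last exact: cv_L1ok.
  apply: le_normr_Rintegral => //.
  have := L1B (cv_L1ok x kK gi) (L1Z (g x) (kern_subr x kK)).
  by congr L1; apply/funext => y; ring.
Qed.

(** For equal signs the right side is [2 |a - b| |a + b|] with [|a + b| >= |a - b|]; for opposite
    signs it is [2 (a ^ 2 + b ^ 2)]. *)
Lemma sqrB_le (a b : R) : (a - b) ^+ 2 <= 2 * `|a * `|a| - b * `|b| |.
Proof.
have := ler_norm (a * `|a| - b * `|b|); have := ler_norm (- (a * `|a| - b * `|b|)).
rewrite normrN.
case: (ger0P a) => a0; case: (ger0P b) => b0 h1 h2.
- by have [ab|ab] := leP a b; nra.
- by have := sqr_ge0 (a + b); nra.
- by have := sqr_ge0 (a + b); nra.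
- by have [ab|ab] := leP a b; nra.
Qed.

Lemma L1_signed_sqr g : L2 leb2 g -> L1 leb2 (fun x => g x * `|g x|).
Proof. by move=> gi; apply: L2_mul => //; exact: L2_norm. Qed.

(* The elementary inequality above reduces the [L2] case to the [L1] one. *)
Lemma cv_cvg2 g : L2 leb2 g -> cvg2 leb2 (fun n => cv (K n) g) g.
Proof.
move=> gi; have Gi := L1_signed_sqr gi; set G := (fun x => _) in Gi.
have c0 : 2 * nrm1 (@leb4 R) (fun z => K n (sub2 z.1 z.2) * (G z.2 - G z.1)) @[n --> \oo] --> 0.
  by rewrite -[0 in X in _ --> X](mulr0 2); apply: cvgMr; exact: pker_avg_cvg.
apply: (cvg2_squeeze _ gi _ c0).
  by move=> n; exact: (cv_L2 (pK n).(pker_kern) gi).1.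
move=> n; have kK := (pK n).(pker_kern); have iH := pker_avg_L1 (pK n) Gi.
rewrite /nrm1 (fubini_Rint (L1_norm iH)) -RintZ; last exact: (L1_int (L1_norm iH)).
apply: Rint_le.
- by apply: (L2B _ gi).2; exact: (cv_L2 kK gi).1.
- exact/L1Z/(L1_int (L1_norm iH)).
- move=> x; rewrite pker_cvB; last exact: cv_L2ok.
  have i2 : L1 leb2 (fun y => (g y - g x) ^+ 2 * K n (sub2 x y)).
    have h1 := cv_L1ok x kK gi.2; have h2 := cv_L2ok x kK gi.
    have h3 := kern_subr x kK.
    have := L1D (L1B h1 (L1Z (2 * g x) h2)) (L1Z (g x ^+ 2) h3).
    by congr L1; apply/funext => y; ring.
  have mgg : measurable_fun setT ((fun y => g y - g x) : mR2 -> mR).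
    by apply: measurable_funB => //; exact: L2_meas gi.
  have := weighted_cauchy_schwarz (fun y => (pK n).(pker_ge0) _) (kern_subr x kK) mgg i2.
  rewrite (kern_subr_int x kK) (pK n).(pker_int) mulr1.
  rewrite (_ : \int[leb2]_y ((g y - g x) * _) = \int[leb2]_y (K n (sub2 x y) * (g y - g x))); last first.
    by apply: eq_Rintegral => y _; rewrite mulrC.
  move=> h; apply: (le_trans h).
  have i3 : L1 leb2 (fun y => K n (sub2 x y) * (G y - G x)).
    have := L1B (cv_L1ok x kK Gi) (L1Z (G x) (kern_subr x kK)).
    by congr L1; apply/funext => y; ring.
  rewrite -RintZ; last exact: L1_norm.
  apply: Rint_le => //; first by apply: L1Z; exact: L1_norm.
  move=> y; rewrite normrM (ger0_norm ((pK n).(pker_ge0) _)) mulrCA mulrC.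
  by rewrite ler_wpM2l ?(pK n).(pker_ge0)//; exact: sqrB_le.
Qed.

End approximate_identity.

End convolution.

Section ae_product.
Context d1 d2 (X : measurableType d1) (Y : measurableType d2) (R : realType).
Variables (mu : {sigma_finite_measure set X -> \bar R}).
Variables (nu : {sigma_finite_measure set Y -> \bar R}).

Lemma ae_prod1 (P : X -> Prop) : {ae mu, forall x, P x} ->
  {ae (mu \x nu)%E, forall z, P z.1}.
Proof.
move=> [N [mN N0 PN]]; exists (N `*` setT); split.
- exact: measurableX.
- transitivity (mu N * nu setT)%E; first exact: product_measure1E.
  by rewrite N0 mul0e.
- by move=> [x y] /= h; split => //; exact: PN.
Qed.

(** By Tonelli the integral of [|f - g|] vanishes. Joint measurability of both functions is
    essential for concluding from slices. *)
Lemma ae_prod_eq (f g : X * Y -> R) : measurable_fun setT f -> measurable_fun setT g ->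
  {ae mu, forall x, {ae nu, forall y, f (x, y) = g (x, y)}} ->
  {ae (mu \x nu)%E, forall z, f z = g z}.
Proof.
move=> mf mg fg; pose h z := f z - g z.
have mh : measurable_fun setT h by exact: measurable_funB.
suff : (\int[(mu \x nu)%E]_(z in setT) `|(h z)%:E| = 0)%E.
  move/(ae_eq_integral_abs _ measurableT (iffRL (measurable_EFinP _ _) mh)).
  apply: filterS => z /= /(_ I) -[] /eqP.
  by rewrite subr_eq0 => /eqP.
rewrite /= fubini_tonelli1; last 2 first.
- exact: measurable_enorm.
- by move=> z; rewrite lee_fin.
rewrite -[RHS](@integral0 _ _ _ mu setT).
apply: ae_eq_integral => //.
- apply: (measurable_fun_fubini_tonelli_F (fun z => `|h z|%:E)); first exact: measurable_enorm.
  by move=> z; rewrite lee_fin.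
apply: filterS fg => x fgx _; rewrite /fubini_F /=.
rewrite -[RHS](@integral0 _ _ _ nu setT).
apply: ae_eq_integral => //.
- by apply: measurable_enorm; apply: (measurableT_comp mh); exact: measurable_fun_pair.
- by apply: filterS fgx => y fgy _; rewrite /h /= fgy subrr normr0.
Qed.

End ae_product.

Section ae_integral.
Context d (X : measurableType d) (R : realType) (mu : {measure set X -> \bar R}).

Lemma ae_Rint_eq (f g : X -> R) : measurable_fun setT f -> measurable_fun setT g ->
  {ae mu, forall x, f x = g x} -> \int[mu]_x f x = \int[mu]_x g x.
Proof.
move=> mf mg fg; congr fine; apply: ae_eq_integral => //.
- exact/measurable_EFinP.
- exact/measurable_EFinP.
- by apply: filterS fg => x -> _.
Qed.

Lemma ae_L1 (f g : X -> R) : measurable_fun setT f ->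
  {ae mu, forall x, f x = g x} -> L1 mu g -> L1 mu f.
Proof.
move=> mf fg gi; apply: L1_lty => //; have mg := L1_meas gi.
rewrite (_ : (\int[mu]_x _)%E = (\int[mu]_x `|g x|%:E)%E); first by rewrite nrm1_fin// ltry.
apply: ae_eq_integral => //; [exact: measurable_enorm|exact: measurable_enorm|].
by apply: filterS fg => x -> _.
Qed.

Lemma ae_cvg1 (F G : (X -> R)^nat) (f g : X -> R) : cvg1 mu F f ->
  (forall n, measurable_fun setT (G n)) -> measurable_fun setT g ->
  (forall n, {ae mu, forall x, G n x = F n x}) -> {ae mu, forall x, g x = f x} ->
  cvg1 mu G g.
Proof.
move=> [iF fi Ff] mG mg GF gf.
have iG n : L1 mu (G n) by exact: ae_L1 (mG n) (GF n) (iF n).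
have gi : L1 mu g by exact: ae_L1 mg gf fi.
split => //; rewrite (_ : (fun n => _) = (fun n => nrm1 mu (fun x => F n x - f x)))//.
apply/funext => n; apply: ae_Rint_eq.
- exact/L1_meas/L1_norm/L1B.
- by apply: (@L1_meas _ _ _ mu); apply: L1_norm; apply: L1B.
- by have := GF n; apply: filter_app; apply: filterS gf => x -> ->.
Qed.

End ae_integral.

(** * Convolution in the space variables, with time as a parameter *)

Section space_time.
Context {R : realType}.
Local Notation mR := (measurableTypeR R).
Local Notation mR2 := (mR * mR)%type.
Local Notation mR3 := (mR * mR2)%type.
Local Notation leb := (@lebesgue_measure R).
Local Notation leb2 := (@leb2 R).
Local Notation leb3 := (@leb3 R).

Definition cvt (K : R * R -> R) (f : R * (R * R) -> R) (z : R * (R * R)) :=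
  cv K (fun y => f (z.1, y)) z.2.

Lemma slice_measurable (f : R * (R * R) -> R) t : measurable_fun setT (f : mR3 -> mR) ->
  measurable_fun setT ((fun x => f (t, x)) : mR2 -> mR).
Proof. by move=> mf; apply: (measurableT_comp mf); exact: measurable_fun_pair. Qed.

Lemma cvt_measurable K f : kern K -> measurable_fun setT (f : mR3 -> mR) ->
  measurable_fun setT (cvt K f : mR3 -> mR).
Proof.
move=> kK mf.
apply: (@measurable_Rint _ _ mR3 mR2 _ leb2 (fun z => f (z.1.1, z.2) * K (sub2 z.1.2 z.2))).
apply: measurable_funM.
  apply: (measurableT_comp mf); apply: measurable_fun_pair => //.
  exact: measurableT_comp.
apply: (measurableT_comp (L1_meas kK.(kern_L1))).
by apply: measurable_fun_pair; apply: measurable_funB => //;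
  apply: measurableT_comp => //; apply: measurableT_comp => //; apply: measurableT_comp.
Qed.

Lemma L2_slice f : L2 leb3 f -> {ae leb, forall t, L2 leb2 (fun x => f (t, x))}.
Proof.
move=> [mf fi]; have := L1_slice fi; apply: filterS => t ft; split => //.
exact: slice_measurable.
Qed.

Lemma cvt_L1 K f : kern K -> L1 leb3 f -> L1 leb3 (cvt K f) /\
  nrm1 leb3 (cvt K f) <= nrm1 leb2 K * nrm1 leb3 f.
Proof.
move=> kK fi; have mf := L1_meas fi.
have i1 : L1 leb (fun t => nrm1 leb2 K * nrm1 leb2 (fun x => f (t, x))).
  by apply: L1Z; exact: (L1_int (L1_norm fi)).
have ic : L1 leb3 (cvt K f).
  apply: (L1_prod _ i1); first exact: cvt_measurable.
  have := L1_slice fi; apply: filterS => t ft.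
  exact: (cv_L1 kK ft).
split => //.
rewrite /nrm1 [leLHS](fubini_Rint (L1_norm ic)).
rewrite (fubini_Rint (L1_norm fi)) -(RintZ _ (L1_int (L1_norm fi))).
have Gi := L1_int (L1_norm ic).
have h := L1_slice fi.
rewrite -lee_fin -RintE// -RintE//.
apply: ae_ge0_le_integral => //.
- by move=> t _; rewrite lee_fin; exact: nrm1_ge0.
- by apply/measurable_EFinP; exact: L1_meas Gi.
- by move=> t _; rewrite lee_fin mulr_ge0//; exact: nrm1_ge0.
- by apply/measurable_EFinP; exact: L1_meas i1.
apply: filterS h => t ft _; rewrite lee_fin.
exact: (cv_L1 kK ft).2.
Qed.

Lemma cvt_L2 K f : kern K -> L2 leb3 f -> L2 leb3 (cvt K f).
Proof.
move=> kK fi; have mf := L2_meas fi; have mc := cvt_measurable kK mf.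
split => //.
have i1 : L1 leb (fun t => nrm1 leb2 K ^+ 2 * nrm2 leb2 (fun x => f (t, x))).
  by apply: L1Z; exact: (L1_int fi.2).
apply: (L1_prod _ i1); first exact: measurable_funX.
have := L2_slice fi; apply: filterS => t ft; have [[_ h1] h2] := cv_L2 kK ft.
split => //; apply: le_trans h2; rewrite le_eqVlt; apply/orP; left; apply/eqP.
by apply: eq_Rintegral => x _; rewrite ger0_norm// sqr_ge0.
Qed.

Lemma cvB K g h x : kern K -> L1 leb2 (fun y => g y * K (sub2 x y)) ->
  L1 leb2 (fun y => h y * K (sub2 x y)) ->
  cv K (fun y => g y - h y) x = cv K g x - cv K h x.
Proof.
move=> kK gi hi; rewrite /cv -RintB//.
by apply: eq_Rintegral => y _; rewrite mulrBl.
Qed.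

Lemma cvt_continuous1 K F f : kern K -> cvg1 leb3 F f ->
  cvg1 leb3 (fun n => cvt K (F n)) (cvt K f).
Proof.
move=> kK [iF fi Ff].
have c0 : nrm1 leb2 K * nrm1 leb3 (fun x => F n x - f x) @[n --> \oo] --> 0.
  by rewrite -[0 in X in _ --> X](mulr0 (nrm1 leb2 K)); apply: cvgMr.
apply: (cvg1_squeeze _ _ _ c0).
- by move=> n; exact: (cvt_L1 kK (iF n)).1.
- exact: (cvt_L1 kK fi).1.
move=> n; have [h1 h2] := cvt_L1 kK (L1B (iF n) fi).
apply: le_trans h2; rewrite le_eqVlt; apply/orP; left; apply/eqP.
have i1 := (cvt_L1 kK (iF n)).1; have i2 := (cvt_L1 kK fi).1.
apply: ae_Rint_eq.
- exact/L1_meas/L1_norm/(L1B i1 i2).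
- exact/L1_meas/L1_norm/h1.
(* Convolution is linear only at times where both slices are integrable, so the comparison is made
   almost everywhere. *)
have : {ae leb, forall t, L1 leb2 (fun x => F n (t, x)) /\ L1 leb2 (fun x => f (t, x))}.
  by have := L1_slice fi; apply: filter_app; have := L1_slice (iF n); apply: filterS.
move=> /(ae_prod1 leb2); apply: filterS => -[t x] [j1 j2].
by rewrite /cvt /= cvB//; exact: cv_L1ok.
Qed.

Section approximate_identity.
Variables (r : R^nat) (K : nat -> R * R -> R).
Hypothesis r0 : r @ \oo --> 0.
Hypothesis pK : forall n, pker (r n) (K n).

Lemma cvt_cvg1 f : L1 leb3 f -> cvg1 leb3 (fun n => cvt (K n) f) f.
Proof.
move=> fi; have mf := L1_meas fi.
have kK n := (pK n).(pker_kern).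
have ic n := (cvt_L1 (kK n) fi).1.
suff [_ h] : (forall n, L1 leb3 (fun z => cvt (K n) f z - f z)) /\
   nrm1 leb3 (fun z => cvt (K n) f z - f z) @[n --> \oo] --> 0 by split.
apply: (@fubini_dominated _ _ _ _ _ leb leb2 _ (fun t => 2 * nrm1 leb2 (fun x => f (t, x)))).
- by move=> n; exact: L1_meas (L1B (ic n) fi).
- by apply: L1Z; exact: (L1_int (L1_norm fi)).
- have := L1_slice fi; apply: filterS => t ft n; have [h1 h2] := cv_L1 (kK n) ft.
  split; first exact: (L1B h1 ft).
  have := nrm1_tri h1 (L1N ft); rewrite (pker_nrm1 (pK n)) mul1r in h2.
  rewrite (_ : nrm1 leb2 (fun x => - f (t, x)) = nrm1 leb2 (fun x => f (t, x))); last first.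
    by apply: eq_Rintegral => y _; rewrite normrN.
  by move=> h; apply: (le_trans h); lra.
- by have := L1_slice fi; apply: filterS => t ft; case: (cv_cvg1 r0 pK ft).
Qed.

Lemma cvt_cvg2 f : L2 leb3 f -> cvg2 leb3 (fun n => cvt (K n) f) f.
Proof.
move=> fi; have mf := L2_meas fi.
have kK n := (pK n).(pker_kern).
have ic n := cvt_L2 (kK n) fi.
have e g : nrm1 leb2 (fun x => g x ^+ 2) = nrm2 leb2 g.
  by apply: eq_Rintegral => x _; rewrite ger0_norm// sqr_ge0.
suff [_ h] : (forall n, L1 leb3 (fun z => (cvt (K n) f z - f z) ^+ 2)) /\
   nrm1 leb3 (fun z => (cvt (K n) f z - f z) ^+ 2) @[n --> \oo] --> 0.
  split => //; apply: cvg_trans h; apply: near_eq_cvg; apply: nearW => n.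
  by apply: eq_Rintegral => x _; rewrite ger0_norm// sqr_ge0.
(* The constant is [2 + 2]: [(a - b) ^ 2 <= 2 a ^ 2 + 2 b ^ 2], and convolution with a kernel of
   mass one does not increase the norm. *)
apply: (@fubini_dominated _ _ _ _ _ leb leb2 _ (fun t => 4 * nrm2 leb2 (fun x => f (t, x)))).
- by move=> n; exact: L1_meas (L2B (ic n) fi).2.
- by apply: L1Z; exact: (L1_int fi.2).
- have := L2_slice fi; apply: filterS => t ft n; have [h1 h2] := cv_L2 (kK n) ft.
  split; first exact: (L2B h1 ft).2.
  rewrite (pker_nrm1 (pK n)) expr1n mul1r in h2.
  rewrite e; apply: (@le_trans _ _ (2 * nrm2 leb2 (cv (K n) (fun x => f (t, x))) +
     2 * nrm2 leb2 (fun x => f (t, x)))); last by lra.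
  rewrite -(RintZ _ h1.2) -(RintZ _ ft.2) -(RintD (L1Z 2 h1.2) (L1Z 2 ft.2)).
  apply: Rint_le; [exact: (L2B h1 ft).2|exact: (L1D (L1Z 2 h1.2) (L1Z 2 ft.2))|].
  move=> x; set a := cv _ _ _; set b := f _; have := sqr_ge0 (a + b); rewrite /cvt/= -/a; nra.
- have := L2_slice fi; apply: filterS => t ft; case: (cv_cvg2 r0 pK ft) => _ _.
  by apply: cvg_trans; apply: near_eq_cvg; apply: nearW => n; rewrite -e.
Qed.

End approximate_identity.

End space_time.

(** * Smooth test functions and kernels *)

Section smooth_functions_of_one_variable.
Context {R : realType}.
Implicit Types (f g : R -> R) (x : R).

(** The derivative is existentially quantified, so that a closed formula can be supplied at each
    step of an induction; [classC_coord] converts this notion into the one required of test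
    functions. *)
Fixpoint Cn (n : nat) f : Prop :=
  if n is m.+1 then exists f', (forall x, is_derive x 1 f (f' x)) /\ Cn m f'
  else continuous f.

Definition csm f := forall n, Cn n f.

Lemma is_derive_continuous f x df : is_derive x 1 f df -> {for x, continuous f}.
Proof.
move=> [fx _]; apply: differentiable_continuous; exact/derivable1_diffP.
Qed.

Lemma CnW n f : Cn n.+1 f -> Cn n f.
Proof.
elim: n f => [|n ih] f [f' [ff' hf']].
  by move=> x; exact: is_derive_continuous (ff' x).
by exists f'; split => //; exact: ih.
Qed.

Lemma Cn_continuous n f : Cn n f -> continuous f.
Proof. by elim: n => // n ih /CnW. Qed.

Lemma CnD n f g : Cn n f -> Cn n g -> Cn n (fun x => f x + g x).
Proof.
elim: n f g => [|n ih] f g.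
  by move=> cf cg x; apply: cvgD; [exact: cf|exact: cg].
move=> [f' [ff' hf']] [g' [gg' hg']].
by exists (fun x => f' x + g' x); split; [move=> x; exact: is_deriveD|exact: ih].
Qed.

Lemma CnM n f g : Cn n f -> Cn n g -> Cn n (fun x => f x * g x).
Proof.
elim: n f g => [|n ih] f g.
  by move=> cf cg x; apply: cvgM; [exact: cf|exact: cg].
move=> hf hg; have cf := CnW hf; have cg := CnW hg.
move: hf hg => [f' [ff' hf']] [g' [gg' hg']].
exists (fun x => f x * g' x + g x * f' x); split.
  by move=> x; exact: is_deriveM.
by apply: CnD; apply: ih.
Qed.

Lemma Cn_cst n c : Cn n (fun=> c : R).
Proof.
elim: n c => [|n ih] c; first by move=> x; exact: cvg_cst.
by exists (fun=> 0); split => [x|]; [exact: is_derive_cst|exact: ih].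
Qed.

Lemma is_derive_affine f x (c d df : R) : is_derive (c * x + d) 1 f df ->
  is_derive x 1 (fun y => f (c * y + d)) (c * df).
Proof.
move=> fx; have h : is_derive x (1 : R) (fun y : R => c * y + d) c.
  have -> : (fun y : R => c * y + d) = (c *: id) + cst d.
    by apply/funext => y.
  by apply: is_derive_eq; rewrite addr0 [c *: 1]mulr1.
by rewrite mulrC; exact: (@is_derive1_comp _ f (fun y => c * y + d)).
Qed.

Lemma Cn_affine n f (c d : R) : Cn n f -> Cn n (fun x => f (c * x + d)).
Proof.
elim: n f => [|n ih] f.
  move=> cf x; apply: (@continuous_comp _ _ _ (fun y => c * y + d) f); last exact: cf.
  by apply: cvgD; [apply: cvgMr; exact: cvg_id|exact: cvg_cst].
move=> [f' [ff' hf']]; exists (fun x => c * f' (c * x + d)); split.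
  by move=> x; exact: is_derive_affine.
by apply: CnM; [exact: Cn_cst|exact: ih].
Qed.

Lemma Cn_inv n f : (forall x, f x != 0) -> Cn n f -> Cn n (fun x => (f x)^-1).
Proof.
move=> f0; elim: n f f0 => [|n ih] f f0; first by move=> cf x; apply: cvgV => //; exact: cf.
move=> hf; have cf := CnW hf; move: hf => [f' [ff' hf']].
exists (fun x => (-1) * (f' x * ((f x)^-1 * (f x)^-1))); split.
  move=> x; have [h1 h2] := ff' x; apply: DeriveDef; first exact: derivableV.
  by rewrite deriveV// h2 /GRing.scale/=; field.
apply: CnM; first exact: Cn_cst.
by apply: CnM => //; apply: CnM; exact: ih.
Qed.

(** The powers of [1 / x] are included so that the family is closed under differentiation up to
    linear combinations, which makes smoothness a plain induction. *)
Definition flat (m : nat) x : R := if 0 < x then x ^- m * expR (- x^-1) else 0.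

Lemma flat_ge0 m x : 0 <= flat m x.
Proof.
by rewrite /flat; case: ifP => // x0; rewrite mulr_ge0 ?expR_ge0// invr_ge0 exprn_ge0// ltW.
Qed.

Lemma flat_le0 m x : x <= 0 -> flat m x = 0.
Proof. by rewrite /flat leNgt => /negbTE ->. Qed.

Lemma flat_gt0 x : 0 < x -> 0 < flat 0 x.
Proof. by move=> x0; rewrite /flat x0 expr0 invr1 mul1r expR_gt0. Qed.

(** From [y ^ (m + 2) / (m + 2)! <= exp y] at [y = 1 / x]. A quadratic bound is what gives
    derivative zero at the origin. *)
Lemma flat_bound m x : flat m x <= m.+2`!%:R * x ^+ 2.
Proof.
rewrite /flat; case: ifP => [x0|_]; last by rewrite mulr_ge0// sqr_ge0.
have i0 : 0 < x^-1 by rewrite invr_gt0.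
have := expR_ge1Dxn m.+1 (ltW i0).
have F0 : (0 : R) < m.+2`!%:R by rewrite ltr0n fact_gt0.
move=> h; have {h} : x^-1 ^+ m.+2 / m.+2`!%:R <= expR x^-1 by lra.
rewrite ler_pdivrMr// => h.
rewrite expRN ler_pdivrMr ?expR_gt0// -[leLHS]mul1r ler_pdivrMr ?exprn_gt0//.
apply: (@le_trans _ _ (x ^+ m.+2 * x^-1 ^+ m.+2)).
  by rewrite -exprMn divff ?expr1n// gt_eqF.
rewrite (_ : _ * x ^+ m = x ^+ m.+2 * (expR x^-1 * m.+2`!%:R)); last first.
  by rewrite -addn2 exprD; ring.
by rewrite ler_wpM2l// exprn_ge0// ltW.
Qed.

Lemma is_derive_flat m x :
  is_derive x 1 (flat m) (- m%:R * flat m.+1 x + flat m.+2 x).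
Proof.
have [x0|x0|->] := ltgtP x 0.
- rewrite !flat_le0 ?ltW// mulr0 addr0.
  have h : is_derive x (1 : R) (cst 0 : R -> R) 0 by exact: is_derive_cst.
  apply: near_eq_is_derive h.
  have : \forall y \near x, y < 0 by exact: (cvgr_lt x cvg_id).
  by apply: filterS => y y0; rewrite flat_le0//; exact: ltW.
- pose g (y : R) := y^-1 ^+ m * expR (- y^-1).
  apply: (@near_eq_is_derive _ _ _ g).
    have : \forall y \near x, 0 < y by exact: (cvgr_gt x cvg_id).
    by apply: filterS => y y0; rewrite /g /flat y0 exprVn.
  rewrite /flat x0.
  have xn0 : x != 0 by rewrite gt_eqF.
  have h1 : is_derive x 1 (fun y : R => y^-1) (- x ^- 2).
    have h := @derivableV _ _ (@id R) x 1 xn0 (@derivable_id _ _ x 1).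
    apply: DeriveDef => //; rewrite (deriveV _ (@derivable_id _ _ x 1))//.
    by rewrite derive_id /GRing.scale/= mulr1.
  have h1' : is_derive x 1 (fun y : R => - y^-1) (x ^- 2).
    by have := is_deriveN h1; rewrite opprK.
  have h2 := @is_derive1_comp _ expR (fun y : R => - y^-1) x _ _ (is_derive_expR (- x^-1)) h1'.
  have h3 : is_derive x 1 (fun y : R => y^-1 ^+ m) (m%:R * x^-1 ^+ m.-1 * - x ^- 2).
    have -> : (fun y : R => y^-1 ^+ m) = (fun y : R => y^-1) ^+ m by rewrite exprfctE.
    exact: is_deriveX.
  apply: (is_derive_eq (is_deriveM h3 h2)); rewrite /GRing.scale/=.
  case: m {g h3} => [|m]; rewrite -!exprVn; first by rewrite !expr0; ring.
  by rewrite /= !exprS -addn1 natrD; ring.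
- rewrite !flat_le0// mulr0 addr0.
  have key : (fun h : R => h^-1 *: (flat m (h *: 1 + 0) - flat m 0)) @ 0^' --> (0 : R).
    apply: norm_cvg0.
    have c0 : m.+2`!%:R * `|h| @[h --> (0 : R)^'] --> (0 : R).
      rewrite -[X in _ --> X](mulr0 (m.+2`!%:R)); apply: cvgMr.
      rewrite -[X in _ --> X](@normr0 _ R); apply: cvg_norm.
      exact: cvg_within.
    apply: (squeeze_cvgr _ (cvg_cst 0) c0).
    apply: filterS (nbhs_dnbhs_neq (0 : R)) => h h0.
    rewrite normr_ge0/= [h *: 1]mulr1 addr0 (flat_le0 _ (lexx 0)) subr0 normrM normfV.
    rewrite mulrC ler_pdivrMr ?normr_gt0// (ger0_norm (flat_ge0 _ _)).
    rewrite -mulrA -expr2 real_normK ?num_real//; exact: flat_bound.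
  by apply: DeriveDef; [apply/cvg_ex; exists 0|exact: cvg_lim key].
Qed.

Lemma Cn_flat n m : Cn n (flat m).
Proof.
elim: n m => [|n ih] m.
  by move=> x; exact: is_derive_continuous (is_derive_flat m x).
exists (fun x => - m%:R * flat m.+1 x + flat m.+2 x); split.
  exact: is_derive_flat.
by apply: CnD => //; apply: CnM => //; exact: Cn_cst.
Qed.

(* A smooth step from [0] on the left of [-1] to [1] on the right of [1]. *)
Definition step x : R := flat 0 (x + 1) / (flat 0 (x + 1) + flat 0 (1 - x)).

Lemma step_den_gt0 x : 0 < flat 0 (x + 1) + flat 0 (1 - x).
Proof.
have [x0|x0] := leP x 0.
  by rewrite ltr_wpDl ?flat_ge0// flat_gt0//; lra.
by rewrite ltr_pwDl ?flat_ge0// flat_gt0//; lra.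
Qed.

Lemma step_left x : x <= -1 -> step x = 0.
Proof. by move=> x1; rewrite /step flat_le0 ?mul0r//; lra. Qed.

Lemma step_right x : 1 <= x -> step x = 1.
Proof.
move=> x1; rewrite /step [flat 0 (1 - x)]flat_le0; last by lra.
by rewrite addr0 divff// gt_eqF// flat_gt0//; lra.
Qed.

Lemma Cn_flat_left n m : Cn n (fun x => flat m (x + 1)).
Proof.
have := @Cn_affine n (flat m) 1 1 (Cn_flat n m).
by congr Cn; apply/funext => x; rewrite mul1r.
Qed.

Lemma Cn_flat_right n m : Cn n (fun x => flat m (1 - x)).
Proof.
have := @Cn_affine n (flat m) (-1) 1 (Cn_flat n m).
by congr Cn; apply/funext => x; rewrite mulN1r addrC.
Qed.

Lemma csm_step : csm step.
Proof.
move=> n; apply: CnM; first exact: Cn_flat_left.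
apply: Cn_inv; first by move=> x; rewrite gt_eqF// step_den_gt0.
by apply: CnD; [exact: Cn_flat_left|exact: Cn_flat_right].
Qed.

(** Since [flat 2] is the derivative of [flat 0], this is the quotient rule for [step], arranged so
    that its sign is visible. *)
Definition dstep x : R :=
  (flat 2 (x + 1) * flat 0 (1 - x) + flat 0 (x + 1) * flat 2 (1 - x)) /
  (flat 0 (x + 1) + flat 0 (1 - x)) ^+ 2.

Lemma dstep_ge0 x : 0 <= dstep x.
Proof.
rewrite mulr_ge0 ?invr_ge0 ?sqr_ge0//.
by rewrite addr_ge0// mulr_ge0// flat_ge0.
Qed.

Lemma is_derive_step x : is_derive x 1 step (dstep x).
Proof.
have h1 : is_derive x 1 (fun y => flat 0 (y + 1)) (flat 2 (x + 1)).
  have := @is_derive_flat 0 (1 * x + 1); rewrite oppr0 mul0r add0r => /is_derive_affine.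
  rewrite !mul1r; congr is_derive; apply/funext => y; by rewrite mul1r.
have h2 : is_derive x 1 (fun y => flat 0 (1 - y)) (- flat 2 (1 - x)).
  have := @is_derive_flat 0 (-1 * x + 1); rewrite oppr0 mul0r add0r => /is_derive_affine.
  rewrite !mulN1r [- x + 1]addrC; congr is_derive; apply/funext => y; by rewrite mulN1r addrC.
have D0 := step_den_gt0 x; have Dn0 : flat 0 (x + 1) + flat 0 (1 - x) != 0 by rewrite gt_eqF.
have h3 := is_deriveD h1 h2; have [d3 e3] := h3.
have h4 : is_derive x 1 (fun y => (flat 0 (y + 1) + flat 0 (1 - y))^-1)
   (- (flat 2 (x + 1) - flat 2 (1 - x)) / (flat 0 (x + 1) + flat 0 (1 - x)) ^+ 2).
  apply: DeriveDef; first exact: derivableV.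
  by rewrite deriveV// e3 /GRing.scale/=; field.
apply: (is_derive_eq (is_deriveM h1 h4)).
by rewrite /GRing.scale/= /dstep; field.
Qed.

End smooth_functions_of_one_variable.

(** * Tensor products of smooth functions of one variable *)

Section class_of_tensor_products.
Context {R : realType} {V : normedModType R}.
Implicit Types f g : V -> R.

Lemma classC_continuous n f : classC n f -> continuous f.
Proof. by case: n => [|n] []. Qed.

Lemma classCW n f : classC n.+1 f -> classC n f.
Proof.
elim: n f => [|n ih] f [cf hf]; first by [].
by split => // v; have [h1 h2] := hf v; split => //; exact: ih.
Qed.

Lemma classCD n f g : classC n f -> classC n g -> classC n (fun x => f x + g x).
Proof.
elim: n f g => [|n ih] f g hf hg; have cf := classC_continuous hf; have cg := classC_continuous hg.
  by split => // x; apply: cvgD; [exact: cf|exact: cg].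
split; first by move=> x; apply: cvgD; [exact: cf|exact: cg].
move=> v; have [_ /(_ v)[df hdf]] := hf; have [_ /(_ v)[dg hdg]] := hg.
split; first by move=> x; exact: derivableD.
have -> : 'D_v (fun x => f x + g x) = (fun x => 'D_v f x + 'D_v g x).
  by apply/funext => x; exact: deriveD.
exact: ih.
Qed.

Lemma classCM n f g : classC n f -> classC n g -> classC n (fun x => f x * g x).
Proof.
elim: n f g => [|n ih] f g hf hg; have cf := classC_continuous hf; have cg := classC_continuous hg.
  by split => // x; apply: cvgM; [exact: cf|exact: cg].
split; first by move=> x; apply: cvgM; [exact: cf|exact: cg].
move=> v; have [_ /(_ v)[df hdf]] := hf; have [_ /(_ v)[dg hdg]] := hg.
split; first by move=> x; exact: derivableM.
have -> : 'D_v (fun x => f x * g x) = (fun x => f x * 'D_v g x + g x * 'D_v f x).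
  by apply/funext => x; exact: deriveM.
by apply: classCD; apply: ih => //; exact: classCW.
Qed.

Lemma classC_cst n c : classC n ((fun=> c) : V -> R).
Proof.
elim: n c => [|n ih] c; first by split => // x; exact: cvg_cst.
split; first by move=> x; exact: cvg_cst.
move=> v; split; first by move=> x; exact: derivable_cst.
have -> : 'D_v ((fun=> c) : V -> R) = fun=> 0 by apply/funext => x; exact: derive_cst.
exact: ih.
Qed.

Variable pi : V -> R.
Hypothesis pi_linear : forall (h : R) v a, pi (h *: v + a) = h * pi v + pi a.
Hypothesis pi_continuous : continuous pi.

(** The form [pi] being linear, the difference quotients of [f \o pi] along [v] are literally those
    of [f] along [pi v]. *)
Lemma is_derive_coord (f : R -> R) a v df : is_derive (pi a) 1 f df ->
  is_derive a v (f \o pi) (pi v * df).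
Proof.
move=> [f1 f2]; have fd : differentiable f (pi a) by exact/derivable1_diffP.
have fv : derivable f (pi a) (pi v) by exact: diff_derivable.
have ev : 'D_(pi v) f (pi a) = pi v * df.
  rewrite (deriveE _ fd) -[pi v in LHS]mulr1 [LHS]linearZ/= -f2 (deriveE _ fd).
  by [].
have e : (fun h : R => h^-1 *: ((f \o pi) (h *: v + a) - (f \o pi) a)) =
    (fun h : R => h^-1 *: (f (h *: pi v + pi a) - f (pi a))).
  by apply/funext => h /=; rewrite pi_linear.
apply: DeriveDef; first by rewrite /derivable e.
by rewrite /derive e.
Qed.

Lemma classC_coord n (f : R -> R) : Cn n f -> classC n (f \o pi).
Proof.
elim: n f => [|n ih] f hf; have cf := Cn_continuous hf.
  by split => // x; apply: continuous_comp; [exact: pi_continuous|exact: cf].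
split; first by move=> x; apply: continuous_comp; [exact: pi_continuous|exact: cf].
move: hf => [f' [ff' hf']] v.
have D x := is_derive_coord v (ff' (pi x)).
split; first by move=> x; have [] := D x.
have -> : 'D_v (f \o pi) = (fun x => pi v * (f' \o pi) x).
  by apply/funext => x; have [] := D x.
by apply: classCM; [exact: classC_cst|exact: ih].
Qed.

End class_of_tensor_products.

Section test_functions.
Context {R : realType}.
Implicit Types th a b : R -> R.

Lemma pi2_1 (h : R) (v x : R * R) : (h *: v + x).1 = h * v.1 + x.1. Proof. by []. Qed.
Lemma pi2_2 (h : R) (v x : R * R) : (h *: v + x).2 = h * v.2 + x.2. Proof. by []. Qed.

Definition tens2 a b (x : R * R) : R := a x.1 * b x.2.
Definition tens3 th a b (z : R * (R * R)) : R := th z.1 * tens2 a b z.2.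

Definition csupp (f : R -> R) (l r : R) := forall x, f x != 0 -> x \in `[l, r].

Lemma is_derive_tens2 a b da db (x v : R * R) :
  is_derive x.1 1 a da -> is_derive x.2 1 b db ->
  is_derive x v (tens2 a b) (v.1 * (da * b x.2) + v.2 * (a x.1 * db)).
Proof.
move=> ha hb.
have h1 := is_derive_coord pi2_1 v ha; have h2 := is_derive_coord pi2_2 v hb.
apply: (is_derive_eq (is_deriveM h1 h2)).
by rewrite /GRing.scale/=; ring.
Qed.

Lemma is_derive_tens3 th a b dth da db (z v : R * (R * R)) :
  is_derive z.1 1 th dth -> is_derive z.2.1 1 a da -> is_derive z.2.2 1 b db ->
  is_derive z v (tens3 th a b) (v.1 * (dth * tens2 a b z.2) +
    th z.1 * (v.2.1 * (da * b z.2.2) + v.2.2 * (a z.2.1 * db))).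
Proof.
move=> ht ha hb.
have h0 := @is_derive_coord R _ (fun z : R * (R * R) => z.1) (fun _ _ _ => erefl) _ _ v _ ht.
have h1 := @is_derive_coord R _ (fun z : R * (R * R) => z.2.1) (fun _ _ _ => erefl) _ _ v _ ha.
have h2 := @is_derive_coord R _ (fun z : R * (R * R) => z.2.2) (fun _ _ _ => erefl) _ _ v _ hb.
apply: (is_derive_eq (is_deriveM h0 (is_deriveM h1 h2))).
by rewrite /GRing.scale/= mulrfctE /tens2/=; ring.
Qed.

Lemma continuous_snd1 : continuous (fun z : R * (R * R) => z.2.1).
Proof. by move=> z; apply: continuous_comp; [exact: cvg_snd|exact: cvg_fst]. Qed.

Lemma continuous_snd2 : continuous (fun z : R * (R * R) => z.2.2).
Proof. by move=> z; apply: continuous_comp; exact: cvg_snd. Qed.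

Lemma smooth_tens2 a b : csm a -> csm b -> smooth (tens2 a b).
Proof.
move=> ha hb n; apply: classCM.
- apply: (@classC_coord _ _ (fun x : R * R => x.1)) => //; first by move=> x; exact: cvg_fst.
- apply: (@classC_coord _ _ (fun x : R * R => x.2)) => //; first by move=> x; exact: cvg_snd.
Qed.

Lemma smooth_tens3 th a b : csm th -> csm a -> csm b -> smooth (tens3 th a b).
Proof.
move=> ht ha hb n; apply: classCM; last apply: classCM.
- apply: (@classC_coord _ _ (fun x : R * (R * R) => x.1)) => //; first by move=> x; exact: cvg_fst.
- apply: (@classC_coord _ _ (fun x : R * (R * R) => x.2.1)) => //; exact: continuous_snd1.
- apply: (@classC_coord _ _ (fun x : R * (R * R) => x.2.2)) => //; exact: continuous_snd2.
Qed.

Lemma supp_sub (V : normedModType R) (f : V -> R) (B : set V) : compact B ->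
  (forall x, f x != 0 -> B x) -> compact (supp f) /\ supp f `<=` B.
Proof.
move=> cB fB; have clB : closed B by apply: compact_closed => //; exact: norm_hausdorff.
have sB : supp f `<=` B.
  by apply: (subset_trans (closureS fB)); move/closure_id : clB => <-.
split => //; apply: (subclosed_compact _ cB sB); exact: closed_closure.
Qed.

Lemma test_tens2 a b la ra lb rb : csm a -> csm b -> csupp a la ra -> csupp b lb rb ->
  test_fun (tens2 a b).
Proof.
move=> ha hb sa sb; split; first exact: smooth_tens2.
have cB : compact (`[la, ra]%classic `*` `[lb, rb]%classic : set (R * R)).
  by apply: compact_setX; exact: segment_compact.
apply: (supp_sub cB _).1 => x; rewrite mulf_eq0 negb_or => /andP[h1 h2].
by split; [exact: sa|exact: sb].
Qed.

Lemma test_tens3 T th a b lt rt la ra lb rb : csm th -> csm a -> csm b ->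
  csupp th lt rt -> csupp a la ra -> csupp b lb rb -> 0 < lt -> rt < T ->
  test_slab T (tens3 th a b).
Proof.
move=> ht ha hb st sa sb lt0 rtT.
have cB : compact (`[lt, rt]%classic `*` (`[la, ra]%classic `*` `[lb, rb]%classic) : set (R * (R * R))).
  by do 2?apply: compact_setX; exact: segment_compact.
have [|h1 h2] := @supp_sub _ (tens3 th a b) _ cB.
  move=> x; rewrite /tens3 /tens2 !mulf_eq0 !negb_or => /and3P[x1 x2 x3].
  by split; [exact: st|split; [exact: sa|exact: sb]].
split; first by split => //; exact: smooth_tens3.
apply: (subset_trans h2) => -[t x] [/=]; rewrite in_itv/= => /andP[t1 t2] _.
by split => //=; rewrite in_itv/=; apply/andP; split; lra.
Qed.

End test_functions.

(** * Integration on the line and the one-dimensional profiles of the kernels *)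

Section calculus_on_the_line.
Context {R : realType}.
Local Notation mR := (measurableTypeR R).
Local Notation leb := (@lebesgue_measure R).
Implicit Types (F f a b : R -> R) (c d h l r x y : R).

Lemma continuous_measurableR f : continuous f -> measurable_fun setT (f : mR -> mR).
Proof. exact: continuous_measurable_fun. Qed.

Lemma FTC2_Rint F f (l r : R) : (forall x : R, is_derive x (1 : R) F (f x)) -> continuous f ->
  l <= r -> \int[leb]_(x in `[l, r]) f x = F r - F l.
Proof.
move=> Ff cf; rewrite le_eqVlt => /predU1P[->|lr].
  by rewrite set_itv1 Rintegral_set1 subrr.
have cF : continuous F by move=> x; exact: is_derive_continuous (Ff x).
rewrite /Rintegral (@continuous_FTC2 _ f F)//.
- exact/continuous_subspaceT.
- split; first by move=> x _; have [] := Ff x.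
  + exact: cvg_at_right_filter (cF l).
  + exact: cvg_at_left_filter (cF r).
- by move=> x _; rewrite derive1E; have [] := Ff x.
Qed.

Lemma continuous_L1_itv f (l r : R) : continuous f ->
  leb.-integrable `[l, r] (EFin \o f).
Proof.
move=> cf; apply: continuous_compact_integrable; first exact: segment_compact.
exact: continuous_subspaceT.
Qed.

(* Integrate [F (x + 1) - F x], written as an integral of [f] over [[x, x + 1]],
   over the line: translation invariance gives [0], Fubini gives the integral of [f]. *)
Lemma integral_derivative_line F f : (forall x : R, is_derive x (1 : R) F (f x)) -> continuous f ->
  L1 leb F -> L1 leb f -> \int[leb]_x f x = 0.
Proof.
move=> Ff cf iF fi.
pose I := \1_(`[0, 1]%classic : set R) : R -> R.
have mI : measurable_fun setT (I : mR -> mR) by apply: measurable_indic; exact: measurable_itv.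
have iI : L1 leb I by exact: integrable_indic_itv.
have intI : \int[leb]_x I x = 1.
  rewrite /Rintegral integral_indic//= setIT lebesgue_measure_itv/= lte_fin ltr01.
  by rewrite -EFinB subr0.
have I0 x : 0 <= I x by rewrite /I indicE.
pose H (z : R * R) := f z.1 * I (z.1 - z.2).
have iH : L1 (leb \x leb)%E H.
  apply: (@L1_prod _ _ _ _ _ leb leb H (fun x => `|f x|)).
  - apply: measurable_funM; first exact: measurableT_comp (continuous_measurableR cf) _.
    by apply: (measurableT_comp mI); exact: measurable_funB.
  - exact: L1_norm.
  - apply: aeW => x; rewrite /H /=; split.
      by apply: L1Z; exact: (mpres_L1 (mpres_reflect x) iI).
    under eq_Rintegral do rewrite normrM.
    rewrite RintZ; last by apply: L1_norm; exact: (mpres_L1 (mpres_reflect x) iI).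
    rewrite -(mpres_Rint (mpres_reflect x) (L1_norm iI)).
    by under eq_Rintegral do rewrite ger0_norm//; rewrite intI mulr1.
have e1 : \int[(leb \x leb)%E]_z H z = \int[leb]_x f x.
  rewrite (fubini_Rint iH); apply: eq_Rintegral => x _; rewrite /H /=.
  rewrite RintZ; last exact: (mpres_L1 (mpres_reflect x) iI).
  by rewrite -(mpres_Rint (mpres_reflect x) iI) intI mulr1.
have sF : L1 leb (fun x => F (x + 1)).
  have := mpres_L1 (mpres_shift (-1)) iF.
  by congr L1; apply/funext => x /=; rewrite opprK.
have e2 : \int[(leb \x leb)%E]_z H z = \int[leb]_x (F (x + 1) - F x).
  rewrite (mpres_Rint (mpres_swap leb leb) iH).
  rewrite (fubini_Rint (mpres_L1 (mpres_swap leb leb) iH)).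
  apply: eq_Rintegral => x _; rewrite -(FTC2_Rint Ff cf) ?lerDl//.
  rewrite [RHS]Rintegral_mkcond; apply: eq_Rintegral => y _.
  rewrite /H/= /I indicE patchE !mem_setE !in_itv/= subr_ge0 lerBlDr [1 + x]addrC.
  by case: ifP; rewrite ?mulr1 ?mulr0.
rewrite -e1 e2 RintB// -[X in X - _](_ : \int[leb]_x F x = _) ?subrr//.
rewrite (mpres_Rint (mpres_shift (-1)) iF).
by apply: eq_Rintegral => x _ /=; rewrite opprK.
Qed.

Lemma csm_derive a : csm a -> forall x : R, is_derive x (1 : R) a (derive1 a x).
Proof.
move=> /(_ 1%N)[a' [aa' _]] x; have [h1 h2] := aa' x.
by apply: DeriveDef => //; rewrite derive1E.
Qed.

Lemma csm_derive1 a : csm a -> csm (derive1 a).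
Proof.
move=> ha n; have [a' [aa' ha']] := ha n.+1.
rewrite (_ : (derive1 a) = a')//; apply/funext => x.
by rewrite derive1E; have [] := aa' x.
Qed.

Lemma csm_continuous a : csm a -> continuous a.
Proof. by move=> /(_ 0%N). Qed.

Lemma csm_affine a c d : csm a -> csm (fun x => a (c * x + d)).
Proof. by move=> ha n; apply: Cn_affine. Qed.

Lemma csmD a b : csm a -> csm b -> csm (fun x => a x + b x).
Proof. by move=> ha hb n; apply: CnD. Qed.

Lemma csmM a b : csm a -> csm b -> csm (fun x => a x * b x).
Proof. by move=> ha hb n; apply: CnM. Qed.

Lemma csm_cst c : csm (fun=> c : R).
Proof. by move=> n; exact: Cn_cst. Qed.

Lemma csm_shift a c : csm a -> csm (fun x => a (x - c)).
Proof. by move=> /(csm_affine 1 (- c)); under eq_fun do rewrite mul1r. Qed.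

Lemma csm_reflect a c : csm a -> csm (fun x => a (c - x)).
Proof. by move=> /(csm_affine (-1) c); under eq_fun do rewrite mulN1r addrC. Qed.

Lemma csupp_derive a l r : csupp a l r -> csupp (derive1 a) l r.
Proof.
move=> sa x; apply: contraNT => xlr; rewrite derive1E; apply/eqP.
have h : is_derive x (1 : R) (cst 0 : R -> R) 0 by exact: is_derive_cst.
suff : \near x, cst 0 x = a x by move=> /near_eq_is_derive/(_ h)[].
move: xlr; rewrite in_itv/= negb_and -!ltNge => /orP[xl|xr].
- have : \forall y \near x, y < l by exact: (cvgr_lt x cvg_id).
  apply: filterS => y yl; apply/esym/eqP; apply: contraLR yl => /sa.
  by rewrite in_itv/= -leNgt => /andP[].
- have : \forall y \near x, r < y by exact: (cvgr_gt x cvg_id).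
  apply: filterS => y yl; apply/esym/eqP; apply: contraLR yl => /sa.
  by rewrite in_itv/= -leNgt => /andP[].
Qed.

Lemma csupp_bounded a l r : continuous a -> csupp a l r -> exists C, forall x, `|a x| <= C.
Proof.
move=> ca sa.
have /compact_bounded[M [_ hM]] : compact (a @` `[l, r]%classic).
  by apply: continuous_compact; [exact: continuous_subspaceT|exact: segment_compact].
exists (`|M| + 1) => x; have [->|ax] := eqVneq (a x) 0.
  by rewrite normr0 addr_ge0.
apply: hM; first by rewrite (le_lt_trans (ler_norm _))// ltrDl.
by exists x => //; exact: sa.
Qed.

Lemma csupp_patch a l r : csupp a l r -> a \_ `[l, r]%classic = a.
Proof.
move=> sa; apply/funext => x; rewrite patchE; case: ifPn => // xlr.
by apply/esym/eqP; apply: contraNT xlr => /sa; rewrite mem_setE.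
Qed.

Lemma csupp_L1 a l r : continuous a -> csupp a l r -> L1 leb a.
Proof.
move=> ca sa; rewrite /L1 -(csupp_patch sa) -restrict_EFin.
by rewrite -integrable_mkcond; [exact: continuous_L1_itv|exact: measurable_itv].
Qed.

Lemma csuppM a b l r : csupp a l r -> csupp (fun x => b x * a x) l r.
Proof. by move=> sa x; rewrite mulf_eq0 negb_or => /andP[_]; exact: sa. Qed.

Lemma csupp_shift a c l r : csupp a l r -> csupp (fun x => a (x - c)) (l + c) (r + c).
Proof. by move=> sa x /sa; rewrite !in_itv/= => /andP[? ?]; apply/andP; split; lra. Qed.

Lemma csupp_reflect a c l r : csupp a l r -> csupp (fun x => a (c - x)) (c - r) (c - l).
Proof. by move=> sa x /sa; rewrite !in_itv/= => /andP[? ?]; apply/andP; split; lra. Qed.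

Lemma csupp_affine a d l r : 0 < d -> csupp a l r -> csupp (fun x => a (d^-1 * x)) (d * l) (d * r).
Proof.
move=> d0 sa x /sa; rewrite !in_itv/= => /andP[h1 h2]; apply/andP; split.
  by rewrite mulrC -ler_pdivlMr// mulrC.
by rewrite -ler_pdivrMl.
Qed.

Lemma dstepE : dstep = derive1 (@step R).
Proof. by apply/funext => x; rewrite derive1E; have [] := is_derive_step x. Qed.

Definition moll (d x : R) : R := d^-1 * dstep (d^-1 * x).
(** A Heaviside function with jump at [c], smoothed over [[c - d, c + d]]. *)
Definition sstep (d c x : R) : R := step (d^-1 * x - d^-1 * c).
(* The derivative [dkap d h] of [kap d h] is a difference quotient of mollifiers. *)
Definition kap (d h x : R) : R := h^-1 * (sstep d 0 x - sstep d h x).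
Definition dkap (d h x : R) : R := h^-1 * (moll d x - moll d (x - h)).

Lemma csm_moll d : csm (moll d).
Proof.
apply: csmM; first exact: csm_cst.
have := csm_affine d^-1 0 (csm_derive1 csm_step); rewrite -dstepE.
by under eq_fun do rewrite addr0.
Qed.

Lemma csm_sstep d c : csm (sstep d c).
Proof. by have := csm_affine d^-1 (- (d^-1 * c)) csm_step. Qed.

Lemma is_derive_sstep d c x : is_derive x (1 : R) (sstep d c) (moll d (x - c)).
Proof.
rewrite /moll mulrBr; apply: is_derive_affine; exact: is_derive_step.
Qed.

Lemma moll_ge0 d x : 0 < d -> 0 <= moll d x.
Proof. by move=> d0; rewrite mulr_ge0 ?invr_ge0 ?dstep_ge0// ltW. Qed.

Lemma csupp_dstep : csupp (@dstep R) (-1) 1.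
Proof.
move=> x; apply: contraNT; rewrite in_itv/= negb_and -!ltNge /dstep => /orP[x1|x1].
  by rewrite [flat 0 (x + 1)]flat_le0 ?[flat 2 (x + 1)]flat_le0 ?mul0r ?addr0 ?mul0r//; lra.
by rewrite [flat 0 (1 - x)]flat_le0 ?[flat 2 (1 - x)]flat_le0 ?mulr0 ?addr0 ?mul0r//; lra.
Qed.

Lemma csupp_moll d : 0 < d -> csupp (moll d) (- d) d.
Proof.
move=> d0; apply: csuppM; have := csupp_affine d0 csupp_dstep.
by rewrite mulrN1 mulr1.
Qed.

Lemma sstep_left d c x : 0 < d -> x <= c - d -> sstep d c x = 0.
Proof.
move=> d0 xc; rewrite /sstep step_left// -mulrBr ler_pdivrMl// mulrN1; lra.
Qed.

Lemma sstep_right d c x : 0 < d -> c + d <= x -> sstep d c x = 1.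
Proof.
move=> d0 xc; rewrite /sstep step_right// -mulrBr ler_pdivlMl// mulr1; lra.
Qed.

Lemma sstep_mono d c : 0 < d -> {homo sstep d c : x y / x <= y}.
Proof.
move=> d0 x y xy; have c1 : continuous (fun x => moll d (x - c)).
  by apply: csm_continuous; apply: csm_shift; exact: csm_moll.
rewrite -subr_ge0 -(FTC2_Rint (is_derive_sstep d c) c1 xy).
by apply: Rintegral_ge0 => z _; exact: moll_ge0.
Qed.

Lemma sstepE d c x : sstep d c x = sstep d 0 (x - c).
Proof. by rewrite /sstep mulr0 subr0 mulrBr. Qed.

Lemma sstep_01 d c x : 0 < d -> 0 <= sstep d c x <= 1.
Proof.
move=> d0; apply/andP; split.
  rewrite -(@sstep_left d c (Num.min x (c - d)))//; last by rewrite ge_min lexx orbT.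
  by apply: sstep_mono => //; rewrite ge_min lexx.
rewrite -(@sstep_right d c (Num.max x (c + d)))//; last by rewrite le_max lexx orbT.
by apply: sstep_mono => //; rewrite le_max lexx.
Qed.

Lemma moll_int d : 0 < d -> \int[leb]_x moll d x = 1.
Proof.
move=> d0; have cs := csupp_moll d0; have ce := csm_continuous (csm_moll d).
have dd : - d <= d by lra.
have Fd x : is_derive x (1 : R) (sstep d 0) (moll d x).
  by have := is_derive_sstep d 0 x; rewrite subr0.
have := FTC2_Rint Fd ce dd; rewrite (@sstep_left d 0 (- d)) ?sub0r// (@sstep_right d 0 d) ?add0r// subr0 => <-.
by rewrite [RHS]Rintegral_mkcond (csupp_patch cs).
Qed.

Lemma csm_kap d h : csm (kap d h).
Proof.
apply: csmM; first exact: csm_cst.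
apply: csmD; first exact: csm_sstep.
have := csmM (csm_cst (-1)) (csm_sstep d h).
by under eq_fun do rewrite mulN1r.
Qed.

Lemma is_derive_kap d h x : is_derive x (1 : R) (kap d h) (dkap d h x).
Proof.
have h0 := is_derive_sstep d 0 x; rewrite subr0 in h0.
have := is_deriveZ h^-1 (is_deriveB h0 (is_derive_sstep d h x)).
exact.
Qed.

Lemma csupp_kap d h : 0 < d -> 0 < h -> csupp (kap d h) (- d) (h + d).
Proof.
move=> d0 h0; apply: csuppM => x; apply: contraNT.
rewrite in_itv/= negb_and -!ltNge => /orP[x1|x1].
  by rewrite !sstep_left ?subrr//; lra.
by rewrite !sstep_right ?subrr//; lra.
Qed.

Lemma kap_ge0 d h x : 0 < d -> 0 < h -> 0 <= kap d h x.
Proof.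
move=> d0 h0; rewrite mulr_ge0 ?invr_ge0 ?(ltW h0)// subr_ge0 sstepE.
by apply: sstep_mono => //; lra.
Qed.

(** Integrate the derivative of [x kap(x)]. Its second term [x dkap(x)] has integral [-1], because
    shifting the mollifier by [h] raises its first moment by exactly [h]. *)
Lemma kap_int d h : 0 < d -> 0 < h -> \int[leb]_x kap d h x = 1.
Proof.
move=> d0 h0; have cs := csupp_moll d0; have ce := csm_continuous (csm_moll d).
have ck := csm_continuous (csm_kap d h); have sk := csupp_kap d0 h0.
have cid : continuous (@id R) by move=> x; exact: cvg_id.
have cM (f g : R -> R) : continuous f -> continuous g -> continuous (fun x => f x * g x).
  by move=> cf cg x; apply: cvgM; [exact: cf|exact: cg].
have csh : continuous (fun x => moll d (x - h)).
  by apply: csm_continuous; apply: csm_shift; exact: csm_moll.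
have ssh := csupp_shift (c := h) cs.
have i1 : L1 leb (fun x => x * moll d x).
  by apply: (csupp_L1 _ (csuppM cs)); exact: cM.
have i2 : L1 leb (fun x => x * moll d (x - h)).
  by apply: (csupp_L1 _ (csuppM ssh)); exact: cM.
have ie : L1 leb (moll d) by exact: csupp_L1 cs.
have ik : L1 leb (kap d h) by exact: csupp_L1 sk.
have i3 : L1 leb (fun x => x * kap d h x).
  by apply: (csupp_L1 _ (csuppM sk)); exact: cM.
have e2 : \int[leb]_x (x * moll d (x - h)) = \int[leb]_x (x * moll d x) + h.
  have i4 : L1 leb (fun x => (x + h) * moll d x).
    have := L1D i1 (L1Z h ie); by congr L1; apply/funext => x; ring.
  transitivity (\int[leb]_x ((x + h) * moll d x)).
    rewrite [RHS](mpres_Rint (mpres_shift h) i4).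
    by apply: eq_Rintegral => x _ /=; rewrite subrK.
  rewrite -[X in _ = _ + X]mulr1 -(moll_int d0) -RintZ// -RintD//; last exact: L1Z.
  by apply: eq_Rintegral => x _; ring.
have D x : is_derive x (1 : R) (fun x => x * kap d h x) (kap d h x + h^-1 * (x * moll d x - x * moll d (x - h))).
  apply: (is_derive_eq (is_deriveM (is_derive_id x 1) (is_derive_kap d h x))).
  by rewrite /dkap /GRing.scale/=; ring.
have i5 : L1 leb (fun x => h^-1 * (x * moll d x - x * moll d (x - h))) by exact/L1Z/L1B.
have cD : continuous (fun x => kap d h x + h^-1 * (x * moll d x - x * moll d (x - h))).
  move=> x; apply: cvgD; first exact: ck.
  apply: cvgMr; apply: cvgB; [exact: (cM _ _ cid ce)|exact: (cM _ _ cid csh)].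
have := integral_derivative_line D cD i3 (L1D ik i5).
rewrite (RintD ik i5) (RintZ h^-1 (L1B i1 i2)) (RintB i1 i2) e2.
set S := \int[leb]_x (x * _); set K := \int[leb]_x _; have hn : h != 0 by rewrite gt_eqF.
move=> e; have -> : K = (K + h^-1 * (S - (S + h))) + 1 by field.
by rewrite e add0r.
Qed.

End calculus_on_the_line.

(** * Kernels built from smooth profiles, and derivatives of mollified functions *)

Section smooth_kernels.
Context {R : realType}.
Local Notation mR := (measurableTypeR R).
Local Notation mR2 := (mR * mR)%type.
Local Notation leb := (@lebesgue_measure R).
Local Notation leb2 := (@leb2 R).
Implicit Types (a b : R -> R) (d h l r : R).

Definition ck a := csm a /\ exists l r, csupp a l r.

Lemma ck_derive a : ck a -> ck (derive1 a).
Proof.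
move=> [ha [l [r sa]]]; split; first exact: csm_derive1.
by exists l, r; exact: csupp_derive.
Qed.

Lemma ck_continuous a : ck a -> continuous a.
Proof. by move=> [/csm_continuous]. Qed.

Lemma ck_measurable a : ck a -> measurable_fun setT (a : mR -> mR).
Proof. by move=> /ck_continuous/continuous_measurableR. Qed.

Lemma ck_bounded a : ck a -> exists C, forall x, `|a x| <= C.
Proof. by move=> [ha [l [r sa]]]; apply: csupp_bounded sa; exact: csm_continuous. Qed.

Lemma ck_L1 a : ck a -> L1 leb a.
Proof. by move=> [ha [l [r sa]]]; apply: csupp_L1 sa; exact: csm_continuous. Qed.

Lemma ck_moll d : 0 < d -> ck (moll d).
Proof. by move=> d0; split; [exact: csm_moll|exists (- d), d; exact: csupp_moll]. Qed.

Lemma ck_kap d h : 0 < d -> 0 < h -> ck (kap d h).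
Proof. by move=> d0 h0; split; [exact: csm_kap|exists (- d), (h + d); exact: csupp_kap]. Qed.

Lemma derive1_kap d h : derive1 (kap d h) = dkap d h.
Proof. by apply/funext => x; rewrite derive1E; have [] := is_derive_kap d h x. Qed.

Lemma kern_tens2 a b : L1 leb a -> L1 leb b -> (exists C, forall x, `|a x| <= C) ->
  (exists C, forall x, `|b x| <= C) -> kern (tens2 a b).
Proof.
move=> ia ib [C hC] [D hD]; split.
  apply: (@L1_prod _ _ _ _ _ leb leb _ (fun x => nrm1 leb b * `|a x|)).
  - apply: measurable_funM; first exact: measurableT_comp (L1_meas ia) _.
    exact: measurableT_comp (L1_meas ib) _.
  - exact/L1Z/L1_norm.
  - apply: aeW => x; split; first by rewrite /tens2/=; exact: L1Z.
    under eq_Rintegral do rewrite /tens2/= normrM.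
    by rewrite RintZ ?[nrm1 _ _ * _]mulrC//; exact: L1_norm.
exists (C * D) => s; rewrite normrM ler_pM//.
Qed.

Lemma kern_ck a b : ck a -> ck b -> kern (tens2 a b).
Proof.
by move=> ha hb; apply: kern_tens2; [exact: ck_L1|exact: ck_L1|exact: ck_bounded|exact: ck_bounded].
Qed.

Lemma tens2_int a b : ck a -> ck b ->
  \int[leb2]_s tens2 a b s = (\int[leb]_x a x) * \int[leb]_x b x.
Proof.
move=> ha hb; have [iK _] := kern_ck ha hb.
rewrite [LHS](fubini_Rint iK) /tens2/=.
rewrite (_ : \int[leb]_x _ = \int[leb]_x ((\int[leb]_x b x) * a x)); last first.
  by apply: eq_Rintegral => x _; rewrite RintZ 1?mulrC//; exact: ck_L1.
by rewrite RintZ 1?mulrC//; exact: ck_L1.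
Qed.

Lemma pker_tens2 (rho : R) a b la ra lb rb : ck a -> ck b -> csupp a la ra -> csupp b lb rb ->
  `|la| <= rho -> `|ra| <= rho -> `|lb| <= rho -> `|rb| <= rho ->
  (forall x, 0 <= a x) -> (forall x, 0 <= b x) ->
  \int[leb]_x a x = 1 -> \int[leb]_x b x = 1 -> pker rho (tens2 a b).
Proof.
move=> ha hb sa sb la_ ra_ lb_ rb_ a0 b0 ia ib; split.
- exact: kern_ck.
- by move=> s; exact: mulr_ge0.
- by rewrite tens2_int// ia ib mulr1.
- have H l r x : `|l| <= rho -> `|r| <= rho -> x \in `[l, r] -> `|x| <= rho.
    by rewrite in_itv/= !ler_norml => /andP[? ?] /andP[? ?] /andP[? ?]; apply/andP; split; lra.
  move=> s; rewrite mulf_eq0 negb_or => /andP[/sa s1 /sb s2].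
  by split; [exact: H s1|exact: H s2].
Qed.

Lemma pker_moll_moll d : 0 < d -> pker d (tens2 (moll d) (moll d)).
Proof.
move=> d0; have s := csupp_moll d0; have k := ck_moll d0.
by apply: (pker_tens2 k k s s); rewrite ?normrN ?gtr0_norm//;
  [move=> x; exact: moll_ge0|move=> x; exact: moll_ge0|exact: moll_int|exact: moll_int].
Qed.

Lemma pker_moll_kap d h : 0 < d -> 0 < h -> pker (h + d) (tens2 (moll d) (kap d h)).
Proof.
move=> d0 h0; have s := csupp_moll d0; have k := ck_moll d0.
apply: (pker_tens2 k (ck_kap d0 h0) s (csupp_kap d0 h0)); rewrite ?normrN ?gtr0_norm//; try lra.
- by move=> x; exact: moll_ge0.
- by move=> x; exact: kap_ge0.
- exact: moll_int.
- exact: kap_int.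
Qed.

(** A common setting for [L1] and [L2] functions: it asks just that convolution with any kernel
    converge at every point. *)
Definition locL (f : R * R -> R) := measurable_fun setT (f : mR2 -> mR) /\
  forall K, kern K -> forall x, L1 leb2 (fun y => f y * K (sub2 x y)).

Lemma locL_L1 f : L1 leb2 f -> locL f.
Proof. by move=> fi; split; [exact: L1_meas fi|move=> K kK x; exact: cv_L1ok]. Qed.

Lemma locL_L2 f : L2 leb2 f -> locL f.
Proof. by move=> fi; split; [exact: L2_meas fi|move=> K kK x; exact: cv_L2ok]. Qed.

Lemma cv_swap K f x : L1 leb2 (fun y => f y * K (sub2 x y)) ->
  cv K f x = cv (fun s => K (s.2, s.1)) (fun y => f (y.2, y.1)) (x.2, x.1).
Proof.
move=> i; rewrite /cv (mpres_Rint (mpres_swap leb leb) i).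
by apply: eq_Rintegral => -[y1 y2] _.
Qed.

Lemma L1_swapP (f : R * R -> R) : L1 leb2 (fun y => f (y.2, y.1)) -> L1 leb2 f.
Proof. by move=> /L1_swap2; congr L1; apply/funext => -[y1 y2]. Qed.

Lemma locL_swap f : locL f -> locL (fun y => f (y.2, y.1)).
Proof.
move=> [mf fi]; split.
  by apply: (measurableT_comp mf); exact: measurable_fun_pair.
move=> K kK x; apply: L1_swapP => /=.
have kK' : kern (fun s => K (s.2, s.1)).
  have [iK [C hC]] := kK; split; first exact: L1_swap2.
  by exists C => s.
have := fi _ kK' (x.2, x.1); congr L1; apply/funext => -[y1 y2]//.
Qed.

(** Differentiation under the integral sign. As [f] is only assumed integrable against kernels, the
    dominating function must itself have the form of [f] times a kernel; here the kernel is an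
    indicator in the first variable times [b]. *)
Lemma is_derive_cv1 a b f x1 x2 : ck a -> ck b -> locL f ->
  is_derive x1 (1 : R) (fun t => cv (tens2 a b) f (t, x2)) (cv (tens2 (derive1 a) b) f (x1, x2)).
Proof.
move=> ha hb [mf fi]; have kab := kern_ck ha hb.
have ha' := ck_derive ha; have [M hM] := ck_bounded ha'.
have M0 : 0 <= M by exact: le_trans (hM 0).
have [csa [l [r sa']]] := ha'.
pose rho := Num.max `|l| `|r|.
have sa x : derive1 a x != 0 -> `|x| <= rho.
  move=> /sa'; rewrite in_itv/= => /andP[lx xr]; rewrite le_max.
  have [x0|x0] := leP 0 x.
    by apply/orP; right; rewrite ger0_norm// (le_trans xr)// ler_norm.
  apply/orP; left; rewrite ltr0_norm//; have := ler_norm (- l); rewrite normrN; lra.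
(* The interval is enlarged by [1] so that [I (x1 - y1) = 1] whenever [t - y1] lies in the support
   of the derivative of [a] and [|t - x1| < 1]. *)
pose I := \1_(`[- (rho + 1), rho + 1]%classic : set R) : R -> R.
have iI : L1 leb I by exact: integrable_indic_itv.
have I1 x : `|I x| <= 1 by rewrite /I indicE; case: (_ \in _); rewrite ?normr1 ?normr0.
have kI : kern (tens2 I b).
  by apply: kern_tens2 => //; [exact: ck_L1|exists 1|exact: ck_bounded].
pose F (t : R) (y : R * R) := f y * tens2 a b (sub2 (t, x2) y).
have dF t y : is_derive t (1 : R) (F ^~ y) (f y * tens2 (derive1 a) b (sub2 (t, x2) y)).
  have h1 : is_derive t (1 : R) (fun t => a (t - y.1)) (derive1 a (t - y.1)).
    have := is_derive_affine (csm_derive ha.1 (1 * t + - y.1)); rewrite !mul1r.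
    by congr is_derive; apply/funext => z; rewrite mul1r.
  apply: (is_derive_eq (is_deriveM (is_derive_cst (f y) t (1 : R))
    (is_deriveM h1 (is_derive_cst (b (x2 - y.2)) t (1 : R))))).
  by rewrite /GRing.scale/= /tens2 /sub2/=; ring.
pose G y := M * `|f y * tens2 I b (sub2 (x1, x2) y)|.
have iG : L1 leb2 G by apply/L1Z/L1_norm; exact: fi.
have GF t y : (`](x1 - 1), (x1 + 1)[%classic : set R) t -> setT y -> `|partial1of2 F t y| <= G y.
  rewrite /= in_itv/= => /andP[t1 t2] _.
  rewrite partial1of2E; have [_ ->] := dF t y; rewrite /G /tens2 /sub2/=.
  have [->|an0] := eqVneq (derive1 a (t - y.1)) 0.
    by rewrite mul0r mulr0 normr0 mulr_ge0.
  have := sa _ an0; rewrite ler_norml => /andP[s1 s2].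
  have -> : I (x1 - y.1) = 1 by rewrite /I indic_sym ler_norml (_ : _ && _)//; apply/andP; split; lra.
  by rewrite mul1r !normrM mulrCA ler_wpM2r.
have Ia : (`](x1 - 1), (x1 + 1)[%classic : set R) x1 by rewrite /= in_itv/=; apply/andP; split; lra.
have iF t : (`](x1 - 1), (x1 + 1)[%classic : set R) t -> leb2.-integrable setT (EFin \o F t).
  by move=> _; exact: fi.
have dF1 t y : (`](x1 - 1), (x1 + 1)[%classic : set R) t -> setT y -> derivable (F ^~ y) t 1.
  by move=> _ _; have [] := dF t y.
have G0 y : 0 <= G y by rewrite mulr_ge0.
apply: DeriveDef.
  exact: (derivable_under_integral measurableT Ia iF dF1 G0 iG GF).
rewrite -derive1E.
rewrite (differentiation_under_integral measurableT Ia iF dF1 G0 iG GF).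
by apply: eq_Rintegral => y _; rewrite partial1of2E; have [_ ->] := dF x1 y.
Qed.

Lemma is_derive_cv2 a b f x1 x2 : ck a -> ck b -> locL f ->
  is_derive x2 (1 : R) (fun t => cv (tens2 a b) f (x1, t)) (cv (tens2 a (derive1 b)) f (x1, x2)).
Proof.
move=> ha hb lf; have sw a' b' t : ck a' -> ck b' ->
    cv (tens2 a' b') f (x1, t) = cv (tens2 b' a') (fun y => f (y.2, y.1)) (t, x1).
  move=> ha' hb'; rewrite cv_swap; last exact: lf.2 _ (kern_ck ha' hb') _.
  by congr cv; apply/funext => s; rewrite /tens2/= mulrC.
rewrite sw//; last exact: ck_derive.
under eq_fun do rewrite sw//.
by apply: is_derive_cv1 => //; exact: locL_swap.
Qed.

Lemma continuous_cv1 a b f x2 : ck a -> ck b -> locL f ->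
  continuous (fun t => cv (tens2 a b) f (t, x2)).
Proof. by move=> ha hb lf t; exact: is_derive_continuous (is_derive_cv1 t x2 ha hb lf). Qed.

Lemma continuous_cv2 a b f x1 : ck a -> ck b -> locL f ->
  continuous (fun t => cv (tens2 a b) f (x1, t)).
Proof. by move=> ha hb lf t; exact: is_derive_continuous (is_derive_cv2 x1 t ha hb lf). Qed.

Lemma integral_partial2 (G G2 : R * R -> R) :
  (forall x1 x2, is_derive x2 (1 : R) (fun t => G (x1, t)) (G2 (x1, x2))) ->
  (forall x1, continuous (fun t => G2 (x1, t))) ->
  L1 leb2 G -> L1 leb2 G2 -> \int[leb2]_x G2 x = 0.
Proof.
move=> dG cG iG iG2; rewrite (fubini_Rint iG2).
rewrite -(mul0r (fine (leb setT))) -(Rintegral_cst _ measurableT).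
apply: ae_Rint_eq => //; first exact: L1_meas (L1_int iG2).
have := L1_slice iG; apply: filter_app; have := L1_slice iG2; apply: filterS => x1 h2 h1.
exact: (integral_derivative_line (dG x1) (cG x1) h1 h2).
Qed.

Lemma integral_partial1 (G G1 : R * R -> R) :
  (forall x1 x2, is_derive x1 (1 : R) (fun t => G (t, x2)) (G1 (x1, x2))) ->
  (forall x2, continuous (fun t => G1 (t, x2))) ->
  L1 leb2 G -> L1 leb2 G1 -> \int[leb2]_x G1 x = 0.
Proof.
move=> dG cG iG iG1.
rewrite [LHS](mpres_Rint (mpres_swap leb leb) iG1).
apply: (@integral_partial2 (fun x => G (x.2, x.1)) (fun x => G1 (x.2, x.1))).
- by move=> x1 x2; exact: dG.
- by move=> x1; exact: cG.
- exact: L1_swap2.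
- exact: L1_swap2.
Qed.

End smooth_kernels.

(** * Weak derivatives in time *)

Section absolutely_continuous_functions.
Context {R : realType}.
Local Notation mR := (measurableTypeR R).
Local Notation leb := (@lebesgue_measure R).
Implicit Types (F f g : R -> R) (s t T : R).

Lemma integrable_itv_sub F (i j : interval R) : leb.-integrable [set` i] (EFin \o F) ->
  [set` j] `<=` [set` i] -> leb.-integrable [set` j] (EFin \o F).
Proof. by move=> Fi ji; apply: integrableS Fi => //; exact: measurable_itv. Qed.

Lemma Rint_oo_cc f s t : leb.-integrable `[s, t] (EFin \o f) ->
  \int[leb]_(x in `]s, t[) f x = \int[leb]_(x in `[s, t]) f x.
Proof.
move=> fi; rewrite Rintegral_itv_bndo_bndc; last first.
  by apply: (integrable_itv_sub fi); exact: subset_itv_oo_cc.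
by rewrite Rintegral_itv_obnd_cbnd//; apply: (integrable_itv_sub fi); exact: subset_itv_oc_cc.
Qed.

Lemma bounded_derivative_lipschitz f f' C (x y : R) : (forall x : R, is_derive x (1 : R) f (f' x)) ->
  (forall x, `|f' x| <= C) -> `|f x - f y| <= C * `|x - y|.
Proof.
move=> ff' fC.
wlog xy : x y / y <= x.
  move=> h; have [/h//|/ltW/h] := leP y x.
  by rewrite [X in X <= _ -> _]distrC [X in _ * X]distrC.
have [->|yx] := eqVneq x y; first by rewrite !subrr !normr0 mulr0.
have {}yx : y < x by rewrite lt_neqAle eq_sym yx.
have [|c _ ->] := @MVT R f f' y x yx (fun z _ => ff' z).
  by apply: continuous_subspaceT => z; exact: is_derive_continuous (ff' z).
by rewrite normrM ler_wpM2r.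
Qed.

(* The chain rule holds for the primitives of continuous functions, which
   approximate [F] in [L1] and its primitive uniformly. *)
Lemma chain_rule_ac (beta beta' W F : R -> R) (C1 C2 s t : R) : s < t ->
  (forall x : R, is_derive x (1 : R) beta (beta' x)) -> continuous beta' ->
  (forall x, `|beta' x| <= C1) -> (forall x y, `|beta' x - beta' y| <= C2 * `|x - y|) ->
  leb.-integrable `[s, t] (EFin \o F) ->
  (forall r, r \in `[s, t] -> W r - W s = \int[leb]_(x in `[s, r]) F x) ->
  beta (W t) - beta (W s) = \int[leb]_(r in `[s, t]) (beta' (W r) * F r).
Proof.
move=> st bb' cb' b1 b2 Fi WF.
have mE : measurable (`[s, t]%classic : set mR) by exact: measurable_itv.
have Efin : (leb `[s, t]%classic < +oo)%E by rewrite lebesgue_measure_itv/=; case: ifP => _; rewrite ltry.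
have [phi_ [cphi iphi phiF]] := approximation_continuous_integrable mE Efin Fi.
have C1_ge0 : 0 <= C1 by exact: le_trans (b1 0).
have C2_ge0 : 0 <= C2.
  by have := b2 1 0; rewrite subr0 normr1 mulr1; exact: le_trans.
have sub_ r : r \in `[s, t] -> [set` `[s, r]] `<=` [set` `[s, t]].
  by rewrite in_itv/= => /andP[_ rt]; apply: subset_itvl; rewrite bnd_simp.
have iFphi n : leb.-integrable `[s, t] (EFin \o (fun x => F x - phi_ n x)).
  exact: (integrableB mE Fi (iphi n)).
pose eps n := \int[leb]_(x in `[s, t]) `|F x - phi_ n x|.
have eps0 : eps @ \oo --> 0.
  by apply/fine_cvg; apply: cvg_trans phiF; apply: near_eq_cvg; apply: nearW.
pose Wn n r := W s + \int[leb]_(x in `[s, r]) phi_ n x.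
have WnW n r : r \in `[s, t] -> `|W r - Wn n r| <= eps n.
  move=> rst; rewrite /Wn opprD addrA WF// -RintegralB//; last 2 first.
  - exact: (integrable_itv_sub Fi (sub_ _ rst)).
  - exact: (integrable_itv_sub (iphi n) (sub_ _ rst)).
  apply: (le_trans (le_normr_Rintegral _ (integrable_itv_sub (iFphi n) (sub_ _ rst)))) => //.
  rewrite /eps -lee_fin /Rintegral !fineK.
  - by apply: ge0_subset_integral => //;
      [exact: (measurable_int _ (integrable_norm (iFphi n)))|exact: sub_].
  - by apply: integrable_fin_num => //; exact: integrable_norm (iFphi n).
  - apply: integrable_fin_num => //; apply: integrable_norm.
    exact: integrable_itv_sub (iFphi n) (sub_ _ rst).
have cW n : {within `[s, t], continuous (Wn n)}.
  have := @parameterized_integral_continuous R s t (phi_ n) (ltW st) (iphi n).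
  move=> h x; apply: cvgD; [exact: cvg_cst|exact: h].
have dW n r : r \in `]s, t[ -> is_derive r (1 : R) (Wn n) (phi_ n r).
  rewrite in_itv/= => /andP[sr rt].
  have [h1 h2] := @continuous_FTC1_closed R (phi_ n) s r t rt (iphi n) sr (cphi n r).
  have h : is_derive r (1 : R) (fun r => \int[leb]_(x in `[s, r]) phi_ n x) (phi_ n r).
    by apply: DeriveDef; [exact: h1|rewrite -derive1E; exact: h2].
  by apply: (is_derive_eq (is_deriveD (is_derive_cst (W s) r (1 : R)) h)); rewrite add0r.
have cbW n : {within `[s, t], continuous (fun r => beta' (Wn n r) * phi_ n r)}.
  move=> x; apply: cvgM; first by apply: continuous_comp (cW n x) (cb' _).
  exact: (continuous_subspaceT (cphi n)).
have key n : beta (Wn n t) - beta (Wn n s) = \int[leb]_(r in `[s, t]) (beta' (Wn n r) * phi_ n r).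
  have bW r : r \in `]s, t[ -> is_derive r (1 : R) (beta \o Wn n) (beta' (Wn n r) * phi_ n r).
    by move=> rst; exact: (is_derive1_comp (bb' _) (dW n r rst)).
  have cbWn : {within `[s, t], continuous (beta \o Wn n)}.
    by move=> x; apply: continuous_comp (cW n x) _; exact: is_derive_continuous (bb' _).
  have /(continuous_within_itvP _ st)[_ cl cr] := cbWn.
  rewrite /Rintegral (@continuous_FTC2 _ _ (beta \o Wn n) s t st (cbW n))//.
  - by split => // x /bW[].
  - by move=> x /bW[_ <-]; rewrite derive1E.
have Wnt n : `|W t - Wn n t| <= eps n by apply: WnW; rewrite in_itv/= lexx ltW.
have Wns n : Wn n s = W s by rewrite /Wn set_itv1 Rintegral_set1 addr0.
have lhs : beta (Wn n t) - beta (Wn n s) @[n --> \oo] --> beta (W t) - beta (W s).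
  apply: cvgB; last first.
    by rewrite (_ : (fun n => _) = fun=> beta (W s)); [exact: cvg_cst|apply/funext => n; rewrite Wns].
  have h : Wn n t @[n --> \oo] --> W t.
    apply/cvgrPdist_le => e e0; have /cvgr0Pnorm_le/(_ _ e0) := eps0.
    by apply: filterS => n; apply: le_trans; apply: (le_trans (Wnt n)); exact: ler_norm.
  by apply: continuous_cvg => //; exact: is_derive_continuous (bb' _).
have mW : measurable_fun `[s, t]%classic (W : mR -> mR).
  apply: subspace_continuous_measurable_fun => //.
  have h := @parameterized_integral_continuous R s t F (ltW st) Fi.
  have h' : {within `[s, t], continuous (fun r => W s + \int[leb]_(x in `[s, r]) F x)}.
    by move=> x; apply: cvgD; [exact: cvg_cst|exact: h].
  apply: (subspace_eq_continuous _ h') => r /set_mem rst.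
  have e : W s + \int[leb]_(x in `[s, r]) F x = W r by rewrite -WF// addrC subrK.
  exact: e.
have mbW : measurable_fun `[s, t]%classic ((beta' \o W) : mR -> mR).
  by apply: measurableT_comp mW; exact: continuous_measurableR.
have bnd : [bounded (beta' \o W) x | x in `[s, t]%classic].
  exists C1; split; first exact: num_real.
  by move=> M CM x _ /=; rewrite (le_trans (b1 _))// ltW.
have iR : leb.-integrable `[s, t] (EFin \o (fun r => beta' (W r) * F r)).
  have := integrableMr mE mbW bnd Fi; apply: eq_integrable => // x _.
have iRn n : leb.-integrable `[s, t] (EFin \o (fun r => beta' (Wn n r) * phi_ n r)).
  by apply: continuous_compact_integrable; [exact: segment_compact|exact: cbW].
have iz1 n : leb.-integrable `[s, t] (EFin \o (fun x => C1 * `|F x - phi_ n x|)).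
  have := integrableZl mE C1 (integrable_norm (iFphi n)).
  by apply: eq_integrable => // x _.
have iz2 n : leb.-integrable `[s, t] (EFin \o (fun x => C2 * eps n * `|F x|)).
  have := integrableZl mE (C2 * eps n) (integrable_norm Fi).
  by apply: eq_integrable => // x _.
pose nF := \int[leb]_(x in `[s, t]) `|F x|.
have err n : `|\int[leb]_(r in `[s, t]) (beta' (W r) * F r) -
    \int[leb]_(r in `[s, t]) (beta' (Wn n r) * phi_ n r)| <= C1 * eps n + C2 * eps n * nF.
  rewrite -RintegralB//.
  apply: (le_trans (le_normr_Rintegral _ (integrableB mE iR (iRn n)))) => //.
  rewrite -[X in _ <= X + _]RintegralZl//; last exact: integrable_norm (iFphi n).
  rewrite -[X in _ <= _ + X]RintegralZl//; last exact: integrable_norm Fi.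
  rewrite -RintegralD//.
  apply: le_Rintegral => //.
  - by apply: integrable_norm; exact: (integrableB mE iR (iRn n)).
  - have := integrableD mE (iz1 n) (iz2 n).
    by apply: eq_integrable => // x _.
  move=> r rst; rewrite (_ : _ - _ = beta' (Wn n r) * (F r - phi_ n r) +
    (beta' (W r) - beta' (Wn n r)) * F r); last by ring.
  apply: (le_trans (ler_normD _ _)); rewrite lerD//.
    by rewrite normrM ler_wpM2r.
  by rewrite normrM ler_wpM2r// (le_trans (b2 _ _))// ler_wpM2l// WnW.
have rhs : \int[leb]_(r in `[s, t]) (beta' (Wn n r) * phi_ n r) @[n --> \oo] -->
    \int[leb]_(r in `[s, t]) (beta' (W r) * F r).
  have c0 : C1 * eps n + C2 * eps n * nF @[n --> \oo] --> 0.
    rewrite (_ : 0 = C1 * 0 + C2 * 0 * nF); last by rewrite !mulr0 mul0r addr0.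
    by apply: cvgD; [apply: cvgMr|apply: cvgMl; apply: cvgMr].
  apply/cvgrPdist_le => e e0; have /cvgr0Pnorm_le/(_ _ e0) := c0.
  by apply: filterS => n; apply: le_trans; apply: (le_trans (err n)); exact: ler_norm.
move: lhs; under eq_fun do rewrite key.
by move=> /(cvg_lim (@Rhausdorff R)) <-; move: rhs => /(cvg_lim (@Rhausdorff R)).
Qed.

End absolutely_continuous_functions.

(** * From an equation tested in time to an integral identity *)

Section weak_time_derivative.
Context {R : realType}.
Local Notation mR := (measurableTypeR R).
Local Notation leb := (@lebesgue_measure R).
Implicit Types (g G : R -> R) (s t T : R).

Lemma restrict_L1 G (i : interval R) : leb.-integrable [set` i] (EFin \o G) ->
  L1 leb (G \_ [set` i]).
Proof.
by move=> Gi; rewrite /L1 -restrict_EFin -integrable_mkcond//; exact: measurable_itv.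
Qed.

Lemma measurable_indicR (i : interval R) :
  measurable_fun setT (\1_([set` i] : set R) : mR -> mR).
Proof. by apply: measurable_indic; exact: measurable_itv. Qed.

Lemma Rint_indic G (i : interval R) :
  \int[leb]_(x in [set` i]) G x = \int[leb]_x (\1_([set` i] : set R) x * G x).
Proof.
rewrite Rintegral_mkcond; apply: eq_Rintegral => x _; rewrite patchE indicE.
by case: (x \in _); rewrite ?mul1r ?mul0r.
Qed.

Lemma indic_norm_le (A : set R) (x : R) : `|\1_A x : R| <= 1.
Proof. by rewrite indicE; case: (_ \in _); rewrite ?normr1 ?normr0. Qed.

Lemma mollification_cvg (g : R -> R) (T s c : R) (d : R^nat) : {within `[0, T], continuous g} ->
  leb.-integrable `[0, T] (EFin \o g) -> c < s -> s + c < T -> 0 < c ->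
  (forall n, 0 < d n <= c) -> d @ \oo --> 0 ->
  \int[leb]_(x in `]0, T[) (moll (d n) (x - s) * g x) @[n --> \oo] --> g s.
Proof.
move=> cg ig cs scT c0 dc d0.
have s0T : 0 < s < T by apply/andP; split; lra.
have [cgo _ _] : [/\ {in `]0, T[, continuous g}, g @ 0^'+ --> g 0 & g @ T^'- --> g T].
  by apply/continuous_within_itvP => //; lra.
have cgs : {for s, continuous g} by apply: cgo; rewrite in_itv/=.
have ik n : L1 leb (fun x => moll (d n) (x - s)).
  have /andP[dn0 _] := dc n.
  exact: (mpres_L1 (mpres_shift s) (ck_L1 (ck_moll dn0))).
have supk n x : moll (d n) (x - s) != 0 -> `|x - s| <= d n.
  have /andP[dn0 _] := dc n.
  by move=> /(csupp_moll dn0); rewrite in_itv/= ler_norml.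
pose gh := g \_ `]0, T[%classic.
have ighT : leb.-integrable `]0, T[ (EFin \o g).
  by apply: (integrable_itv_sub ig); exact: subset_itv_oo_cc.
have igh : L1 leb gh by exact: restrict_L1.
have iphig n : L1 leb (fun x => moll (d n) (x - s) * gh x).
  have /andP[dn0 _] := dc n; have [C hC] := ck_bounded (ck_moll dn0).
  by apply: (@L1_bound _ _ _ _ _ _ C) => //; exact: L1_meas (ik n).
have e1 n : \int[leb]_(x in `]0, T[) (moll (d n) (x - s) * g x) =
    \int[leb]_x (moll (d n) (x - s) * gh x).
  rewrite Rintegral_mkcond; apply: eq_Rintegral => x _; rewrite /gh !patchE.
  by case: (x \in _); rewrite ?mulr0.
under eq_fun do rewrite e1.
have int1 n : \int[leb]_x moll (d n) (x - s) = 1.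
  have /andP[dn0 _] := dc n; have := moll_int dn0.
  by rewrite (mpres_Rint (mpres_shift s) (ck_L1 (ck_moll dn0))).
apply/cvgrPdist_le => e e0.
have : \forall x \near s, `|g s - g x| <= e by move/cvgrPdist_le : cgs => /(_ _ e0).
move=> /nbhs_ballP[rho /= rho0 hrho].
have /cvgr0Pnorm_lt/(_ _ rho0) := d0; apply: filterS => n dn.
have /andP[dn0 dnc] := dc n; rewrite gtr0_norm// in dn.
have i2 : L1 leb (fun x => moll (d n) (x - s) * (g s - gh x)).
  have := L1B (L1Z (g s) (ik n)) (iphig n); by congr L1; apply/funext => x; ring.
rewrite [X in `|X|](_ : _ = \int[leb]_x (moll (d n) (x - s) * (g s - gh x))); last first.
  rewrite -[X in X - _]mulr1 -(int1 n) -RintZ// -RintB//; last exact: L1Z.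
  by apply: eq_Rintegral => x _; ring.
apply: (le_trans (le_normr_Rintegral _ i2)) => //.
rewrite -[leRHS]mulr1 -(int1 n) -RintZ//.
apply: Rint_le; [exact: L1_norm|exact: L1Z|] => x.
have [->|mx] := eqVneq (moll (d n) (x - s)) 0; first by rewrite mul0r mulr0 normr0.
have xs := supk _ _ mx.
rewrite normrM (ger0_norm (moll_ge0 _ dn0)) mulrC ler_wpM2r ?moll_ge0//.
have -> : gh x = g x.
  rewrite /gh patchE mem_set//= in_itv/=; move: xs; rewrite ler_norml => /andP[? ?].
  by apply/andP; split; lra.
by apply: hrho; rewrite /ball/= distrC; lra.
Qed.

(** The test function is a smoothed indicator of []s, t[], the difference of two smoothed steps: its
    derivative evaluates [g] near [s] and, with the opposite sign, near [t]. *)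
Lemma weak_time_derivative_interior g G (T s t : R) : {within `[0, T], continuous g} ->
  leb.-integrable `]0, T[ (EFin \o G) ->
  (forall th l r, csm th -> csupp th l r -> 0 < l -> r < T ->
    \int[leb]_(x in `]0, T[) (derive1 th x * g x + th x * G x) = 0) ->
  0 < s -> s < t -> t < T -> g t - g s = \int[leb]_(x in `]s, t[) G x.
Proof.
move=> cg iG H s0 st tT.
have ig : leb.-integrable `[0, T] (EFin \o g).
  by apply: continuous_compact_integrable => //; exact: segment_compact.
have igo : leb.-integrable `]0, T[ (EFin \o g).
  by apply: (integrable_itv_sub ig); exact: subset_itv_oo_cc.
(* Half the distances to the end points, so that the transition zones stay inside []0, T[]. *)
pose c := Num.min (s / 2) ((T - t) / 2).
have c0 : 0 < c by rewrite lt_min; apply/andP; split; rewrite divr_gt0//; lra.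
have cs : c < s by rewrite /c gt_min; apply/orP; left; lra.
have ctT : t + c < T.
  have : c <= (T - t) / 2 by rewrite /c ge_min lexx orbT.
  lra.
pose d (n : nat) : R := c * n.+1%:R^-1.
have d0 : d @ \oo --> 0.
  by rewrite -[X in _ --> X](mulr0 c); apply: cvgMr; exact: cvg_harmonic.
have dc n : 0 < d n <= c.
  apply/andP; split; first by rewrite mulr_gt0// invr_gt0.
  by rewrite ler_piMr ?(ltW c0)// invf_le1// ler1n.
have As := @mollification_cvg g T s c d cg ig cs _ c0 dc d0.
have At := @mollification_cvg g T t c d cg ig _ ctT c0 dc d0.
have {As} As : \int[leb]_(x in `]0, T[) (moll (d n) (x - s) * g x) @[n --> \oo] --> g s.
  by apply: As; lra.
have {At} At : \int[leb]_(x in `]0, T[) (moll (d n) (x - t) * g x) @[n --> \oo] --> g t.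
  by apply: At; lra.
pose th n x := sstep (d n) s x - sstep (d n) t x.
pose Gh := G \_ `]0, T[%classic.
have iGh : L1 leb Gh by exact: restrict_L1.
have mth n : measurable_fun setT (th n : mR -> mR).
  by apply: measurable_funB; apply: continuous_measurableR; apply: csm_continuous; exact: csm_sstep.
have th1 n x : `|th n x| <= 1.
  have /andP[dn0 _] := dc n.
  have /andP[? ?] := sstep_01 s x dn0; have /andP[? ?] := sstep_01 t x dn0.
  by rewrite /th ler_norml; apply/andP; split; lra.
have mGh : measurable_fun setT (Gh : mR -> mR) by exact: L1_meas iGh.
have cB : cvg1 leb (fun n x => th n x * Gh x) (fun x => \1_(`]s, t[%classic : set R) x * Gh x).
  apply: (@L1_dct _ _ _ leb _ _ (fun x => `|Gh x|)).
  - by move=> n; exact: (measurable_funM (mth n) mGh).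
  - by apply: measurable_funM => //; exact: measurable_indicR.
  - exact: L1_norm.
  - by apply: aeW => x n; rewrite normrM ler_piMl.
  (* Away from [s] and [t] the smoothed steps already have their final value once [d n] is below the
     distance of [x] to both points. *)
  - have := ae_neq s; apply: filter_app; have := ae_neq t; apply: filterS => x xt xs.
    apply: cvgMl; apply: cvg_near_cst.
    have [e e0 he] : exists2 e : R, 0 < e & e < `|x - s| /\ e < `|x - t|.
      have n1 : 0 < `|x - s| by rewrite normr_gt0 subr_eq0.
      have n2 : 0 < `|x - t| by rewrite normr_gt0 subr_eq0.
      exists (Num.min (`|x - s| / 2) (`|x - t| / 2)).
        by rewrite lt_min !divr_gt0.
      by split; rewrite gt_min; apply/orP; [left|right]; lra.
    have /cvgr0Pnorm_lt/(_ _ e0) := d0; apply: filterS => n dn.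
    have /andP[dn0 _] := dc n; rewrite gtr0_norm// in dn.
    have [e1 e2] := he; rewrite /th indicE mem_setE in_itv/=.
    have [xs'|sx] := ltP x s.
      have h1 : x - s = - `|x - s| by rewrite ltr0_norm ?opprK//; lra.
      have h2 : x - t = - `|x - t| by rewrite ltr0_norm ?opprK//; lra.
      by rewrite ltNge (ltW xs')/= !sstep_left ?subrr//; lra.
    have sx' : s < x by rewrite lt_neqAle eq_sym xs.
    have h1 : x - s = `|x - s| by rewrite gtr0_norm//; lra.
    rewrite sx' /= (@sstep_right _ (d n) s)//; last by lra.
    have [xt'|tx] := ltP x t.
      have h2 : x - t = - `|x - t| by rewrite ltr0_norm ?opprK//; lra.
      by rewrite sstep_left ?subr0//; lra.
    have h2 : x - t = `|x - t| by rewrite ger0_norm//; lra.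
    by rewrite sstep_right ?subrr//; lra.
have idth n (a : R) : leb.-integrable `]0, T[ (EFin \o (fun x => moll (d n) (x - a) * g x)).
  have /andP[dn0 _] := dc n; have [C hC] := ck_bounded (ck_moll dn0).
  have mE : measurable (`]0, T[%classic : set mR) by exact: measurable_itv.
  have mm : measurable_fun `]0, T[%classic ((fun x => moll (d n) (x - a)) : mR -> mR).
    apply: measurable_funTS; apply: continuous_measurableR; apply: csm_continuous.
    by apply: csm_shift; exact: csm_moll.
  have bb : [bounded moll (d n) (x - a) | x in `]0, T[%classic].
    exists C; split; first exact: num_real.
    by move=> M CM x _ /=; rewrite (le_trans (hC _))// ltW.
  by have := integrableMr mE mm bb igo; apply: eq_integrable => // x _.
have ithG n : leb.-integrable `]0, T[ (EFin \o (fun x => th n x * G x)).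
  have mE : measurable (`]0, T[%classic : set mR) by exact: measurable_itv.
  have mm : measurable_fun `]0, T[%classic (th n : mR -> mR).
    exact: measurable_funTS (mth n).
  have bb : [bounded th n x | x in `]0, T[%classic].
    exists 1; split; first exact: num_real.
    by move=> M CM x _ /=; rewrite (le_trans (th1 _ _))// ltW.
  by have := integrableMr mE mm bb iG; apply: eq_integrable => // x _.
have key n : \int[leb]_x (th n x * Gh x) =
    \int[leb]_(x in `]0, T[) (moll (d n) (x - t) * g x) -
    \int[leb]_(x in `]0, T[) (moll (d n) (x - s) * g x).
  have /andP[dn0 dnc] := dc n.
  have cth : csm (th n).
    apply: csmD; first exact: csm_sstep.
    have := csmM (csm_cst (-1)) (csm_sstep (d n) t).
    by under eq_fun do rewrite mulN1r.
  have sth : csupp (th n) (s - d n) (t + d n).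
    move=> x; apply: contraNT; rewrite in_itv/= negb_and -!ltNge => /orP[xl|xr].
      by rewrite /th !sstep_left ?subrr//; lra.
    by rewrite /th !sstep_right ?subrr//; lra.
  have := H _ _ _ cth sth; rewrite subr_gt0 => /(_ (le_lt_trans dnc cs)).
  have tdT : t + d n < T by lra.
  move=> /(_ tdT).
  have dth x : derive1 (th n) x = moll (d n) (x - s) - moll (d n) (x - t).
    have [_ <-] := is_deriveB (is_derive_sstep (d n) s x) (is_derive_sstep (d n) t x).
    by rewrite derive1E.
  have -> : \int[leb]_(x in `]0, T[) (derive1 (th n) x * g x + th n x * G x) =
      \int[leb]_(x in `]0, T[) ((moll (d n) (x - s) * g x - moll (d n) (x - t) * g x) + th n x * G x).
    by apply: eq_Rintegral => x _; rewrite dth mulrBl.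
  have iB : leb.-integrable `]0, T[
      (EFin \o (fun x => moll (d n) (x - s) * g x - moll (d n) (x - t) * g x)).
    have mE : measurable (`]0, T[%classic : set mR) by exact: measurable_itv.
    by have := integrableB mE (idth n s) (idth n t); apply: eq_integrable => // x _.
  rewrite (RintegralD _ iB (ithG n))//.
  rewrite RintegralB//.
  have -> : \int[leb]_x (th n x * Gh x) = \int[leb]_(x in `]0, T[) (th n x * G x).
    rewrite [RHS]Rintegral_mkcond; apply: eq_Rintegral => x _; rewrite /Gh !patchE.
    by case: (x \in _); rewrite ?mulr0.
  lra.
have l1 := cvg1_int cB.
have l2 : \int[leb]_(x in `]0, T[) (moll (d n) (x - t) * g x) -
    \int[leb]_(x in `]0, T[) (moll (d n) (x - s) * g x) @[n --> \oo] --> g t - g s.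
  exact: cvgB At As.
rewrite (_ : (fun n => \int[leb]_x (th n x * Gh x)) = (fun n =>
  \int[leb]_(x in `]0, T[) (moll (d n) (x - t) * g x) -
  \int[leb]_(x in `]0, T[) (moll (d n) (x - s) * g x))) in l1; last exact/funext.
have <- := cvg_lim (@Rhausdorff R) l2.
have -> := cvg_lim (@Rhausdorff R) l1.
rewrite [RHS]Rint_indic; apply: eq_Rintegral => x _; rewrite /Gh patchE indicE.
case: (boolP (x \in `]s, t[%classic)) => [|_]; last by rewrite !mul0r.
rewrite !mem_setE !in_itv/= => /andP[sx xt].
by rewrite ifT//; apply/andP; split; lra.
Qed.

Lemma const_itv_closure (g : R -> R) (a b c : R) : a < b -> {within `[a, b], continuous g} ->
  (forall x, a < x < b -> g x = c) -> forall x, a <= x <= b -> g x = c.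
Proof.
move=> ab cg gc x /andP[ax xb]; have /(continuous_within_itvP _ ab)[_ ga gb] := cg.
have ha : g y @[y --> a^'+] --> c.
  apply: cvg_near_cst; have h := nbhs_right_lt ab; have := nbhs_right_gt a.
  by apply: filter_app; apply: filterS h => y yb ay; apply: gc; rewrite ay.
have hb : g y @[y --> b^'-] --> c.
  apply: cvg_near_cst; have h := nbhs_left_gt ab; have := nbhs_left_lt b.
  by apply: filter_app; apply: filterS h => y yb ay; apply: gc; rewrite yb.
have [->|xa] := eqVneq x a.
  by rewrite -(cvg_lim (@Rhausdorff R) ga) (cvg_lim (@Rhausdorff R) ha).
have [->|xb'] := eqVneq x b.
  by rewrite -(cvg_lim (@Rhausdorff R) gb) (cvg_lim (@Rhausdorff R) hb).
by apply: gc; rewrite !lt_neqAle ax xb xb' eq_sym xa.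
Qed.

(** By the interior case [g] minus the primitive of [G] is constant on []0, T[]; continuity on the
    closed interval carries this to the end points, where no test function reaches. *)
Lemma weak_time_derivative g G (T s t : R) : 0 < T -> {within `[0, T], continuous g} ->
  leb.-integrable `]0, T[ (EFin \o G) ->
  (forall th l r, csm th -> csupp th l r -> 0 < l -> r < T ->
    \int[leb]_(x in `]0, T[) (derive1 th x * g x + th x * G x) = 0) ->
  0 <= s -> s < t -> t <= T -> g t - g s = \int[leb]_(x in `]s, t[) G x.
Proof.
move=> T0 cg iG H s0 st tT.
pose Gh := G \_ `]0, T[%classic.
have iGh (i : interval R) : leb.-integrable [set` i] (EFin \o Gh).
  by apply: integrableS (restrict_L1 iG) => //; exact: measurable_itv.
have GhG a b : 0 <= a -> b <= T -> \int[leb]_(x in `[a, b]) Gh x = \int[leb]_(x in `]a, b[) G x.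
  move=> a0 bT; rewrite -Rint_oo_cc//; apply: eq_Rintegral => x /set_mem/=.
  rewrite in_itv/= => /andP[ax xb]; rewrite /Gh patchE mem_set//= in_itv/=.
  by rewrite (le_lt_trans a0)// (lt_le_trans xb).
pose P x := \int[leb]_(y in `[0, x]) Gh y.
have Psub a b : 0 <= a -> a < b -> b <= T -> P b - P a = \int[leb]_(x in `]a, b[) G x.
  move=> a0 ab bT; rewrite /P -GhG//.
  have i0b : leb.-integrable `[0, b] (EFin \o Gh) by exact: iGh.
  have e := @Rintegral_itvB R Gh (BLeft 0) (BRight b) a i0b.
  rewrite e ?bnd_simp//; last exact: ltW.
  by rewrite Rintegral_itv_obnd_cbnd//; exact: iGh.
have cP : {within `[0, T], continuous P}.
  exact: parameterized_integral_continuous (ltW T0) (iGh _).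
have cD : {within `[0, T], continuous (fun x => g x - P x)}.
  by move=> x; apply: cvgB; [exact: cg|exact: cP].
have Dc x : 0 < x < T -> g x - P x = g (T / 2) - P (T / 2).
  move=> /andP[x0 xT]; have h2 : 0 < T / 2 by lra.
  have h2T : T / 2 < T by lra.
  have [xl|xr|->//] := ltgtP x (T / 2).
    have := weak_time_derivative_interior cg iG H x0 xl h2T.
    by rewrite -Psub//; lra.
  have := weak_time_derivative_interior cg iG H h2 xr xT.
  by rewrite -Psub//; lra.
have D := const_itv_closure T0 cD Dc.
have tD : g t - P t = g (T / 2) - P (T / 2) by apply: D; lra.
have sD : g s - P s = g (T / 2) - P (T / 2) by apply: D; lra.
rewrite -Psub//; lra.
Qed.

(** The hypothesis says that [G] is the weak derivative of the zero function, so its integrals over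
    intervals vanish, and Lebesgue differentiation of the primitive gives the claim. *)
Lemma ae_eq0_itv G (T : R) : 0 < T -> leb.-integrable `]0, T[ (EFin \o G) ->
  (forall th l r, csm th -> csupp th l r -> 0 < l -> r < T ->
    \int[leb]_(x in `]0, T[) (th x * G x) = 0) ->
  {ae leb, forall t, t \in `]0, T[ -> G t = 0}.
Proof.
move=> T0 iG H.
have Z s t : 0 <= s -> s < t -> t <= T -> \int[leb]_(x in `]s, t[) G x = 0.
  move=> s0 st tT; rewrite -(@weak_time_derivative (fun=> 0) G T s t)//.
  - by rewrite subrr.
  - by move=> x; exact: cvg_cst.
  - move=> th l r cth sth l0 rT; rewrite -[RHS](H th l r)//.
    by apply: eq_Rintegral => x _; rewrite mulr0 add0r.
pose Gh := G \_ `]0, T[%classic.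
have iGh : leb.-integrable setT (EFin \o Gh) by exact: restrict_L1.
pose F (x : R) := \int[leb]_(y in `]-oo, x]) Gh y.
have FE x : F x = \int[leb]_(y in `]0, (Num.min x T)[) G y.
  rewrite /F -Rintegral_itv_bndo_bndc; last first.
    by apply: integrableS iGh => //; exact: measurable_itv.
  rewrite !(Rintegral_mkcond _ [set` _]); apply: eq_Rintegral => y _; rewrite /Gh !patchE.
  rewrite !mem_setE !in_itv/= lt_min.
  by case: (0 < y); case: (y < x); case: (y < T).
have F0 x : F x = 0.
  rewrite FE; have [x0|x0] := leP (Num.min x T) 0.
    by rewrite set_itv_ge ?Rintegral_set0// bnd_simp -leNgt.
  by apply: Z => //; rewrite ge_min lexx orbT.
have lGh : locally_integrable setT Gh by exact: integrable_locally.
have iGhx y : leb.-integrable `]-oo, y] (EFin \o Gh).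
  by apply: integrableS iGh => //; exact: measurable_itv.
have FF : Filter (nbhs (almost_everywhere leb)) by exact: ae_filter_ringOfSetsType.
have := FTC1Ny iGhx lGh; apply: filterS => x [_ dF] xT.
have -> : G x = Gh x by rewrite /Gh patchE mem_set.
rewrite -dF.
rewrite [X in derive1 X](_ : _ = fun=> 0); first by rewrite derive1_cst.
by apply/funext => y; exact: F0.
Qed.

End weak_time_derivative.

(** * Testing against tensor products *)

Lemma ae_and d (X : measurableType d) (R : realType) (mu : {measure set X -> \bar R}) (P Q : X -> Prop) :
  {ae mu, forall x, P x} -> {ae mu, forall x, Q x} -> {ae mu, forall x, P x /\ Q x}.
Proof.
have FF : Filter (nbhs (almost_everywhere mu)) by exact: ae_filter_ringOfSetsType.
by move=> hP; apply: filter_app; apply: filterS hP => x Px Qx.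
Qed.

Lemma ae_imp d (X : measurableType d) (R : realType) (mu : {measure set X -> \bar R}) (P Q : X -> Prop) :
  {ae mu, forall x, P x} -> (forall x, P x -> Q x) -> {ae mu, forall x, Q x}.
Proof.
have FF : Filter (nbhs (almost_everywhere mu)) by exact: ae_filter_ringOfSetsType.
by move=> hP PQ; apply: filterS hP.
Qed.

Lemma Rint_sum5 d (X : measurableType d) (R : realType) (mu : {measure set X -> \bar R})
    (f0 f1 f2 f3 f4 : X -> R) : L1 mu f0 -> L1 mu f1 -> L1 mu f2 -> L1 mu f3 -> L1 mu f4 ->
  \int[mu]_x (f0 x - f1 x - f2 x - f3 x + f4 x) =
  \int[mu]_x f0 x - \int[mu]_x f1 x - \int[mu]_x f2 x - \int[mu]_x f3 x + \int[mu]_x f4 x.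
Proof.
move=> i0 i1 i2 i3 i4.
by rewrite (RintD (L1B (L1B (L1B i0 i1) i2) i3) i4) (RintB (L1B (L1B i0 i1) i2) i3)
  (RintB (L1B i0 i1) i2) (RintB i0 i1).
Qed.

Lemma Rint_sum5_eq d d' (X : measurableType d) (Y : measurableType d') (R : realType)
    (mu : {measure set X -> \bar R}) (nu : {measure set Y -> \bar R})
    (f0 f1 f2 f3 f4 : X -> R) (g0 g1 g2 g3 g4 : Y -> R) :
  L1 mu f0 -> L1 mu f1 -> L1 mu f2 -> L1 mu f3 -> L1 mu f4 ->
  L1 nu g0 -> L1 nu g1 -> L1 nu g2 -> L1 nu g3 -> L1 nu g4 ->
  \int[nu]_x g0 x = \int[mu]_x f0 x -> \int[nu]_x g1 x = \int[mu]_x f1 x ->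
  \int[nu]_x g2 x = \int[mu]_x f2 x -> \int[nu]_x g3 x = \int[mu]_x f3 x ->
  \int[nu]_x g4 x = \int[mu]_x f4 x ->
  \int[mu]_x (f0 x - f1 x - f2 x - f3 x + f4 x) = \int[nu]_x (g0 x - g1 x - g2 x - g3 x + g4 x).
Proof. by move=> *; rewrite !Rint_sum5//; congr (_ - _ - _ - _ + _). Qed.

Section ae_slices.
Context d1 d2 (X : measurableType d1) (Y : measurableType d2) (R : realType).
Variables (mu : {sigma_finite_measure set X -> \bar R}).
Variables (nu : {sigma_finite_measure set Y -> \bar R}).

(** Testing at a point of space leaves an exceptional set of times that depends on the point;
    Tonelli in the other order makes the union of these sets null in space-time. *)
Lemma ae_prod_eq2 (f g : X * Y -> R) : measurable_fun setT f -> measurable_fun setT g ->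
  (forall y, {ae mu, forall x, f (x, y) = g (x, y)}) ->
  {ae (mu \x nu)%E, forall z, f z = g z}.
Proof.
move=> mf mg fg; pose h z := f z - g z.
have mh : measurable_fun setT h by exact: measurable_funB.
suff : (\int[(mu \x nu)%E]_(z in setT) `|(h z)%:E| = 0)%E.
  move/(ae_eq_integral_abs _ measurableT (iffRL (measurable_EFinP _ _) mh)).
  apply: filterS => z /= /(_ I) -[] /eqP.
  by rewrite subr_eq0 => /eqP.
rewrite /= fubini_tonelli2; last 2 first.
- exact: measurable_enorm.
- by move=> z; rewrite lee_fin.
rewrite -[RHS](@integral0 _ _ _ nu setT).
apply: eq_integral => y _; rewrite /fubini_G /=.
rewrite -[RHS](@integral0 _ _ _ mu setT).
apply: ae_eq_integral => //.
- by apply: measurable_enorm; apply: (measurableT_comp mh); exact: measurable_fun_pair.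
- by apply: filterS (fg y) => x fgx _; rewrite /h /= fgx subrr normr0.
Qed.

Lemma ae_slice (P : X * Y -> Prop) : {ae (mu \x nu)%E, forall z, P z} ->
  {ae mu, forall x, {ae nu, forall y, P (x, y)}}.
Proof.
move=> [N [mN N0 PN]].
have mF : measurable_fun setT (fun x => nu (xsection N x)) by exact: measurable_fun_xsection.
have : (\int[mu]_x `|nu (xsection N x)| = 0)%E.
  rewrite -[RHS]N0 /product_measure1 /=.
  by apply: eq_integral => x _; rewrite gee0_abs.
move=> /(ae_eq_integral_abs _ measurableT mF); apply: filterS => x /= /(_ I) hx.
exists (xsection N x); split => //; first exact: measurable_xsection.
by move=> y /= Pxy; rewrite /xsection/= inE; exact: PN.
Qed.

End ae_slices.

Section testing_in_space_time.
Context {R : realType}.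
Local Notation mR := (measurableTypeR R).
Local Notation mR2 := (mR * mR)%type.
Local Notation mR3 := (mR * mR2)%type.
Local Notation leb := (@lebesgue_measure R).
Local Notation leb2 := (@leb2 R).
Local Notation leb3 := (@leb3 R).
Implicit Types (f g : R * (R * R) -> R) (K : R * R -> R) (x : R * R) (h th a b : R -> R).

Lemma ae_cv_eq K (f g : R * R -> R) x : kern K -> measurable_fun setT (f : mR2 -> mR) ->
  measurable_fun setT (g : mR2 -> mR) -> {ae leb2, forall y, f y = g y} -> cv K f x = cv K g x.
Proof.
move=> kK mf mg fg; have mk := L1_meas (kern_subr x kK).
apply: ae_Rint_eq; [exact: measurable_funM|exact: measurable_funM|].
by apply: (ae_imp fg) => y ->.
Qed.

Lemma is_derive_mul a b (t da db : R) : is_derive t (1 : R) a da -> is_derive t (1 : R) b db ->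
  is_derive t (1 : R) (fun r => a r * b r) (da * b t + a t * db).
Proof.
move=> ha hb; apply: (is_derive_eq (is_deriveM ha hb)).
by rewrite /GRing.scale/= addrC; congr (_ + _); rewrite mulrC.
Qed.

Definition kern1 h := [/\ measurable_fun setT (h : mR -> mR), L1 leb h &
  exists C, forall t, `|h t| <= C].

Lemma kern1_ck th : ck th -> kern1 th.
Proof. by move=> cth; split; [exact: ck_measurable|exact: ck_L1|exact: ck_bounded]. Qed.

Lemma kern1_indic (s t : R) : kern1 (\1_(`]s, t[%classic : set R)).
Proof.
split; first exact: measurable_indicR.
- apply: L1_lty; first exact: measurable_indicR.
  under eq_integral do rewrite ger0_norm//.
  have mE : measurable (`]s, t[%classic : set mR) by exact: measurable_itv.
  have Efin : (leb `]s, t[%classic < +oo)%E.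
    by rewrite lebesgue_measure_itv/=; case: ifP => _; rewrite ltry.
  by rewrite integral_indic// setIT; exact: Efin.
- by exists 1 => x; exact: indic_norm_le.
Qed.

(** The analogue of [locL] in space-time. The factor [h] localises in time, since a kernel in space
    alone is not square integrable over space-time. *)
Definition locT f := measurable_fun setT (f : mR3 -> mR) /\
  forall h K x, kern1 h -> kern K -> L1 leb3 (fun z => h z.1 * (f z * K (sub2 x z.2))).

Lemma measurable_fst1 h : measurable_fun setT (h : mR -> mR) ->
  measurable_fun setT ((fun z => h z.1) : mR3 -> mR).
Proof. by move=> mh; exact: measurableT_comp mh measurable_fst. Qed.

Lemma measurable_kern_slice K x : kern K ->
  measurable_fun setT ((fun z => K (sub2 x z.2)) : mR3 -> mR).
Proof.
move=> [/L1_meas mK _].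
exact: measurableT_comp (measurableT_comp mK (measurable_sub2r x)) measurable_snd.
Qed.

Lemma locT_L1 f : L1 leb3 f -> locT f.
Proof.
move=> fi; have mf := L1_meas fi; split => // h K x [mh _ [C hC]] kK.
have [C' hC'] := kern_bounded kK.
apply: (L1_bound (measurable_fst1 mh)) => [z|]; first exact: (hC z.1).
under eq_fun do rewrite mulrC.
by apply: (L1_bound (measurable_kern_slice x kK)) fi => z; exact: hC'.
Qed.

Lemma locT_L2 f : L2 leb3 f -> locT f.
Proof.
move=> fi; have mf := L2_meas fi; split => // h K x [mh ih [C hC]] kK.
have mK := measurable_kern_slice x kK; have [C' hC'] := kern_bounded kK.
have hK : L2 leb3 (fun z => h z.1 * K (sub2 x z.2)).
  split; first exact: measurable_funM (measurable_fst1 mh) mK.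
  have ih2 : L1 leb (fun t => h t ^+ 2).
    by under eq_fun do rewrite expr2; exact: (L1_bound mh hC ih).
  have iK2 : L1 leb2 (fun y => K (sub2 x y) ^+ 2) by case: (kern_subr_L2 x kK).
  apply: (@L1_prod _ _ _ _ _ leb leb2 _ (fun t => h t ^+ 2 * \int[leb2]_y (K (sub2 x y) ^+ 2))).
  - by apply: measurable_funX; exact: measurable_funM (measurable_fst1 mh) mK.
  - by under eq_fun do rewrite mulrC; exact: L1Z.
  - apply: aeW => t; have i1 : L1 leb2 (fun y => (h t * K (sub2 x y)) ^+ 2).
      by under eq_fun do rewrite exprMn; exact: L1Z.
    split => //.
    rewrite -RintZ//; apply: Rint_le; [exact: L1_norm|exact: L1Z|].
    by move=> y; rewrite ger0_norm ?sqr_ge0// exprMn.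
by have := L2_mul fi hK; congr L1; apply/funext => z; ring.
Qed.

Lemma cvt_Rint h K f x : kern1 h -> kern K -> locT f ->
  L1 leb (fun t => h t * cvt K f (t, x)) /\
  \int[leb3]_z (h z.1 * (f z * K (sub2 x z.2))) = \int[leb]_t (h t * cvt K f (t, x)).
Proof.
move=> kh kK [mf lf]; have i := lf h K x kh kK.
have [mh _ _] := kh.
have m1 : measurable_fun setT ((fun t => h t * cvt K f (t, x)) : mR -> mR).
  apply: measurable_funM => //.
  by apply: (measurableT_comp (cvt_measurable kK mf)); exact: measurable_fun_pair.
have e : {ae leb, forall t, h t * cvt K f (t, x) = \int[leb2]_y (h t * (f (t, y) * K (sub2 x y)))}.
  have := L1_slice i; apply: filterS => t it; rewrite /cvt/cv/=.
  (* Where [h] vanishes nothing is known about the slice of [f], but both sides are zero; elsewhere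
     one divides by [h t] to recover its integrability. *)
  have [h0|hn0] := eqVneq (h t) 0.
    by rewrite h0 mul0r /Rintegral integral0_eq// => y _; rewrite mul0r.
  rewrite RintZ//.
  have := L1Z (h t)^-1 it; congr L1; apply/funext => y /=.
  by rewrite mulrA mulVf// mul1r.
have i2 := L1_int i.
split; first exact: ae_L1 i2.
rewrite fubini_Rint//; apply/esym; apply: ae_Rint_eq => //.
exact: L1_meas i2.
Qed.

Lemma integrable_itv_indic (g : R -> R) (s t : R) :
  L1 leb (fun r => \1_(`]s, t[%classic : set R) r * g r) -> leb.-integrable `]s, t[ (EFin \o g).
Proof.
move=> ig; rewrite (@integrable_mkcond _ _ _ leb _ _ (measurable_itv _)).
move: ig; rewrite /L1; congr (_.-integrable _ _); apply/funext => r.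
by rewrite restrict_EFin /= patchE indicE; case: ifP => _; rewrite ?mul1r ?mul0r.
Qed.

Lemma cvt_integrable K f x (T : R) : kern K -> locT f ->
  leb.-integrable `]0, T[ (EFin \o (fun t => cvt K f (t, x))).
Proof.
by move=> kK lf; apply: integrable_itv_indic; have [] := cvt_Rint x (kern1_indic 0 T) kK lf.
Qed.

Lemma csupp_indic th (l r T c t : R) : csupp th l r -> 0 < l -> r < T ->
  \1_(`]0, T[%classic : set R) t * (th t * c) = th t * c.
Proof.
move=> sth l0 rT; have [->|/sth] := eqVneq (th t) 0; first by rewrite !(mul0r, mulr0).
rewrite in_itv/= => /andP[lt tr]; rewrite indicE mem_set/= ?mul1r//.
by rewrite in_itv/= (lt_le_trans l0)// (le_lt_trans tr).
Qed.

Lemma ae_L1_slice f K x (T : R) : kern K -> locT f ->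
  {ae leb, forall t, t \in `]0, T[ -> L1 leb2 (fun y => f (t, y) * K (sub2 x y))}.
Proof.
move=> kK [mf lf]; have := L1_slice (lf _ K x (kern1_indic 0 T) kK).
apply: filterS => t + tT; rewrite /= indicE mem_set//.
by under eq_fun do rewrite mul1r.
Qed.

Lemma csm_csupp_ck th l r : csm th -> csupp th l r -> ck th.
Proof. by move=> cth sth; split => //; exists l, r. Qed.

Lemma cvt_out (T : R) K f z : (forall z, z.1 \notin `]0, T[ -> f z = 0) -> z.1 \notin `]0, T[ -> cvt K f z = 0.
Proof.
move=> fz zT; rewrite /cvt /cv /Rintegral integral0_eq// => y _.
by rewrite fz// mul0r.
Qed.

(* Testing with [ktest th a b x] evaluates at [x] the convolution with [tens2 a b]. *)
Definition ktest th a b x := tens3 th (fun y => a (x.1 - y)) (fun y => b (x.2 - y)).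

Lemma ktestE th a b x z : ktest th a b x z = th z.1 * tens2 a b (sub2 x z.2).
Proof. by []. Qed.

Lemma is_derive_reflect a (c t : R) : csm a -> is_derive t (1 : R) (fun y : R => a (c - y)) (- derive1 a (c - t)).
Proof.
move=> ca; have h : is_derive (-1 * t + c) (1 : R) a (derive1 a (-1 * t + c)) by exact: csm_derive.
have := is_derive_affine h; rewrite !mulN1r addrC.
by under eq_fun do rewrite mulN1r addrC.
Qed.

Lemma ktest_test (T l r : R) th a b x : csm th -> csupp th l r -> 0 < l -> r < T -> ck a -> ck b ->
  test_slab T (ktest th a b x).
Proof.
move=> cth sth l0 rT [ca [la [ra sa]]] [cb [lb [rb sb]]].
have ca' := csm_reflect x.1 ca; have cb' := csm_reflect x.2 cb.
exact: (test_tens3 cth ca' cb' sth (csupp_reflect (c := x.1) sa) (csupp_reflect (c := x.2) sb) l0 rT).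
Qed.

(** The profiles are reflected in space but not in time, hence a sign on the space derivatives
    only. *)
Lemma ktest_derive th a b x (z v : R * (R * R)) : csm th -> csm a -> csm b ->
  is_derive z v (ktest th a b x) (v.1 * ktest (derive1 th) a b x z +
    (v.2.1 * - ktest th (derive1 a) b x z + v.2.2 * - ktest th a (derive1 b) x z)).
Proof.
move=> cth ca cb.
have h := is_derive_tens3 v (csm_derive cth z.1) (is_derive_reflect x.1 z.2.1 ca)
  (is_derive_reflect x.2 z.2.2 cb).
apply: (is_derive_eq h); rewrite /ktest /tens3 /tens2/=; ring.
Qed.

Lemma ktest_dt th a b x : csm th -> csm a -> csm b -> 'D_et (ktest th a b x) = ktest (derive1 th) a b x.
Proof.
move=> cth ca cb; apply/funext => z; have [_ ->] := ktest_derive x z et cth ca cb.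
by rewrite /et /=; ring.
Qed.

Lemma ktest_d0 th a b x : csm th -> csm a -> csm b ->
  'D_(ex 0) (ktest th a b x) = (fun z => - ktest th (derive1 a) b x z).
Proof.
move=> cth ca cb; apply/funext => z; have [_ ->] := ktest_derive x z (ex 0) cth ca cb.
by rewrite /ex /ex2 /=; ring.
Qed.

Lemma ktest_d1 th a b x : csm th -> csm a -> csm b ->
  'D_(ex 1) (ktest th a b x) = (fun z => - ktest th a (derive1 b) x z).
Proof.
move=> cth ca cb; apply/funext => z; have [_ ->] := ktest_derive x z (ex 1) cth ca cb.
by rewrite /ex /ex2 /=; ring.
Qed.

Lemma ktest_d00 th a b x : csm th -> csm a -> csm b ->
  'D_(ex 0) ('D_(ex 0) (ktest th a b x)) = ktest th (derive1 (derive1 a)) b x.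
Proof.
move=> cth ca cb; rewrite (ktest_d0 x cth ca cb); apply/funext => z.
have h := ktest_derive x z (ex 0) cth (csm_derive1 ca) cb.
have [_ ->] := is_deriveN h.
by rewrite /ex /ex2 /=; ring.
Qed.

End testing_in_space_time.

Lemma fubini_Rint2 d1 d2 (X : measurableType d1) (Y : measurableType d2) (R : realType)
    (mu : {sigma_finite_measure set X -> \bar R}) (nu : {sigma_finite_measure set Y -> \bar R})
    (f : X * Y -> R) : L1 (mu \x nu)%E f ->
  L1 nu (fun y => \int[mu]_x f (x, y)) /\
  \int[nu]_y \int[mu]_x f (x, y) = \int[(mu \x nu)%E]_z f z.
Proof.
move=> fi; have m := mpres_swap nu mu.
have i := mpres_L1 m fi; split; first exact: L1_int i.
by rewrite (mpres_Rint m fi) (fubini_Rint i).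
Qed.

(** * Integration by parts for nonlinear functions of mollified quantities *)

Section nonlinear_integration_by_parts.
Context {R : realType}.
Local Notation mR := (measurableTypeR R).
Local Notation mR2 := (mR * mR)%type.
Local Notation mR3 := (mR * mR2)%type.
Local Notation leb := (@lebesgue_measure R).
Local Notation leb2 := (@leb2 R).
Local Notation leb3 := (@leb3 R).
Implicit Types (f g : R * R -> R) (a b : R -> R).

Lemma L2_lip d (X : measurableType d) (mu : {measure set X -> \bar R}) (F : R -> R) (C : R) (w : X -> R) :
  continuous F -> (forall x, `|F x| <= C * `|x|) -> L2 mu w -> L2 mu (fun x => F (w x)).
Proof.
move=> cF FC wL; apply: (@L2_le _ _ _ _ _ (fun x => C * `|w x|)).
- exact: measurableT_comp (continuous_measurableR cF) (L2_meas wL).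
- by move=> x; apply: (le_trans (FC _)); exact: ler_norm.
- by apply: L2Z; exact: L2_norm.
Qed.

Lemma L1_comp_mul d (X : measurableType d) (mu : {measure set X -> \bar R}) (F : R -> R) (C : R) (w g : X -> R) :
  continuous F -> (forall x, `|F x| <= C) -> measurable_fun setT w -> L1 mu g ->
  L1 mu (fun x => F (w x) * g x).
Proof.
move=> cF FC mw gi; apply: (L1_bound (h := fun x => F (w x)) (C := C)) => //.
exact: measurableT_comp (continuous_measurableR cF) mw.
Qed.

(** Mean value theorem. For [F = beta] it makes [beta(w)] integrable, and continuous from [L2] to
    [L1], although [w] need not be integrable. *)
Lemma quadratic_growth (F F' : R -> R) C (x y : R) : (forall x : R, is_derive x (1 : R) F (F' x)) ->
  (forall x, `|F' x| <= C * `|x|) -> `|F x - F y| <= C * ((`|x| + `|y|) * `|x - y|).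
Proof.
move=> FF' F'C.
have C0 : 0 <= C by have := F'C 1; rewrite normr1 mulr1; exact: le_trans.
wlog xy : x y / y <= x.
  move=> hw; have [/hw//|/ltW/hw] := leP y x.
  by rewrite distrC [`|y| + _]addrC [X in _ * (_ * X)]distrC.
have [->|yx] := eqVneq x y; first by rewrite !subrr !normr0 !mulr0.
have {}yx : y < x by rewrite lt_neqAle eq_sym yx.
have [|c + ->] := @MVT R F F' y x yx (fun z _ => FF' z).
  by apply: continuous_subspaceT => z; exact: is_derive_continuous (FF' z).
rewrite in_itv/= => /andP[yc cx]; rewrite normrM mulrA ler_wpM2r//.
apply: (le_trans (F'C c)); rewrite ler_wpM2l//.
have := ler_norm x; have := ler_norm (- y); rewrite normrN => hy hx.
by rewrite ler_norml; apply/andP; split; have := normr_ge0 x; have := normr_ge0 y; lra.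
Qed.

Section chain.
Variables (F F' : R -> R) (C C' : R).
Hypothesis FF' : forall x : R, is_derive x (1 : R) F (F' x).
Hypotheses (cF' : continuous F') (FC : forall x, `|F x| <= C * `|x|) (FC' : forall x, `|F' x| <= C').

Let cF : continuous F. Proof. by move=> x; exact: is_derive_continuous (FF' x). Qed.

Lemma L1_chain_terms d (X : measurableType d) (mu : {measure set X -> \bar R}) (w w' q q' : X -> R) :
  L2 mu w -> L2 mu w' -> L2 mu q -> L2 mu q' ->
  L1 mu (fun y => F' (w y) * (w' y * q y) + F (w y) * q' y).
Proof.
move=> wL w'L qL q'L; apply: L1D.
- by apply: (L1_comp_mul cF' FC' (L2_meas wL)); exact: L2_mul.
- by apply: L2_mul => //; exact: L2_lip cF FC wL.
Qed.

(** The integrand is the [x1] derivative of [F(w)] times the mollified [g]. It serves with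
    [F = beta'] for pressure and viscosity, and with [F = beta] for transport. *)
Lemma integral_chain1 a b a2 b2 f g : ck a -> ck b -> ck a2 -> ck b2 -> L2 leb2 f -> L2 leb2 g ->
  let w := cv (tens2 a b) f in
  \int[leb2]_y (F' (w y) * (cv (tens2 (derive1 a) b) f y * cv (tens2 a2 b2) g y) +
    F (w y) * cv (tens2 (derive1 a2) b2) g y) = 0.
Proof.
move=> ka kb ka2 kb2 fL gL w; have kda := ck_derive ka; have kda2 := ck_derive ka2.
have [wL _] := cv_L2 (kern_ck ka kb) fL; have [w1L _] := cv_L2 (kern_ck kda kb) fL.
have [qL _] := cv_L2 (kern_ck ka2 kb2) gL; have [q1L _] := cv_L2 (kern_ck kda2 kb2) gL.
have lf := locL_L2 fL; have lg := locL_L2 gL.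
apply: (@integral_partial1 R (fun y => F (w y) * cv (tens2 a2 b2) g y)).
- move=> x1 x2.
  have dw := is_derive_cv1 x1 x2 ka kb lf; have dq := is_derive_cv1 x1 x2 ka2 kb2 lg.
  apply: (is_derive_eq (is_derive_mul (is_derive1_comp (FF' _) dw) dq)).
  by rewrite /= -mulrA.
- move=> x2 t.
  have cw : {for t, continuous (fun r : R => w (r, x2))} by exact: continuous_cv1.
  have cc (G : R -> R) : continuous G -> {for t, continuous (fun r : R => G (w (r, x2)))}.
    by move=> cG; exact: (continuous_comp (f := fun r : R => w (r, x2)) cw (cG _)).
  apply: cvgD; apply: cvgM.
  + exact: cc cF'.
  + by apply: cvgM; exact: continuous_cv1.
  + exact: cc cF.
  + exact: continuous_cv1.
- by apply: L2_mul qL; exact: L2_lip cF FC wL.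
- exact: (L1_chain_terms wL w1L qL q1L).
Qed.

Lemma integral_chain2 a b a2 b2 f g : ck a -> ck b -> ck a2 -> ck b2 -> L2 leb2 f -> L2 leb2 g ->
  let w := cv (tens2 a b) f in
  \int[leb2]_y (F' (w y) * (cv (tens2 a (derive1 b)) f y * cv (tens2 a2 b2) g y) +
    F (w y) * cv (tens2 a2 (derive1 b2)) g y) = 0.
Proof.
move=> ka kb ka2 kb2 fL gL w; have kdb := ck_derive kb; have kdb2 := ck_derive kb2.
have [wL _] := cv_L2 (kern_ck ka kb) fL; have [w1L _] := cv_L2 (kern_ck ka kdb) fL.
have [qL _] := cv_L2 (kern_ck ka2 kb2) gL; have [q1L _] := cv_L2 (kern_ck ka2 kdb2) gL.
have lf := locL_L2 fL; have lg := locL_L2 gL.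
apply: (@integral_partial2 R (fun y => F (w y) * cv (tens2 a2 b2) g y)).
- move=> x1 x2.
  have dw := is_derive_cv2 x1 x2 ka kb lf; have dq := is_derive_cv2 x1 x2 ka2 kb2 lg.
  apply: (is_derive_eq (is_derive_mul (is_derive1_comp (FF' _) dw) dq)).
  by rewrite /= -mulrA.
- move=> x1 t.
  have cw : {for t, continuous (fun r : R => w (x1, r))} by exact: continuous_cv2.
  have cc (G : R -> R) : continuous G -> {for t, continuous (fun r : R => G (w (x1, r)))}.
    by move=> cG; exact: (continuous_comp (f := fun r : R => w (x1, r)) cw (cG _)).
  apply: cvgD; apply: cvgM.
  + exact: cc cF'.
  + by apply: cvgM; exact: continuous_cv2.
  + exact: cc cF.
  + exact: continuous_cv2.
- by apply: L2_mul qL; exact: L2_lip cF FC wL.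
- exact: (L1_chain_terms wL w1L qL q1L).
Qed.

End chain.

Lemma slice_integral_eq0 (h : R -> R) (H : R * (R * R) -> R) : L1 leb3 (fun z => h z.1 * H z) ->
  {ae leb, forall t, L1 leb2 (fun x => H (t, x))} ->
  {ae leb, forall t, \int[leb2]_x H (t, x) = 0} -> \int[leb3]_z (h z.1 * H z) = 0.
Proof.
move=> iH HL H0; rewrite fubini_Rint//.
rewrite (@ae_Rint_eq _ _ _ leb _ (fun=> 0)); first by rewrite /Rintegral integral0_eq.
- exact: L1_meas (L1_int iH).
- exact: measurable_cst.
by apply: (ae_imp (ae_and HL H0)) => t [iHt H0t] /=; rewrite RintZ// H0t mulr0.
Qed.

Definition kshift (d h : R) := tens2 (moll d) (fun y => moll d (y - h)).

Lemma ck_shift (a : R -> R) (c : R) : ck a -> ck (fun y => a (y - c)).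
Proof.
move=> [ca [l [r sa]]]; split; first exact: csm_shift.
by exists (l + c), (r + c); exact: csupp_shift.
Qed.

Lemma cvt_kshift d h (f : R * (R * R) -> R) t x :
  cvt (kshift d h) f (t, x) = cvt (tens2 (moll d) (moll d)) f (t, (x.1, x.2 - h)).
Proof.
rewrite /cvt /cv /=; apply: eq_Rintegral => y _; congr (_ * _).
by rewrite /kshift /tens2 /sub2 /=; congr (_ * moll d _); ring.
Qed.

Lemma cvt_dkap d h (f : R * (R * R) -> R) : 0 < d ->
  {ae leb, forall t, locL (fun x => f (t, x))} ->
  {ae leb3, forall z, cvt (tens2 (moll d) (derive1 (kap d h))) f z =
    h^-1 * (cvt (tens2 (moll d) (moll d)) f z - cvt (kshift d h) f z)}.
Proof.
move=> d0 lf; apply: (ae_imp (ae_prod1 leb2 lf)) => -[t x] [mf /= lt].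
have km : kern (tens2 (moll d) (moll d)) by apply: kern_ck; exact: ck_moll.
have ks : kern (kshift d h).
  by apply: kern_ck; [exact: ck_moll|apply: ck_shift; exact: ck_moll].
have i1 := lt _ km x; have i2 := lt _ ks x.
rewrite /cvt /cv /= -(RintB i1 i2) -(RintZ _ (L1B i1 i2)).
apply: eq_Rintegral => y _; rewrite derive1_kap /kshift /tens2 /dkap /=.
by move: (moll d _) (moll d _) (moll d _) => *; ring.
Qed.

End nonlinear_integration_by_parts.

(** * Convergence of nonlinear expressions *)

Section convergence_almost_everywhere.
Context d (X : measurableType d) (R : realType) (mu : {measure set X -> \bar R}).
Implicit Types f g h w : X -> R.

(** Distances below [2 ^ -(n + 1)] make the sum of the squared errors integrable, hence finite
    almost everywhere. The map [phi] need not be increasing: [n <= phi n] already preserves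
    limits. *)
Lemma cvg2_ae_subseq (F : (X -> R)^nat) f : cvg2 mu F f ->
  exists phi : nat -> nat, (forall n, (n <= phi n)%N) /\
    {ae mu, forall x, F (phi n) x @[n --> \oo] --> f x}.
Proof.
move=> [FL fL F0].
have /choice[phi hphi] : forall n : nat, exists m : nat, (n <= m)%N /\
    nrm2 mu (fun x => F m x - f x) <= 1 / (2 ^ n.+1)%:R.
  move=> n; have e0 : 0 < 1 / (2 ^ n.+1)%:R :> R by rewrite divr_gt0// ltr0n expn_gt0.
  have /cvgr0Pnorm_le/(_ _ e0)[N _ hN] := F0.
  exists (maxn n N); split; first exact: leq_maxl.
  by apply: (le_trans (ler_norm _)); apply: hN; exact: leq_maxr.
exists phi; split=> [n|]; first by have [] := hphi n.
pose g n x := (F (phi n) x - f x) ^+ 2.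
have gi n : L1 mu (g n) by have [] := L2B (FL (phi n)) fL.
have mg n : measurable_fun setT (EFin \o g n) by apply/measurable_EFinP; exact: L1_meas (gi n).
have g0 n x : (0 <= (g n x)%:E)%E by rewrite lee_fin sqr_ge0.
pose S x := (\sum_(n <oo) (g n x)%:E)%E.
have mS : measurable_fun setT S.
  by apply: ge0_emeasurable_sum => [n x _ _|n _]; [exact: g0|exact: mg].
have S0 x : (0 <= S x)%E by exact: nneseries_ge0.
have iS : mu.-integrable setT S.
  apply/integrableP; split => //.
  under eq_integral do rewrite gee0_abs//.
  rewrite /S integral_nneseries//.
  apply: (@le_lt_trans _ _ 1%E); last exact: ltry.
  apply: le_trans (epsilon_trick0 xpredT (ler01 : 0 <= 1 :> R)).
  apply: lee_nneseries => [n _ _|n _]; first exact: integral_ge0.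
  by rewrite RintE// lee_fin; have [_] := hphi n.
have := integrable_ae measurableT iS.
move=> /ae_imp; apply => x /(_ I) Sx.
have gx0 : g n x @[n --> \oo] --> 0.
  apply: cvg_series_cvg_0; apply: nnseries_is_cvg => [n|]; first exact: sqr_ge0.
  by rewrite -ge0_fin_numE//; exact: S0.
have := cvg_sqrt0 (fun n => sqr_ge0 (F (phi n) x - f x)) gx0.
move=> h; apply/cvgrPdist_le => e e0; have /cvgr0Pnorm_le/(_ _ e0) := h.
by apply: filterS => n; rewrite sqrtr_sqr normr_id distrC.
Qed.

Lemma cvg1_bound_mul h (F : (X -> R)^nat) f C : measurable_fun setT h -> (forall x, `|h x| <= C) ->
  cvg1 mu F f -> cvg1 mu (fun n x => h x * F n x) (fun x => h x * f x).
Proof.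
move=> mh hC [Fi fi F0].
have c0 : C * nrm1 mu (fun x => F n x - f x) @[n --> \oo] --> 0.
  by rewrite -[0 in X in _ --> X](mulr0 C); exact: cvgMr.
apply: (cvg1_squeeze _ _ _ c0); [by move=> n; exact: L1_bound (Fi n)|exact: L1_bound fi|].
move=> n; have i1 := L1B (Fi n) fi.
rewrite /nrm1 -(RintZ C (L1_norm i1)); apply: Rint_le.
- apply: L1_norm; have := L1_bound mh hC i1.
  by congr L1; apply/funext => x; rewrite mulrBr.
- by apply: L1Z; exact: L1_norm.
by move=> x; rewrite -mulrBr normrM ler_wpM2r.
Qed.

(** As [F (W n)] converges only pointwise, it is first paired with the fixed [g], where dominated
    convergence applies; the error [G n - g] needs only the bound on [F]. *)
Lemma cvg1_comp_mul (F : R -> R) (C : R) (W G : (X -> R)^nat) w g : continuous F ->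
  (forall x, `|F x| <= C) -> (forall n, measurable_fun setT (W n)) -> measurable_fun setT w ->
  {ae mu, forall x, W n x @[n --> \oo] --> w x} -> cvg1 mu G g ->
  cvg1 mu (fun n x => F (W n x) * G n x) (fun x => F (w x) * g x).
Proof.
move=> cF FC mW mw Ww Gg; have [Gi gi G0] := Gg.
have c1 : cvg1 mu (fun n x => F (W n x) * g x) (fun x => F (w x) * g x).
  apply: (@L1_dct _ _ _ mu _ _ (fun x => C * `|g x|)).
  - move=> n; apply: measurable_funM; last exact: L1_meas gi.
    exact: measurableT_comp (continuous_measurableR cF) (mW n).
  - apply: measurable_funM; last exact: L1_meas gi.
    exact: measurableT_comp (continuous_measurableR cF) mw.
  - by apply: L1Z; exact: L1_norm.
  - by apply: aeW => x n; rewrite normrM ler_wpM2r.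
  - apply: (ae_imp Ww) => x hx; apply: cvgMl.
    have cx : {for w x, continuous F} by exact: cF.
    by apply: continuous_cvg.
have c2 : cvg1 mu (fun n x => F (W n x) * (G n x - g x)) (fun=> 0).
  have c0 : C * nrm1 mu (fun x => G n x - g x) @[n --> \oo] --> 0.
    by rewrite -[0 in X in _ --> X](mulr0 C); exact: cvgMr.
  have i n : L1 mu (fun x => F (W n x) * (G n x - g x)).
    by apply: (L1_comp_mul cF FC (mW n)); exact: L1B.
  have i0 : L1 mu (fun=> 0).
    by have := L1B gi gi; congr L1; apply/funext => x; rewrite subrr.
  apply: (cvg1_squeeze i i0 _ c0) => n.
  rewrite /nrm1 -(RintZ C (L1_norm (L1B (Gi n) gi))); apply: Rint_le.
  - apply: L1_norm; have := i n.
    by congr L1; apply/funext => x; rewrite subr0.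
  - by apply: L1Z; apply: L1_norm; exact: L1B.
  by move=> x; rewrite subr0 normrM ler_wpM2r.
have := cvg1D c1 c2.
rewrite (_ : (fun n x => _) = (fun n x => F (W n x) * G n x)); last first.
  by apply/funext => n; apply/funext => x; ring.
by rewrite (_ : (fun x => F (w x) * g x + 0) = (fun x => F (w x) * g x))//; apply/funext => x; rewrite addr0.
Qed.

Lemma cvg2_norm (F : (X -> R)^nat) f : cvg2 mu F f ->
  cvg2 mu (fun n x => `|F n x|) (fun x => `|f x|).
Proof.
move=> [FL fL F0]; apply: (cvg2_squeeze _ _ _ F0).
- by move=> n; exact: L2_norm.
- exact: L2_norm.
move=> n; have [_ i1] := L2B (L2_norm (FL n)) (L2_norm fL); have [_ i2] := L2B (FL n) fL.
apply: Rint_le => // x; rewrite -[leLHS]real_normK ?num_real// -[leRHS]real_normK ?num_real//.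
by rewrite ler_pXn2r ?nnegrE//; exact: ler_dist_dist.
Qed.

Lemma L1_quadratic (F F' : R -> R) C w : (forall x : R, is_derive x (1 : R) F (F' x)) ->
  (forall x, `|F' x| <= C * `|x|) -> F 0 = 0 -> L2 mu w -> L1 mu (fun x => F (w x)).
Proof.
move=> FF' F'C F0 wL.
have cF : continuous F by move=> x; exact: is_derive_continuous (FF' x).
apply: (@L1_le _ _ _ _ _ (fun x => C * (w x * w x))).
- exact: measurableT_comp (continuous_measurableR cF) (L2_meas wL).
- move=> x; have := quadratic_growth (w x) 0 FF' F'C.
  rewrite F0 !subr0 normr0 addr0 -normrM => /le_trans; apply.
  by rewrite [leRHS]normrM ler_wpM2r// ler_norm.
- by apply: L1Z; exact: L2_mul.
Qed.

Lemma cvg1_quadratic (F F' : R -> R) C (G : (X -> R)^nat) g : (forall x : R, is_derive x (1 : R) F (F' x)) ->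
  (forall x, `|F' x| <= C * `|x|) -> F 0 = 0 -> cvg2 mu G g ->
  cvg1 mu (fun n x => F (G n x)) (fun x => F (g x)).
Proof.
move=> FF' F'C F0 Gg; have [GL gL G0] := Gg.
have C0 : 0 <= C by have := F'C 1; rewrite normr1 mulr1; exact: le_trans.
have FL1 w : L2 mu w -> L1 mu (fun x => F (w x)) by exact: L1_quadratic FF' F'C F0.
have d0 : cvg2 mu (fun n x => G n x - g x) (fun=> 0).
  split.
  - by move=> n; exact: L2B.
  - by have := L2B gL gL; congr L2; apply/funext => x; rewrite subrr.
  - rewrite (_ : (fun n => _) = (fun n => nrm2 mu (fun x => G n x - g x)))//.
    by apply/funext => n; congr nrm2; apply/funext => x; rewrite subr0.
have S : cvg1 mu (fun n x => `|G n x| * `|G n x - g x|) (fun x => `|g x| * `|0 : R|).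
  exact: cvg1_mul (cvg2_norm Gg) (cvg2_norm d0).
have S' : cvg1 mu (fun n x => `|g x| * `|G n x - g x|) (fun x => `|g x| * `|0 : R|).
  exact: cvg1_mul (cvg2_cst (L2_norm gL)) (cvg2_norm d0).
have [Si S0 Sl] := cvg1Z C (cvg1D S S').
apply: (cvg1_squeeze _ _ _ Sl); [by move=> n; exact: FL1|exact: FL1|].
move=> n; apply: Rint_le.
- by apply: L1_norm; apply: L1B; exact: FL1.
- by apply: L1_norm; exact: L1B.
move=> x; apply: (le_trans (quadratic_growth (G n x) (g x) FF' F'C)).
have -> : `|g x| * `|0 : R| = 0 by rewrite normr0 mulr0.
by rewrite addr0 mulr0 subr0 -mulrDl; exact: ler_norm.
Qed.

End convergence_almost_everywhere.

(** * The mollified equations *)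

Section mollified_equations.
Context {R : realType}.
Local Notation mR := (measurableTypeR R).
Local Notation mR2 := (mR * mR)%type.
Local Notation mR3 := (mR * mR2)%type.
Local Notation leb := (@lebesgue_measure R).
Local Notation leb2 := (@leb2 R).
Local Notation leb3 := (@leb3 R).
Implicit Types (f g : R * (R * R) -> R) (K : R * R -> R) (x : R * R) (h th a b : R -> R).

(* Here [u0], [u1] are the components of the velocity, [v0] stands for [d1 u0], and
   [U] is the weakly continuous representative of [u0]; the space-time functions
   vanish outside the slab. *)
Variables (T : R) (u0 u1 v0 p : R * (R * R) -> R) (U : R -> R * R -> R).
Hypotheses (T0 : 0 < T) (u0L : L2 leb3 u0) (u1L : L2 leb3 u1) (v0L : L2 leb3 v0) (pL : L2 leb3 p).
Hypotheses (u0z : forall z, z.1 \notin `]0, T[ -> u0 z = 0)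
  (u1z : forall z, z.1 \notin `]0, T[ -> u1 z = 0)
  (v0z : forall z, z.1 \notin `]0, T[ -> v0 z = 0).
Hypothesis weak_dx : forall th l r a b x, csm th -> csupp th l r -> 0 < l -> r < T -> ck a -> ck b ->
  \int[leb3]_z (u0 z * 'D_(ex 0) (ktest th a b x) z) = - \int[leb3]_z (v0 z * ktest th a b x z).
Hypothesis weak_div : forall psi : R * R -> R, test_fun psi ->
  {ae leb, forall t : R, t \in `]0, T[ ->
    \int[leb2]_x (u0 (t, x) * 'D_(ex2 0) psi x + u1 (t, x) * 'D_(ex2 1) psi x) = 0}.
Hypothesis weak_eq : forall th l r a b x, csm th -> csupp th l r -> 0 < l -> r < T -> ck a -> ck b ->
  let phi := ktest th a b x in
  \int[leb3]_z (u0 z * 'D_et phi z + (u0 z * u0 z * 'D_(ex 0) phi z + u0 z * u1 z * 'D_(ex 1) phi z)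
    + p z * 'D_(ex 0) phi z + u0 z * 'D_(ex 0) ('D_(ex 0) phi) z) = 0.
Hypothesis UL : forall t, t \in `[0, T] -> L2 leb2 (U t).
Hypothesis Uc : forall w : R * R -> R, L2 leb2 w ->
  {within `[0, T], continuous (fun t => \int[leb2]_x (U t x * w x))}.
Hypothesis Uu : {ae leb, forall t : R, t \in `]0, T[ -> {ae leb2, forall x, U t x = u0 (t, x)}}.

(** At a fixed point of space both sides are functions of time with equal integrals against all test
    functions of time; outside []0, T[] both vanish by the extension by zero. *)
Lemma mollified_dx a b : ck a -> ck b ->
  {ae leb3, forall z, cvt (tens2 (derive1 a) b) u0 z = cvt (tens2 a b) v0 z}.
Proof.
move=> ka kb; have kda := ck_derive ka; have [ca _] := ka; have [cb _] := kb.
have kab := kern_ck ka kb; have kdab := kern_ck kda kb.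
have lu := locT_L2 u0L; have lv := locT_L2 v0L.
have m1 := cvt_measurable kdab (L2_meas u0L); have m2 := cvt_measurable kab (L2_meas v0L).
apply: (@ae_prod_eq2 _ _ _ _ _ leb leb2) => // x.
pose G t := cvt (tens2 (derive1 a) b) u0 (t, x) - cvt (tens2 a b) v0 (t, x).
have G0 : {ae leb, forall t, t \in `]0, T[ -> G t = 0}.
  apply: ae_eq0_itv => //.
    have mE : measurable (`]0, T[%classic : set mR) by exact: measurable_itv.
    have := integrableB mE (cvt_integrable x T kdab lu) (cvt_integrable x T kab lv).
    by apply: eq_integrable => // t _.
  move=> th l r cth sth l0 rT; have kth := kern1_ck (csm_csupp_ck cth sth).
  have [i1 e1] := cvt_Rint x kth kdab lu; have [i2 e2] := cvt_Rint x kth kab lv.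
  have := weak_dx x cth sth l0 rT ka kb.
  have d0 z : 'D_(ex 0) (ktest th a b x) z = - ktest th (derive1 a) b x z.
    exact: (congr1 (fun F => F z) (ktest_d0 x cth ca cb)).
  have -> : \int[leb3]_z (u0 z * 'D_(ex 0) (ktest th a b x) z) =
      - \int[leb3]_z (th z.1 * (u0 z * tens2 (derive1 a) b (sub2 x z.2))).
    rewrite -(RintN (lu.2 _ _ x kth kdab)); apply: eq_Rintegral => z _.
    by rewrite d0 ktestE; ring.
  have -> : \int[leb3]_z (v0 z * ktest th a b x z) =
      \int[leb3]_z (th z.1 * (v0 z * tens2 a b (sub2 x z.2))).
    by apply: eq_Rintegral => z _; rewrite ktestE; ring.
  rewrite e1 e2 => e.
  rewrite Rint_indic.
  have -> : \int[leb]_t (\1_(`]0, T[%classic : set R) t * (th t * G t)) =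
      \int[leb]_t (th t * cvt (tens2 (derive1 a) b) u0 (t, x) - th t * cvt (tens2 a b) v0 (t, x)).
    by apply: eq_Rintegral => t _; rewrite (csupp_indic _ _ sth l0 rT) /G mulrBr.
  apply: (etrans (RintB i1 i2)); apply/eqP; rewrite subr_eq0; apply/eqP; exact: oppr_inj e.
apply: (ae_imp G0) => t Gt.
have [tT|tT] := boolP (t \in `]0, T[); last by rewrite !(cvt_out (z := (t, x)) _ _ tT).
by apply/eqP; rewrite -subr_eq0; apply/eqP; exact: Gt.
Qed.

Lemma mollified_div a b : ck a -> ck b ->
  {ae leb3, forall z, cvt (tens2 (derive1 a) b) u0 z + cvt (tens2 a (derive1 b)) u1 z = 0}.
Proof.
move=> ka kb; have kda := ck_derive ka; have kdb := ck_derive kb.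
have [ca [la [ra sa]]] := ka; have [cb [lb [rb sb]]] := kb.
have kab := kern_ck ka kdb; have kdab := kern_ck kda kb.
have lu := locT_L2 u0L; have lv := locT_L2 u1L.
have m1 := cvt_measurable kdab (L2_meas u0L); have m2 := cvt_measurable kab (L2_meas u1L).
apply: (@ae_prod_eq2 _ _ _ _ _ leb leb2 _ (fun=> 0)) => //; first exact: measurable_funD.
move=> x.
pose psi := tens2 (fun y => a (x.1 - y)) (fun y => b (x.2 - y)).
have tpsi : test_fun psi.
  exact: test_tens2 (csm_reflect x.1 ca) (csm_reflect x.2 cb)
    (csupp_reflect (c := x.1) sa) (csupp_reflect (c := x.2) sb).
have dpsi (y v : R * R) : is_derive y v psi
    (v.1 * - tens2 (derive1 a) b (sub2 x y) + v.2 * - tens2 a (derive1 b) (sub2 x y)).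
  apply: (is_derive_eq (is_derive_tens2 v (is_derive_reflect x.1 y.1 ca) (is_derive_reflect x.2 y.2 cb))).
  by rewrite /tens2 /=; ring.
have d0 y : 'D_(ex2 0) psi y = - tens2 (derive1 a) b (sub2 x y).
  by have [_ ->] := dpsi y (ex2 0); rewrite /ex2 /=; ring.
have d1 y : 'D_(ex2 1) psi y = - tens2 a (derive1 b) (sub2 x y).
  by have [_ ->] := dpsi y (ex2 1); rewrite /ex2 /=; ring.
have := ae_and (weak_div tpsi) (ae_and (ae_L1_slice x T kdab lu) (ae_L1_slice x T kab lv)).
apply: filterS => t [h [h1 h2]].
have [tT|tT] := boolP (t \in `]0, T[); last by rewrite !(cvt_out (z := (t, x)) _ _ tT)// addr0.
have := h tT; rewrite /cvt/cv/= -(RintD (h1 tT) (h2 tT)).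
have -> : \int[leb2]_y (u0 (t, y) * 'D_(ex2 0) psi y + u1 (t, y) * 'D_(ex2 1) psi y) =
    - \int[leb2]_y (u0 (t, y) * tens2 (derive1 a) b (sub2 x y) + u1 (t, y) * tens2 a (derive1 b) (sub2 x y)).
  rewrite -(RintN (L1D (h1 tT) (h2 tT))); apply: eq_Rintegral => y _.
  by rewrite d0 d1; ring.
by move=> /eqP; rewrite oppr_eq0 => /eqP.
Qed.

(* The time derivative of [u0] mollified by [tens2 a b]. *)
Definition flux a b z :=
  - cvt (tens2 (derive1 a) b) (fun z => u0 z * u0 z) z - cvt (tens2 a (derive1 b)) (fun z => u0 z * u1 z) z
  - cvt (tens2 (derive1 a) b) p z + cvt (tens2 (derive1 (derive1 a)) b) u0 z.

Lemma flux_integrable a b x : ck a -> ck b ->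
  leb.-integrable `]0, T[ (EFin \o (fun t => flux a b (t, x))).
Proof.
move=> ka kb; have kda := ck_derive ka; have kdb := ck_derive kb; have kdda := ck_derive kda.
have mE : measurable (`]0, T[%classic : set mR) by exact: measurable_itv.
have i1 := cvt_integrable x T (kern_ck kda kb) (locT_L1 (L2_mul u0L u0L)).
have i2 := cvt_integrable x T (kern_ck ka kdb) (locT_L1 (L2_mul u0L u1L)).
have i3 := cvt_integrable x T (kern_ck kda kb) (locT_L2 pL).
have i4 := cvt_integrable x T (kern_ck kdda kb) (locT_L2 u0L).
have := integrableD mE (integrableB mE (integrableB mE (integrableN i1) i2) i3) i4.
by apply: eq_integrable => // t _; rewrite /flux /=.
Qed.

(** Weak continuity tested against the kernel makes the left side continuous in time, and the
    momentum equation identifies its weak derivative; so the identity holds at all times, end points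
    included. *)
Lemma mollified_momentum a b x (s t : R) : ck a -> ck b -> 0 <= s -> s < t -> t <= T ->
  cv (tens2 a b) (U t) x - cv (tens2 a b) (U s) x = \int[leb]_(r in `]s, t[) flux a b (r, x).
Proof.
move=> ka kb; have kda := ck_derive ka; have kdb := ck_derive kb; have kdda := ck_derive kda.
have [ca _] := ka; have [cb _] := kb.
have kab := kern_ck ka kb.
have cg : {within `[0, T], continuous (fun r => cv (tens2 a b) (U r) x)}.
  by apply: Uc; exact: kern_subr_L2.
apply: (weak_time_derivative T0 cg (flux_integrable x ka kb)) => th l r cth sth l0 rT.
have kth := kern1_ck (csm_csupp_ck cth sth).
have kdth : kern1 (derive1 th).
  by apply: kern1_ck; apply: ck_derive; exact: csm_csupp_ck cth sth.
have L0 := locT_L2 u0L; have L00 := locT_L1 (L2_mul u0L u0L); have L01 := locT_L1 (L2_mul u0L u1L).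
have Lp := locT_L2 pL.
have [i0 e0] := cvt_Rint x kdth kab L0.
have [i1 e1] := cvt_Rint x kth (kern_ck kda kb) L00.
have [i2 e2] := cvt_Rint x kth (kern_ck ka kdb) L01.
have [i3 e3] := cvt_Rint x kth (kern_ck kda kb) Lp.
have [i4 e4] := cvt_Rint x kth (kern_ck kdda kb) L0.
have j0 := L0.2 _ _ x kdth kab.
have j1 := L00.2 _ _ x kth (kern_ck kda kb).
have j2 := L01.2 _ _ x kth (kern_ck ka kdb).
have j3 := Lp.2 _ _ x kth (kern_ck kda kb).
have j4 := L0.2 _ _ x kth (kern_ck kdda kb).
have key : \int[leb]_r (derive1 th r * cvt (tens2 a b) u0 (r, x) + th r * flux a b (r, x)) = 0.
  have := weak_eq x cth sth l0 rT ka kb.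
  have d00 z : 'D_(ex 0) ('D_(ex 0) (ktest th a b x)) z = ktest th (derive1 (derive1 a)) b x z.
    exact: (congr1 (fun F => F z) (ktest_d00 x cth ca cb)).
  have dt z : 'D_et (ktest th a b x) z = ktest (derive1 th) a b x z.
    exact: (congr1 (fun F => F z) (ktest_dt x cth ca cb)).
  have d0 z : 'D_(ex 0) (ktest th a b x) z = - ktest th (derive1 a) b x z.
    exact: (congr1 (fun F => F z) (ktest_d0 x cth ca cb)).
  have d1 z : 'D_(ex 1) (ktest th a b x) z = - ktest th a (derive1 b) x z.
    exact: (congr1 (fun F => F z) (ktest_d1 x cth ca cb)).
  move=> <-.
  transitivity (\int[leb]_r (derive1 th r * cvt (tens2 a b) u0 (r, x)
      - th r * cvt (tens2 (derive1 a) b) (fun z => u0 z * u0 z) (r, x)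
      - th r * cvt (tens2 a (derive1 b)) (fun z => u0 z * u1 z) (r, x)
      - th r * cvt (tens2 (derive1 a) b) p (r, x)
      + th r * cvt (tens2 (derive1 (derive1 a)) b) u0 (r, x))).
    by apply: eq_Rintegral => r' _; rewrite /flux mulrDr !mulrBr mulrN !addrA.
  apply: (etrans (Rint_sum5_eq i0 i1 i2 i3 i4 j0 j1 j2 j3 j4 e0 e1 e2 e3 e4)).
  apply: eq_Rintegral => z _.
  by rewrite d00 dt d0 d1 !ktestE; ring.
(* The equation concerns [u0], the claim concerns [U]; they agree at almost every time, which is
   enough under the time integral. *)
rewrite -[RHS]key (_ : \int[leb]_r _ = \int[leb]_(r in `]0, T[)
    (derive1 th r * cvt (tens2 a b) u0 (r, x) + th r * flux a b (r, x))); last first.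
  rewrite Rint_indic; apply: eq_Rintegral => r' _.
  by rewrite [RHS]mulrDr (csupp_indic _ _ sth l0 rT) (csupp_indic _ _ (csupp_derive sth) l0 rT).
have mE : measurable (`]0, T[%classic : set mR) by exact: measurable_itv.
have mth : measurable_fun setT (th : mR -> mR) by have [] := kth.
have mdth : measurable_fun setT (derive1 th : mR -> mR) by have [] := kdth.
have mfl : measurable_fun `]0, T[%classic ((fun r => flux a b (r, x)) : mR -> mR).
  by apply/measurable_EFinP; have /integrableP[] := flux_integrable x ka kb.
have mcg : measurable_fun `]0, T[%classic ((fun r => cv (tens2 a b) (U r) x) : mR -> mR).
  apply: (measurable_funS (E := `[0, T]%classic)); first exact: measurable_itv.
    exact: subset_itv_oo_cc.
  by apply: subspace_continuous_measurable_fun => //; exact: measurable_itv.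
have mu0 : measurable_fun `]0, T[%classic ((fun r => cvt (tens2 a b) u0 (r, x)) : mR -> mR).
  by apply/measurable_EFinP; have /integrableP[] := cvt_integrable x T kab L0.
congr fine; apply: ae_eq_integral => //.
- apply/measurable_EFinP; apply: measurable_funD; apply: measurable_funM => //; exact: measurable_funTS.
- apply/measurable_EFinP; apply: measurable_funD; apply: measurable_funM => //; exact: measurable_funTS.
apply: (ae_imp Uu) => r' h rT'; congr EFin; congr (_ * _ + _).
have rTc : r' \in `[0, T].
  by move: rT'; rewrite !in_itv/= => /andP[? ?]; apply/andP; split; exact: ltW.
apply: (ae_cv_eq _ kab (L2_meas (UL rTc)) _ (h rT')).
exact: slice_measurable (L2_meas u0L).
Qed.

(** The integration variable enters the kernel through [x - y], so integrating by parts in [y] moves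
    the derivative from the kernel to [Y ^ 2] without a sign. *)
Lemma cv_mul_derive a b d (g : R * R -> R) x : ck a -> ck b -> 0 < d -> L2 leb2 g ->
  let Y := cv (tens2 (moll d) (moll d)) g in
  let Y1 := cv (tens2 (derive1 (moll d)) (moll d)) g in
  cv (tens2 (derive1 a) b) (fun y => Y y * Y y) x = cv (tens2 a b) (fun y => Y y * Y1 y + Y y * Y1 y) x.
Proof.
move=> ka kb d0 gL Y Y1; have kda := ck_derive ka; have [ca _] := ka.
have ke := ck_moll d0; have kde := ck_derive ke.
have [YL _] := cv_L2 (kern_ck ke ke) gL; have [Y1L _] := cv_L2 (kern_ck kde ke) gL.
have lg := locL_L2 gL.
have kab := kern_ck ka kb; have kdab := kern_ck kda kb.
have jG (K : R * R -> R) (f : R * R -> R) : kern K -> L1 leb2 f -> L1 leb2 (fun y => f y * K (sub2 x y)).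
  by move=> kK fi; exact: cv_L1ok.
pose G y := Y y * Y y * tens2 a b (sub2 x y).
pose G1 y := (Y y * Y1 y + Y y * Y1 y) * tens2 a b (sub2 x y) - Y y * Y y * tens2 (derive1 a) b (sub2 x y).
have iYY := L2_mul YL YL; have iYY1 := L2_mul YL Y1L.
have i1 := jG _ _ kab (L1D iYY1 iYY1); have i2 := jG _ _ kdab iYY.
have dY (y1 y2 : R) : is_derive y1 (1 : R) (fun t => Y (t, y2)) (Y1 (y1, y2)).
  exact: is_derive_cv1.
have cY1 y2 : continuous (fun t => Y1 (t, y2)) by exact: continuous_cv1.
have cY y2 : continuous (fun t => Y (t, y2)) by exact: continuous_cv1.
have : \int[leb2]_y G1 y = 0.
  apply: (@integral_partial1 R G G1).
  - move=> y1 y2.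
    have hk : is_derive y1 (1 : R) (fun t : R => a (x.1 - t) * b (x.2 - y2))
        (- derive1 a (x.1 - y1) * b (x.2 - y2)).
      apply: (is_derive_eq (is_derive_mul (is_derive_reflect x.1 y1 ca) (is_derive_cst (b (x.2 - y2)) y1 (1 : R)))).
      by rewrite mulr0 addr0.
    apply: (is_derive_eq (is_derive_mul (is_derive_mul (dY y1 y2) (dY y1 y2)) hk)).
    by rewrite /G1 /tens2 /sub2 /=; move: (Y (y1, y2)) (Y1 (y1, y2)) => ? ?; ring.
  - move=> y2 t; rewrite /G1 /tens2 /sub2 /=.
    have cr (c : R -> R) : continuous c -> {for t, continuous (fun t => c (x.1 - t))}.
      move=> cc; apply: continuous_comp (cc _); apply: cvgB; [exact: cvg_cst|exact: cvg_id].
    apply: cvgB; apply: cvgM.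
    + by apply: cvgD; apply: cvgM; [exact: cY|exact: cY1|exact: cY|exact: cY1].
    + by apply: cvgM; [exact: cr (ck_continuous ka)|exact: cvg_cst].
    + by apply: cvgM; exact: cY.
    + by apply: cvgM; [exact: cr (ck_continuous kda)|exact: cvg_cst].
  - exact: jG.
  - exact: L1B.
move=> e0; have := RintB i1 i2; rewrite -[X in X = _ -> _]/(\int[leb2]_y G1 y) e0.
by move=> /esym/eqP; rewrite subr_eq0 => /eqP.
Qed.

(** The rule [d1 (u0 ^ 2) = 2 u0 v0] for a merely weak derivative. It holds with [u0] mollified,
    both sides converge in [L1] as products of [L2] limits, and limits are unique. *)
Lemma mollified_convection a b : ck a -> ck b ->
  {ae leb3, forall z, cvt (tens2 (derive1 a) b) (fun z => u0 z * u0 z) z =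
    cvt (tens2 a b) (fun z => u0 z * v0 z + u0 z * v0 z) z}.
Proof.
move=> ka kb; have kda := ck_derive ka.
have kab := kern_ck ka kb; have kdab := kern_ck kda kb.
pose d (n : nat) : R := n.+1%:R^-1.
have d0 : d @ \oo --> 0 by exact: cvg_harmonic.
have dn0 n : 0 < d n by rewrite invr_gt0.
pose m n := tens2 (moll (d n)) (moll (d n)).
have pm n : pker (d n) (m n) by exact: pker_moll_moll.
have km n : kern (m n) := pker_kern (pm n).
have cY := cvt_cvg2 d0 pm u0L; have cZ := cvt_cvg2 d0 pm v0L.
have cYZ := cvg1_mul cY cZ.
have C1 := cvt_continuous1 kdab (cvg1_mul cY cY).
have C2 := cvt_continuous1 kab (cvg1D cYZ cYZ).
apply: (cvg1_unique C1).
have [L2' l2 _] := C2; have [L1' l1 _] := C1.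
apply: (ae_cvg1 C2) => [n|||]; [exact: L1_meas (L1' n)|exact: L1_meas l2| |exact: aeW].
move=> n; apply: (@ae_prod_eq _ _ _ _ _ leb leb2); [exact: L1_meas (L1' n)|exact: L1_meas (L2' n)|].
have := ae_and (L2_slice u0L) (ae_slice (mollified_dx (ck_moll (dn0 n)) (ck_moll (dn0 n)))).
move=> /ae_imp; apply => t [ut ht]; apply: aeW => x.
apply: (etrans (cv_mul_derive x ka kb (dn0 n) ut)).
have mY : measurable_fun setT (cv (m n) (fun y => u0 (t, y)) : mR2 -> mR).
  exact: cv_measurable (km n) (L2_meas ut).
have mY1 : measurable_fun setT (cv (tens2 (derive1 (moll (d n))) (moll (d n))) (fun y => u0 (t, y)) : mR2 -> mR).
  exact: cv_measurable (kern_ck (ck_derive (ck_moll (dn0 n))) (ck_moll (dn0 n))) (L2_meas ut).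
have mZ : measurable_fun setT (cv (m n) (fun y => v0 (t, y)) : mR2 -> mR).
  by apply: cv_measurable (km n) _; exact: slice_measurable (L2_meas v0L).
apply: (ae_cv_eq _ kab).
- by apply: measurable_funD; exact: measurable_funM.
- by apply: measurable_funD; exact: measurable_funM.
by apply: (ae_imp ht) => y e; congr (_ * _ + _ * _); exact: e.
Qed.



Local Notation m d := (tens2 (moll d) (moll d)).
Local Notation k d h := (tens2 (moll d) (kap d h)).

Definition defect (d : R) z := cvt (m d) (fun z => u0 z * u1 z) z - cvt (m d) u1 z * cvt (m d) u0 z.

Definition shifted_defect (d h : R) z :=
  cvt (kshift d h) (fun z => u0 z * u1 z) z - cvt (kshift d h) u1 z * cvt (kshift d h) u0 z.

(** The two subtracted products have different origins: the first completes the transport term, the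
    second comes from the Leibniz rule and incompressibility. Each tends to [u0 v0], and together
    they cancel the limit of the leading term. *)
Definition remainder (d h : R) z := cvt (k d h) (fun z => u0 z * v0 z + u0 z * v0 z) z
  - cvt (m d) u0 z * cvt (k d h) v0 z - cvt (kshift d h) u0 z * cvt (k d h) v0 z
  + h^-1 * (defect d z - shifted_defect d h z).

(** * Renormalization of the mollified equation at fixed scales *)

Section fixed_scales.
Variables d h : R.
Hypotheses (d0 : 0 < d) (h0 : 0 < h).

Let ke := ck_moll d0.
Let kk := ck_kap d0 h0.
Let kde := ck_derive ke.
Let kdk := ck_derive kk.
Let km : kern (m d) := kern_ck ke ke.
Let kK : kern (k d h) := kern_ck ke kk.
Let ks : kern (kshift d h) := kern_ck ke (ck_shift h ke).

(** In this section [w0], [U1] are the two components of the mollified velocity. Otherwise a final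
    digit is the direction of a derivative, [1] for [x1] and [2] for [x2]; thus [w01] is [d1 w0] and
    [U12] is [d2 U1]. *)
Let w := cvt (k d h) u0.
Let v := cvt (k d h) v0.
Let q := cvt (k d h) p.
Let w1 := cvt (tens2 (derive1 (moll d)) (kap d h)) u0.
Let w2 := cvt (tens2 (moll d) (derive1 (kap d h))) u0.
Let q1 := cvt (tens2 (derive1 (moll d)) (kap d h)) p.
Let v1 := cvt (tens2 (derive1 (moll d)) (kap d h)) v0.
Let w0 := cvt (m d) u0.
Let U1 := cvt (m d) u1.
Let w01 := cvt (tens2 (derive1 (moll d)) (moll d)) u0.
Let U12 := cvt (tens2 (moll d) (derive1 (moll d))) u1.

Let wL : L2 leb3 w := cvt_L2 kK u0L.
Let vL : L2 leb3 v := cvt_L2 kK v0L.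
Let qL : L2 leb3 q := cvt_L2 kK pL.
Let w1L : L2 leb3 w1 := cvt_L2 (kern_ck kde kk) u0L.
Let w2L : L2 leb3 w2 := cvt_L2 (kern_ck ke kdk) u0L.
Let q1L : L2 leb3 q1 := cvt_L2 (kern_ck kde kk) pL.
Let v1L : L2 leb3 v1 := cvt_L2 (kern_ck kde kk) v0L.
Let w0L : L2 leb3 w0 := cvt_L2 km u0L.
Let U1L : L2 leb3 U1 := cvt_L2 km u1L.
Let w01L : L2 leb3 w01 := cvt_L2 (kern_ck kde ke) u0L.
Let U12L : L2 leb3 U12 := cvt_L2 (kern_ck ke kde) u1L.

Lemma defect_L1 : L1 leb3 (defect d).
Proof. by apply: L1B; [case: (cvt_L1 km (L2_mul u0L u1L))|exact: L2_mul]. Qed.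

Lemma shifted_defect_L1 : L1 leb3 (shifted_defect d h).
Proof.
apply: L1B; first by case: (cvt_L1 ks (L2_mul u0L u1L)).
by apply: L2_mul; exact: cvt_L2 ks _.
Qed.

Lemma remainder_L1 : L1 leb3 (remainder d h).
Proof.
apply: L1D; last by apply: L1Z; apply: L1B; [exact: defect_L1|exact: shifted_defect_L1].
apply: L1B; last by apply: L2_mul; [exact: cvt_L2 ks u0L|exact: vL].
apply: L1B; last exact: L2_mul.
have uv := L2_mul u0L v0L.
by have [] := cvt_L1 kK (L1D uv uv).
Qed.

(* The remainder is what is left of the convective terms after removing the
   transport term; it tends to zero in [L1] as the scales vanish. *)
Lemma flux_remainder : {ae leb3, forall z, flux (moll d) (kap d h) z =
  - (remainder d h z + w0 z * v z + U1 z * w2 z) - q1 z + v1 z}.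
Proof.
have lu0 : {ae leb, forall t, locL (fun x => u0 (t, x))}.
  by apply: (ae_imp (L2_slice u0L)) => t; exact: locL_L2.
have lu1 : {ae leb, forall t, locL (fun x => u1 (t, x))}.
  by apply: (ae_imp (L2_slice u1L)) => t; exact: locL_L2.
have lu01 : {ae leb, forall t, locL (fun x => u0 (t, x) * u1 (t, x))}.
  by apply: (ae_imp (L1_slice (L2_mul u0L u1L))) => t; exact: locL_L1.
have ae1 := ae_and (mollified_convection ke kk) (mollified_dx kde kk).
have ae2 := ae_and (mollified_dx ke kk) (mollified_div ke kk).
have ae3 := ae_and (cvt_dkap (f := u0) h d0 lu0) (ae_and (cvt_dkap (f := u1) h d0 lu1)
  (cvt_dkap (f := fun z => u0 z * u1 z) h d0 lu01)).
apply: (ae_imp (ae_and ae1 (ae_and ae2 ae3))) => z [[e1 e2] [[e3 e4] [e5 [e6 e7]]]].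
rewrite /flux /remainder /defect /shifted_defect.
rewrite e1 e2 e7 /w2 e5.
(* Incompressibility identifies the difference quotient of the mollified [u1] with [- v]. With it
   the discrete Leibniz rule becomes a polynomial identity in which [h^-1] is a mere symbol. *)
have {e3 e4 e6} ve : v z = - (h^-1 * (cvt (m d) u1 z - cvt (kshift d h) u1 z)).
  by rewrite /v -e3 -e6; apply/eqP; rewrite -addr_eq0; apply/eqP.
rewrite -![cvt (k d h) v0 z]/(v z) ve /w0 /U1 /q1 /v1.
move: (cvt (k d h) (fun z => u0 z * v0 z + u0 z * v0 z) z)
  (cvt (m d) (fun z => u0 z * u1 z) z) (cvt (kshift d h) (fun z => u0 z * u1 z) z)
  (cvt (m d) u0 z) (cvt (m d) u1 z) (cvt (kshift d h) u0 z) (cvt (kshift d h) u1 z)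
  (cvt (tens2 (derive1 (moll d)) (kap d h)) p z) (cvt (tens2 (derive1 (moll d)) (kap d h)) v0 z) (h^-1).
by clear => *; ring.
Qed.

Section renormalization.
Variables (beta b1 b2 : R -> R) (C1 C2 : R).
Hypothesis betab1 : forall x : R, is_derive x (1 : R) beta (b1 x).
Hypothesis b1b2 : forall x : R, is_derive x (1 : R) b1 (b2 x).
Hypothesis b2c : continuous b2.
Hypotheses (b1C : forall r : R, `|b1 r| <= C1) (b2C : forall r : R, `|b2 r| <= C2).
Hypotheses (beta0 : beta 0 = 0) (b10 : b1 0 = 0).
Variables s t : R.
Hypotheses (s0 : 0 <= s) (st : s < t) (tT : t <= T).

Let b1c : continuous b1. Proof. by move=> x; exact: is_derive_continuous (b1b2 x). Qed.

Let b1_lip (x y : R) : `|b1 x - b1 y| <= C2 * `|x - y|.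
Proof. exact: bounded_derivative_lipschitz b1b2 b2C. Qed.

Let b1_le (x : R) : `|b1 x| <= C2 * `|x|.
Proof. by have := b1_lip x 0; rewrite b10 !subr0. Qed.

Let beta_le (x : R) : `|beta x| <= C1 * `|x|.
Proof. by have := bounded_derivative_lipschitz x 0 betab1 b1C; rewrite beta0 !subr0. Qed.

Let ind : R -> R := \1_(`]s, t[%classic : set R).

Lemma renormalized_in_time x : beta (cv (k d h) (U t) x) - beta (cv (k d h) (U s) x) =
  \int[leb]_r (ind r * (b1 (w (r, x)) * flux (moll d) (kap d h) (r, x))).
Proof.
pose F r := flux (moll d) (kap d h) (r, x).
(* The flux is known to be integrable on []0, T[], whereas the chain rule is applied on [[s, t]],
   which may contain [0] or [T]; hence the extension by zero. *)
have iF : L1 leb (F \_ `]0, T[%classic) by apply: restrict_L1; exact: flux_integrable.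
pose W r := cv (k d h) (U r) x.
have iFst : leb.-integrable `[s, t] (EFin \o (F \_ `]0, T[%classic)).
  by apply: integrableS iF => //; exact: measurable_itv.
have WF r : r \in `[s, t] -> W r - W s = \int[leb]_(y in `[s, r]) (F \_ `]0, T[%classic) y.
  rewrite in_itv/= => /andP[]; rewrite le_eqVlt => /predU1P[<- _|sr rt].
    by rewrite subrr set_itv1 Rintegral_set1.
  rewrite /W (mollified_momentum x ke kk s0 sr (le_trans rt tT)) -Rint_oo_cc; last first.
    by apply: integrableS iF => //; exact: measurable_itv.
  apply: eq_Rintegral => y /set_mem/=; rewrite in_itv/= => /andP[sy yr].
  by rewrite patchE mem_set//= in_itv/= (le_lt_trans s0 sy) (lt_le_trans yr)// (le_trans rt).
rewrite -/(W t) -/(W s) (chain_rule_ac st betab1 b1c b1C b1_lip iFst WF).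
have mW : measurable_fun `[s, t]%classic (W : mR -> mR).
  apply: (measurable_funS (E := `[0, T]%classic)); first exact: measurable_itv.
    by apply: subset_itv; rewrite bnd_simp.
  apply: subspace_continuous_measurable_fun; first exact: measurable_itv.
  by apply: Uc; exact: kern_subr_L2.
have mFT : measurable_fun setT ((F \_ `]0, T[%classic) : mR -> mR) by exact: L1_meas iF.
have mE : measurable (`[s, t]%classic : set mR) by exact: measurable_itv.
have mwx : measurable_fun setT ((fun r => w (r, x)) : mR -> mR).
  by apply: (measurableT_comp (L2_meas wL)); exact: measurable_fun_pair.
transitivity (\int[leb]_(r in `[s, t]) (b1 (w (r, x)) * (F \_ `]0, T[%classic) r)).
  congr fine; apply: ae_eq_integral => //.
  - apply/measurable_EFinP; apply: measurable_funM; last exact: measurable_funTS.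
    exact: measurableT_comp (continuous_measurableR b1c) mW.
  - apply/measurable_EFinP; apply: measurable_funM; last exact: measurable_funTS.
    by apply: measurable_funTS; exact: measurableT_comp (continuous_measurableR b1c) mwx.
  apply: (ae_imp (ae_and (L2_slice u0L) Uu)) => r [u0r Ur] rst; congr EFin.
  have [rT|rT] := boolP (r \in `]0, T[); last first.
    by rewrite !patchE memNset ?mulr0//=; apply/negP.
  congr (b1 _ * _); rewrite /W /w /cvt; apply: (ae_cv_eq _ kK _ _ (Ur rT)); last exact: L2_meas u0r.
  apply: L2_meas; apply: UL; move: rT; rewrite !in_itv/= => /andP[? ?].
  by apply/andP; split; exact: ltW.
rewrite -Rint_oo_cc; last first.
  have bnd : [bounded b1 (w (r, x)) | r in `[s, t]%classic].
    exists C1; split; first exact: num_real.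
    by move=> M CM r _ /=; rewrite (le_trans (b1C _))// ltW.
  have mb : measurable_fun `[s, t]%classic ((fun r => b1 (w (r, x))) : mR -> mR).
    by apply: measurable_funTS; exact: measurableT_comp (continuous_measurableR b1c) mwx.
  by have := integrableMr mE mb bnd iFst; apply: eq_integrable => // r _.
rewrite Rint_indic; apply: eq_Rintegral => r _; rewrite /ind indicE.
case: (boolP (r \in _)) => [|_]; last by rewrite !mul0r.
rewrite mem_setE in_itv/= => /andP[sr rt]; rewrite !mul1r /F patchE mem_set//= in_itv/=.
by rewrite (le_lt_trans s0 sr) (lt_le_trans rt).
Qed.


Let indC (z : R * (R * R)) : `|ind z.1| <= 1. Proof. exact: indic_norm_le. Qed.

Let mind : measurable_fun setT ((fun z => ind z.1) : mR3 -> mR).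
Proof. by apply: measurable_fst1; exact: measurable_indicR. Qed.

Let ind_L1 (f : R * (R * R) -> R) : L1 leb3 f -> L1 leb3 (fun z => ind z.1 * f z).
Proof. by move=> fi; apply: (L1_bound mind indC). Qed.

Let main_terms z := - (b1 (w z) * remainder d h z) + b2 (w z) * (v z * q z) - b2 (w z) * (v z * v z).

Let main_terms_L1 : L1 leb3 main_terms.
Proof.
have mw := L2_meas wL.
apply: L1B; last by apply: (L1_comp_mul b2c b2C mw); exact: L2_mul.
apply: L1D; last by apply: (L1_comp_mul b2c b2C mw); exact: L2_mul.
by apply: L1N; apply: (L1_comp_mul b1c b1C mw); exact: remainder_L1.
Qed.

(* Up to sign, [H1] to [H4] come from spatial derivatives of products of mollified
   functions, so their integrals over time slices vanish. *)
Let H1 z := b2 (w z) * (w1 z * q z) + b1 (w z) * q1 z.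
Let H2 z := b2 (w z) * (w1 z * v z) + b1 (w z) * v1 z.
Let H3 z := b1 (w z) * (w1 z * w0 z) + beta (w z) * w01 z.
Let H4 z := b1 (w z) * (w2 z * U1 z) + beta (w z) * U12 z.

Let H1_L1 : L1 leb3 H1 := L1_chain_terms b1b2 b2c b1_le b2C wL w1L qL q1L.
Let H2_L1 : L1 leb3 H2 := L1_chain_terms b1b2 b2c b1_le b2C wL w1L vL v1L.
Let H3_L1 : L1 leb3 H3 := L1_chain_terms betab1 b1c beta_le b1C wL w1L w0L w01L.
Let H4_L1 : L1 leb3 H4 := L1_chain_terms betab1 b1c beta_le b1C wL w2L U1L U12L.

Let H1_0 : \int[leb3]_z (ind z.1 * H1 z) = 0.
Proof.
apply: slice_integral_eq0; [exact: ind_L1 H1_L1|exact: L1_slice H1_L1|].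
apply: (ae_imp (ae_and (L2_slice u0L) (L2_slice pL))) => r [ur pr].
exact: (integral_chain1 b1b2 b2c b1_le b2C ke kk ke kk ur pr).
Qed.

Let H2_0 : \int[leb3]_z (ind z.1 * H2 z) = 0.
Proof.
apply: slice_integral_eq0; [exact: ind_L1 H2_L1|exact: L1_slice H2_L1|].
apply: (ae_imp (ae_and (L2_slice u0L) (L2_slice v0L))) => r [ur vr].
exact: (integral_chain1 b1b2 b2c b1_le b2C ke kk ke kk ur vr).
Qed.

Let H3_0 : \int[leb3]_z (ind z.1 * H3 z) = 0.
Proof.
apply: slice_integral_eq0; [exact: ind_L1 H3_L1|exact: L1_slice H3_L1|].
apply: (ae_imp (L2_slice u0L)) => r ur.
exact: (integral_chain1 betab1 b1c beta_le b1C ke kk ke ke ur ur).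
Qed.

Let H4_0 : \int[leb3]_z (ind z.1 * H4 z) = 0.
Proof.
apply: slice_integral_eq0; [exact: ind_L1 H4_L1|exact: L1_slice H4_L1|].
apply: (ae_imp (ae_and (L2_slice u0L) (L2_slice u1L))) => r [ur vr].
exact: (integral_chain2 betab1 b1c beta_le b1C ke kk ke ke ur vr).
Qed.

Let Phi z := ind z.1 * (b1 (w z) * flux (moll d) (kap d h) z).

(** In [H3 + H4] the terms with [beta(w)] cancel because the mollified velocity is divergence free,
    which leaves the transport term. [H1] and [H2] trade the derivatives of pressure and viscosity
    for the [b2] terms of [main_terms]. *)
Let Phi_terms z := ind z.1 * main_terms z - ind z.1 * H1 z - ind z.1 * H3 z - ind z.1 * H4 z
  + ind z.1 * H2 z.

Let Phi_ae : {ae leb3, forall z, Phi z = Phi_terms z}.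
Proof.
apply: (ae_imp (ae_and flux_remainder (ae_and (mollified_dx ke kk) (mollified_div ke ke)))).
move=> z [e1 [e2 e3]]; rewrite /Phi /Phi_terms /main_terms /H1 /H2 /H3 /H4 e1.
have -> : w1 z = v z by exact: e2.
have -> : U12 z = - w01 z by apply/eqP; rewrite -addr_eq0 addrC; apply/eqP; exact: e3.
move: (ind z.1) (b1 (w z)) (b2 (w z)) (beta (w z)) (remainder d h z) (v z) (q z) (w0 z) (w2 z) (U1 z)
  (q1 z) (v1 z) (w01 z).
by clear => *; ring.
Qed.

Let Phi_terms_L1 : L1 leb3 Phi_terms.
Proof.
apply: L1D; last exact: ind_L1 H2_L1.
apply: L1B; last exact: ind_L1 H4_L1.
apply: L1B; last exact: ind_L1 H3_L1.
by apply: L1B; [exact: ind_L1 main_terms_L1|exact: ind_L1 H1_L1].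
Qed.

Let Phi_meas : measurable_fun setT (Phi : mR3 -> mR).
Proof.
apply: measurable_funM; first exact: mind.
apply: measurable_funM.
  exact: measurableT_comp (continuous_measurableR b1c) (L2_meas wL).
have mc K f : kern K -> measurable_fun setT (f : mR3 -> mR) -> measurable_fun setT (cvt K f : mR3 -> mR).
  by move=> kK' mf; exact: cvt_measurable.
have muu := L1_meas (L2_mul u0L u0L); have muv := L1_meas (L2_mul u0L u1L).
apply: measurable_funD; last by apply: mc; [exact: kern_ck (ck_derive kde) kk|exact: L2_meas u0L].
apply: measurable_funB; last by apply: mc; [exact: kern_ck|exact: L2_meas pL].
apply: measurable_funB; last by apply: mc; [exact: kern_ck|exact: muv].
by apply: measurable_funN; apply: mc; [exact: kern_ck|exact: muu].
Qed.

Let beta_slice_L1 r : r \in `[0, T] -> L1 leb2 (fun x => beta (cv (k d h) (U r) x)).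
Proof.
by move=> rT; have [UrL _] := cv_L2 kK (UL rT); exact: L1_quadratic betab1 b1_le beta0 UrL.
Qed.

Lemma renormalized_mollified :
  \int[leb2]_x beta (cv (k d h) (U t) x) - \int[leb2]_x beta (cv (k d h) (U s) x) =
  \int[leb3]_z (ind z.1 * (- (b1 (w z) * remainder d h z) + b2 (w z) * (v z * q z)
     - b2 (w z) * (v z * v z))).
Proof.
have sI : s \in `[0, T] by rewrite in_itv/= s0 (le_trans (ltW st)).
have tI : t \in `[0, T] by rewrite in_itv/= tT (le_trans s0 (ltW st)).
rewrite -(RintB (beta_slice_L1 tI) (beta_slice_L1 sI)).
have Phi_L1 : L1 leb3 Phi by exact: ae_L1 Phi_meas Phi_ae Phi_terms_L1.
(* The identity at a fixed point integrates in time first, whereas [H1] to [H4] vanish upon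
   integrating in space at a fixed time. *)
have [_ e] := fubini_Rint2 Phi_L1.
transitivity (\int[leb3]_z Phi z).
  by rewrite -e; apply: eq_Rintegral => x _; rewrite renormalized_in_time.
rewrite (ae_Rint_eq Phi_meas (L1_meas Phi_terms_L1) Phi_ae).
apply: (etrans (Rint_sum5 (ind_L1 main_terms_L1) (ind_L1 H1_L1) (ind_L1 H3_L1) (ind_L1 H4_L1) (ind_L1 H2_L1))).
by rewrite H1_0 H2_0 H3_0 H4_0 !subr0 addr0.
Qed.

End renormalization.
End fixed_scales.


Lemma shifted_defectE (d h t : R) x : shifted_defect d h (t, x) = defect d (t, (x.1, x.2 - h)).
Proof.
exact: (congr2 (fun y z : R => y - z) (cvt_kshift d h (fun z => u0 z * u1 z) t x)
  (congr2 *%R (cvt_kshift d h u1 t x) (cvt_kshift d h u0 t x))).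
Qed.

(** The shifted defect is a translate, so one smallness condition on [d] controls both defects
    whatever [h] is. *)
Lemma shifted_defect_nrm1 (d h : R) : 0 < d -> nrm1 leb3 (shifted_defect d h) = nrm1 leb3 (defect d).
Proof.
move=> d0; have mp : mpres leb3 leb3 (fun z => (idfun z.1, (z.2.1 - 0, z.2.2 - h))).
  exact: mpres_prod (mpres_id leb) (mpres_shift2 (0, h)).
apply: (etrans _ (esym (mpres_Rint mp (L1_norm (defect_L1 d0))))).
by apply: eq_Rintegral => -[t x] _; rewrite shifted_defectE /= subr0.
Qed.

(** * Passage to the limit in the scales *)

Section vanishing_scales.
Variables d h : R^nat.
Hypotheses (d0 : forall n, 0 < d n) (h0 : forall n, 0 < h n).
Hypotheses (dl : d @ \oo --> 0) (hl : h @ \oo --> 0).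
Hypothesis small_defect : forall n, nrm1 leb3 (defect (d n)) <= h n ^+ 2.

Let hdl : (fun n => h n + d n) @ \oo --> 0.
Proof. by rewrite -[0 in X in _ --> X]addr0; exact: cvgD. Qed.

Let pK n : pker (h n + d n) (k (d n) (h n)).
Proof. exact: pker_moll_kap. Qed.

Lemma pker_kshift (e c : R) : 0 < e -> 0 < c -> pker (c + e) (kshift e c).
Proof.
move=> e0 c0; have se := csupp_moll e0; have ke := ck_moll e0.
apply: (pker_tens2 ke (ck_shift c ke) se (csupp_shift (c := c) se)).
- by rewrite normrN gtr0_norm//; lra.
- by rewrite gtr0_norm//; lra.
- by rewrite ler_norml; apply/andP; split; lra.
- by rewrite gtr0_norm//; lra.
- by move=> x; exact: moll_ge0.
- by move=> x; exact: moll_ge0.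
- exact: moll_int.
- by rewrite -(mpres_Rint (mpres_shift c) (ck_L1 ke)) moll_int.
Qed.

Let pS n : pker (h n + d n) (kshift (d n) (h n)).
Proof. exact: pker_kshift. Qed.

Let pM n : pker (d n) (m (d n)).
Proof. exact: pker_moll_moll. Qed.

Lemma remainder_cvg : cvg1 leb3 (fun n => remainder (d n) (h n)) (fun=> 0).
Proof.
have uv := L2_mul u0L v0L.
have cA := cvt_cvg1 hdl pK (L1D uv uv).
have c0 := cvt_cvg2 dl pM u0L; have cv0 := cvt_cvg2 hdl pK v0L; have cs := cvt_cvg2 hdl pS u0L.
have cE : cvg1 leb3 (fun n z => (h n)^-1 * (defect (d n) z - shifted_defect (d n) (h n) z)) (fun=> 0).
  have i n := L1B (defect_L1 (d0 n)) (shifted_defect_L1 (h n) (d0 n)).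
  have i0 : L1 leb3 (fun=> 0) by have := L1B uv uv; congr L1; apply/funext => z; rewrite subrr.
  (* Two defects, each at most [h ^ 2] in norm, divided by [h]. *)
  have h2 : 2 * h n @[n --> \oo] --> 0 by rewrite -[0 in X in _ --> X](mulr0 2); exact: cvgMr.
  apply: (cvg1_squeeze (fun n => L1Z _ (i n)) i0 _ h2) => n.
  have -> : nrm1 leb3 (fun z => (h n)^-1 * (defect (d n) z - shifted_defect (d n) (h n) z) - 0) =
      (h n)^-1 * nrm1 leb3 (fun z => defect (d n) z - shifted_defect (d n) (h n) z).
    rewrite /nrm1 -(RintZ _ (L1_norm (i n))); apply: eq_Rintegral => z _.
    by rewrite subr0 normrM gtr0_norm// invr_gt0.
  rewrite ler_pdivrMl//.
  have tri := nrm1_tri (defect_L1 (d0 n)) (L1N (shifted_defect_L1 (h n) (d0 n))).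
  apply: (le_trans tri).
  have -> : nrm1 leb3 (fun z => - shifted_defect (d n) (h n) z) = nrm1 leb3 (defect (d n)).
    rewrite -(shifted_defect_nrm1 (h n) (d0 n)); apply: eq_Rintegral => z _.
    by rewrite normrN.
  by have := small_defect n; rewrite expr2; lra.
have := cvg1D (cvg1B (cvg1B cA (cvg1_mul c0 cv0)) (cvg1_mul cs cv0)) cE.
by congr cvg1; apply/funext => z; ring.
Qed.

Section passage_to_the_limit.
Hypothesis wae : {ae leb3, forall z, cvt (k (d n) (h n)) u0 z @[n --> \oo] --> u0 z}.
Variables (beta b1 b2 : R -> R) (C1 C2 : R).
Hypothesis betab1 : forall x : R, is_derive x (1 : R) beta (b1 x).
Hypothesis b1b2 : forall x : R, is_derive x (1 : R) b1 (b2 x).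
Hypothesis b2c : continuous b2.
Hypotheses (b1C : forall r : R, `|b1 r| <= C1) (b2C : forall r : R, `|b2 r| <= C2).
Hypotheses (beta0 : beta 0 = 0) (b10 : b1 0 = 0).

Let b1c : continuous b1. Proof. by move=> x; exact: is_derive_continuous (b1b2 x). Qed.

Let b1_le (x : R) : `|b1 x| <= C2 * `|x|.
Proof. by have := bounded_derivative_lipschitz x 0 b1b2 b2C; rewrite b10 !subr0. Qed.

Lemma integral_beta_cvg r : r \in `[0, T] ->
  \int[leb2]_x beta (cv (k (d n) (h n)) (U r) x) @[n --> \oo] --> \int[leb2]_x beta (U r x).
Proof.
move=> rT; apply: cvg1_int.
exact: (cvg1_quadratic betab1 b1_le beta0 (cv_cvg2 hdl pK (UL rT))).
Qed.

(** On the right the bound on [b1] disposes of the remainder, and the bound on [b2] handles products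
    of two [L2] limits. On the left the mollifications of [U s] and [U t] converge in [L2] at these
    very times, which almost everywhere convergence in time would not give. *)
Lemma renormalized_limit (s t : R) : 0 <= s -> s < t -> t <= T ->
  \int[leb2]_x beta (U t x) - \int[leb2]_x beta (U s x) =
  \int[leb3]_z ((\1_(`]s, t[%classic : set R) : R -> R) z.1 *
    (b2 (u0 z) * (v0 z * p z) - b2 (u0 z) * (v0 z * v0 z))).
Proof.
move=> s0 st tT.
have cw := cvt_cvg2 hdl pK u0L; have cv0 := cvt_cvg2 hdl pK v0L; have cp := cvt_cvg2 hdl pK pL.
have mW n : measurable_fun setT (cvt (k (d n) (h n)) u0 : mR3 -> mR).
  by have [/(_ n)/L2_meas] := cw.
have t1 := cvg1_comp_mul b1c b1C mW (L2_meas u0L) wae remainder_cvg.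
have t2 := cvg1_comp_mul b2c b2C mW (L2_meas u0L) wae (cvg1_mul cv0 cp).
have t3 := cvg1_comp_mul b2c b2C mW (L2_meas u0L) wae (cvg1_mul cv0 cv0).
have mind : measurable_fun setT ((fun z => (\1_(`]s, t[%classic : set R) : R -> R) z.1) : mR3 -> mR).
  by apply: measurable_fst1; exact: measurable_indicR.
have t4 := cvg1_bound_mul mind (fun z => indic_norm_le _ z.1) (cvg1B (cvg1D (cvg1Z (-1) t1) t2) t3).
have rhs := cvg1_int t4.
have sI : s \in `[0, T] by rewrite in_itv/= s0 (le_trans (ltW st)).
have tI : t \in `[0, T] by rewrite in_itv/= tT (le_trans s0 (ltW st)).
have lhs : \int[leb2]_x beta (cv (k (d n) (h n)) (U t) x) - \int[leb2]_x beta (cv (k (d n) (h n)) (U s) x)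
    @[n --> \oo] --> \int[leb2]_x beta (U t x) - \int[leb2]_x beta (U s x).
  by apply: cvgB; exact: integral_beta_cvg.
have e n := renormalized_mollified (d0 n) (h0 n) betab1 b1b2 b2c b1C b2C beta0 b10 s0 st tT.
have rhs' : \int[leb2]_x beta (cv (k (d n) (h n)) (U t) x) - \int[leb2]_x beta (cv (k (d n) (h n)) (U s) x)
    @[n --> \oo] --> \int[leb3]_z ((\1_(`]s, t[%classic : set R) : R -> R) z.1 *
    (b2 (u0 z) * (v0 z * p z) - b2 (u0 z) * (v0 z * v0 z))).
  have -> : \int[leb3]_z ((\1_(`]s, t[%classic : set R) : R -> R) z.1 *
      (b2 (u0 z) * (v0 z * p z) - b2 (u0 z) * (v0 z * v0 z))) =
    \int[leb3]_z ((\1_(`]s, t[%classic : set R) : R -> R) z.1 *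
      (-1 * (b1 (u0 z) * 0) + b2 (u0 z) * (v0 z * p z) - b2 (u0 z) * (v0 z * v0 z))).
    by apply: eq_Rintegral => z _; rewrite mulr0 mulr0 add0r.
  have e' n : \int[leb2]_x beta (cv (k (d n) (h n)) (U t) x) - \int[leb2]_x beta (cv (k (d n) (h n)) (U s) x) =
    \int[leb3]_z ((\1_(`]s, t[%classic : set R) : R -> R) z.1 *
      (-1 * (b1 (cvt (k (d n) (h n)) u0 z) * remainder (d n) (h n) z)
       + b2 (cvt (k (d n) (h n)) u0 z) * (cvt (k (d n) (h n)) v0 z * cvt (k (d n) (h n)) p z)
       - b2 (cvt (k (d n) (h n)) u0 z) * (cvt (k (d n) (h n)) v0 z * cvt (k (d n) (h n)) v0 z))).
    by rewrite (e n); apply: eq_Rintegral => z _; rewrite mulN1r.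
  under eq_fun do rewrite e'.
  exact: rhs.
have <- := cvg_lim (@Rhausdorff R) lhs.
by have <- := cvg_lim (@Rhausdorff R) rhs'.
Qed.

End passage_to_the_limit.
End vanishing_scales.

(** The almost everywhere convergence is arranged last: a subsequence keeps the limits of both
    scales and the pairing between [d] and [h]. *)
Lemma good_scales : exists d h : R^nat, [/\ (forall n, 0 < d n) /\ (forall n, 0 < h n),
  d @ \oo --> 0, h @ \oo --> 0, forall n, nrm1 leb3 (defect (d n)) <= h n ^+ 2 &
  {ae leb3, forall z, cvt (k (d n) (h n)) u0 z @[n --> \oo] --> u0 z}].
Proof.
pose e (n : nat) : R := n.+1%:R^-1.
have el : e @ \oo --> 0 by exact: cvg_harmonic.
have e0 n : 0 < e n by rewrite invr_gt0.
have pm n : pker (e n) (m (e n)) by exact: pker_moll_moll.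
have dfl : nrm1 leb3 (defect (e n)) @[n --> \oo] --> 0.
  have c := cvg1B (cvt_cvg1 el pm (L2_mul u0L u1L)) (cvg1_mul (cvt_cvg2 el pm u1L) (cvt_cvg2 el pm u0L)).
  have [_ _ +] := c.
  rewrite (_ : (fun n => _) = (fun n => nrm1 leb3 (defect (e n))))//.
  apply/funext => n; congr nrm1; apply/funext => z; rewrite /defect.
  by move: (cvt _ _ _) (cvt _ _ _) (cvt _ _ _) => *; ring.
(* With [h = e n], the inner scale is sought among the same numbers [e j], far enough along for the
   defect to fall below [h ^ 2]. *)
have /choice[phi hphi] : forall n, exists j, e j <= e n /\ nrm1 leb3 (defect (e j)) <= e n ^+ 2.
  move=> n; have h2 : 0 < e n ^+ 2 by rewrite exprn_gt0.
  have /cvgr0Pnorm_le/(_ _ h2)[N1 _ H1] := dfl.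
  exists (maxn n N1); split.
    by rewrite lef_pV2 ?posrE// ler_nat ltnS leq_maxl.
  by apply: (le_trans (ler_norm _)); apply: H1; exact: leq_maxr.
pose d1 n := e (phi n).
have d1l : d1 @ \oo --> 0.
  apply: (squeeze_cvgr _ (cvg_cst 0) el); apply: nearW => n.
  by rewrite (ltW (e0 _)) /= (proj1 (hphi n)).
have hdl : (fun n => e n + d1 n) @ \oo --> 0.
  by rewrite -[0 in X in _ --> X]addr0; exact: cvgD.
have pK n : pker (e n + d1 n) (k (d1 n) (e n)) by exact: (pker_moll_kap (e0 (phi n)) (e0 n)).
have [psi [psin wae]] := cvg2_ae_subseq (cvt_cvg2 hdl pK u0L).
have sub (a : R^nat) : a @ \oo --> 0 -> (fun n => a (psi n)) @ \oo --> 0.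
  move=> al; apply/cvgrPdist_le => c c0; have /cvgrPdist_le/(_ _ c0)[N _ HN] := al.
  by exists N => // n /= Nn; apply: HN => /=; exact: leq_trans (psin n).
exists (fun n => d1 (psi n)), (fun n => e (psi n)); split => //.
- by split=> n; exact: e0.
- exact: sub.
- exact: sub.
- by move=> n; have [_] := hphi (psi n).
Qed.

Lemma renormalized (beta b1 b2 : R -> R) (C1 C2 s t : R) :
  (forall x : R, is_derive x (1 : R) beta (b1 x)) -> (forall x : R, is_derive x (1 : R) b1 (b2 x)) ->
  continuous b2 -> (forall r : R, `|b1 r| <= C1) -> (forall r : R, `|b2 r| <= C2) ->
  beta 0 = 0 -> b1 0 = 0 -> 0 <= s -> s < t -> t <= T ->
  \int[leb2]_x beta (U t x) - \int[leb2]_x beta (U s x) =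
  \int[leb3]_z ((\1_(`]s, t[%classic : set R) : R -> R) z.1 *
    (b2 (u0 z) * (v0 z * p z) - b2 (u0 z) * (v0 z * v0 z))).
Proof.
move=> h1 h2 h3 h4 h5 h6 h7; have [d [h [[d0 h0] dl hl sd wae]]] := good_scales.
exact: (renormalized_limit d0 h0 dl hl sd wae h1 h2 h3 h4 h5 h6 h7).
Qed.

End mollified_equations.

(** * Weak solutions extended by zero *)

Section functions_on_the_slab.
Context {R : realType}.
Local Notation mR := (measurableTypeR R).
Local Notation mR2 := (mR * mR)%type.
Local Notation mR3 := (mR * mR2)%type.
Local Notation leb := (@lebesgue_measure R).
Local Notation leb2 := (@leb2 R).
Local Notation leb3 := (@leb3 R).
Implicit Types (f g : R * (R * R) -> R) (s t T : R).

(** The data are constrained only on the slab and arbitrary elsewhere; with zero outside, integrals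
    and convolutions can be taken over the whole of space-time. *)
Definition ext T f (z : R * (R * R)) : R := if z.1 \in `]0, T[ then f z else 0.

Lemma ext_out T f z : z.1 \notin `]0, T[ -> ext T f z = 0.
Proof. by rewrite /ext => /negbTE ->. Qed.

Lemma ext_in T f z : z.1 \in `]0, T[ -> ext T f z = f z.
Proof. by rewrite /ext => ->. Qed.

Lemma ext_measurable T f : measurable_fun (slab T : set mR3) (f : mR3 -> mR) ->
  measurable_fun setT (ext T f : mR3 -> mR).
Proof.
have mS : measurable (slab T : set mR3).
  by apply: measurableX => //; exact: measurable_itv.
move=> /(measurable_restrictT _ mS); congr measurable_fun.
apply/funext => z; rewrite patchE /ext; congr (if _ then _ else _).
by apply/idP/idP; rewrite inE /slab /=; [case|move=> h; split].
Qed.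

(** Passage from the iterated extended integrals of the statement to real integrals over space-time,
    by Fubini. *)
Lemma slab_int_Rint s t f g : (forall z, z.1 \in `]s, t[ -> f z = g z) ->
  L1 leb3 (fun z => (\1_(`]s, t[%classic : set R) : R -> R) z.1 * g z) ->
  slab_int s t f = (\int[leb3]_z ((\1_(`]s, t[%classic : set R) : R -> R) z.1 * g z))%:E.
Proof.
move=> fg gi; rewrite -(RintE gi) -(integral12_prod_meas1 gi) /slab_int integral_mkcond.
apply: eq_integral => r _; rewrite patchE /fubini_F.
case: ifPn => [|] rst.
  apply: eq_integral => x _; rewrite /= indicE rst mul1r fg//.
  by rewrite inE in rst.
by rewrite integral0_eq// => x _; rewrite /= indicE (negbTE rst) mul0r.
Qed.

Lemma Lnorm2_sqr (f : R * R -> R) :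
  ((Lnorm leb2 2%:E (EFin \o f)) `^ 2 = \int[leb2]_x ((f x) ^+ 2)%:E)%E.
Proof.
rewrite poweR_Lnorm//; apply: eq_integral => x _.
have -> : (`|(EFin \o f) x| `^ 2)%E = (`|f x| `^ 2)%:E by [].
by rewrite powR_mulrn// real_normK// num_real.
Qed.

Lemma ext_sqr T f t : (\int[leb2]_x ((ext T f (t, x)) ^+ 2)%:E =
  (((fun t => Lnorm leb2 2%:E (fun x => (f (t, x))%:E)) \_ [set` `]0%R, T[]) t) `^ 2)%E.
Proof.
rewrite patchE; case: ifPn => tT.
  rewrite Lnorm2_sqr; apply: eq_integral => x _.
  by rewrite ext_in//; rewrite inE in tT.
rewrite poweR0r// integral0_eq// => x _; rewrite ext_out ?expr0n//.
by move: tT; apply: contra => ?; rewrite inE.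
Qed.

Lemma ext_L2 T f : measurable_fun (slab T : set mR3) (f : mR3 -> mR) ->
  (\int[leb]_t ((((fun t => Lnorm leb2 2%:E (fun x => (f (t, x))%:E)) \_ [set` `]0%R, T[]) t) `^ 2) < +oo)%E ->
  L2 leb3 (ext T f).
Proof.
move=> mf fo; have me := ext_measurable mf; split => //.
have me2 : measurable_fun setT ((fun z => ext T f z ^+ 2) : mR3 -> mR) by exact: measurable_funX.
apply: L1_lty => //; rewrite fubini_tonelli1//=; last exact: measurable_enorm.
apply: le_lt_trans fo; rewrite le_eqVlt; apply/orP; left; apply/eqP.
apply: eq_integral => t _; rewrite -ext_sqr /fubini_F; apply: eq_integral => x _.
by rewrite ger0_norm// sqr_ge0.
Qed.

Lemma LpL2_2 T f : LpL2 T 2%:E f -> L2 leb3 (ext T f).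
Proof.
move=> [mf fo]; apply: ext_L2 mf _.
set N := (X in (\int[leb]_t (X t `^ 2) < +oo)%E).
have N0 t : (0 <= N t)%E by rewrite /N patchE; case: ifP => // _; exact: Lnorm_ge0.
have -> : (\int[leb]_t (N t `^ 2) = Lnorm leb 2%:E N `^ 2)%E.
  by rewrite poweR_Lnorm//; apply: eq_integral => t _; rewrite gee0_abs.
exact: poweR_lty.
Qed.

(** Excludes the degenerate branch in the definition of the norm with exponent [+oo], which is an
    essential supremum only on a space of positive measure. *)
Lemma leb_setT_gt0 : (0 < leb (setT : set mR))%E.
Proof.
apply: (@lt_le_trans _ _ (leb `]0, 1[%classic)).
  by rewrite lebesgue_measure_itv/= ifT ?lte_fin// oppr0 adde0 lte_fin.
by apply: le_measure; rewrite ?inE//; exact: measurable_itv.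
Qed.

Lemma Lnorm_oo (g : R -> \bar R) : Lnorm leb +oo%E g = ess_sup leb (abse \o g).
Proof. by rewrite unlock ifT//; exact: leb_setT_gt0. Qed.

(** The time interval has finite length, so an essential bound on the spatial norm yields square
    integrability over the slab. *)
Lemma LpL2_oo T f : 0 < T -> LpL2 T +oo%E f -> L2 leb3 (ext T f).
Proof.
move=> T0 [mf fo]; apply: ext_L2 (mf) _.
set N := (X in (\int[leb]_t (X t `^ 2) < +oo)%E).
have N0 t : (0 <= N t)%E by rewrite /N patchE; case: ifP => // _; exact: Lnorm_ge0.
have [M hM] : exists M : R, {ae leb, forall t, (N t <= M%:E)%E}.
  move: fo; rewrite Lnorm_oo -/N.
  have := ess_sup_ge leb (abse \o N).
  case: (ess_sup _ _) => [r||] h oo; last 1 first.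
  (* An essential supremum equal to [-oo] is treated formally: any real number is then an upper
     bound. *)
  - by exists 0; apply: (ae_imp h) => t; rewrite /= gee0_abs// => ht; exact: le_trans ht (leNye _).
  - by exists r; apply: (ae_imp h) => t; rewrite /= gee0_abs.
  - by rewrite ltxx in oo.
have me := ext_measurable mf.
have mN2 : measurable_fun setT (fun t : mR => N t `^ 2)%E.
  rewrite (_ : (fun t => _) = fubini_F leb2 (fun z => ((ext T f z) ^+ 2)%:E)).
    apply: measurable_fun_fubini_tonelli_F => [|z]; last by rewrite lee_fin sqr_ge0.
    by apply/measurable_EFinP; exact: measurable_funX.
  by apply/funext => t; rewrite /fubini_F ext_sqr.
have mE : measurable (`]0, T[%classic : set mR) by exact: measurable_itv.
apply: (@le_lt_trans _ _ (\int[leb]_(t in [set` `]0%R, T[]) (M ^+ 2)%:E)%E).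
  rewrite [X in (_ <= X)%E]integral_mkcond.
  apply: ae_ge0_le_integral => //.
  - by move=> t _; exact: poweR_ge0.
  - by move=> t _; rewrite patchE; case: ifP => // _; rewrite lee_fin sqr_ge0.
  - by apply/(measurable_restrictT _ mE); exact: measurable_cst.
  apply: (ae_imp hM) => t Nt _; have := Nt; have := N0 t; rewrite patchE /N patchE.
  case: ifP => [_|]; last by rewrite poweR0r.
  case: (Lnorm _ _ _) => [r||] //; rewrite !lee_fin => r0 rM.
  by rewrite powR_mulrn// ler_pXn2r ?nnegrE// (le_trans r0).
have Efin : (leb [set` `]0%R, T[] < +oo)%E.
  by rewrite lebesgue_measure_itv/=; case: ifP => _; rewrite ltry.
rewrite integral_cst//; apply: lte_mul_pinfty => //.
by rewrite lee_fin sqr_ge0.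
Qed.

Lemma Lfun2_L2 (f : R * R -> R) : f \in Lfun leb2 2%:E -> L2 leb2 f.
Proof.
move=> fL; split; last exact: Lfun2_integrable_sqr.
by move: fL; rewrite inE => /andP[+ _]; rewrite inE.
Qed.

Lemma L2_Lfun2 (f : R * R -> R) : L2 leb2 f -> f \in Lfun leb2 2%:E.
Proof.
move=> [mf fi]; rewrite inE; apply/andP; split; rewrite inE//=.
rewrite /finite_norm; apply: (@lty_poweRy _ _ 2) => //.
by rewrite Lnorm2_sqr RintE// ltry.
Qed.

(** A violation would persist on an interval of positive length. This converts the essential bounds
    on the derivatives of [beta] into pointwise ones, which can be composed with any function. *)
Lemma continuous_ae_bounded (f : R -> R) M : continuous f ->
  {ae leb, forall x, `|f x| <= M} -> forall x, `|f x| <= M.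
Proof.
move=> cf [N [mN N0 fN]] x; rewrite leNgt; apply/negP => Mx.
have : \forall y \near x, M < `|f y|.
  have cn : `|f y| @[y --> x] --> `|f x| by apply: cvg_norm; exact: cf.
  have e0 : 0 < `|f x| - M by rewrite subr_gt0.
  move/cvgrPdist_lt : cn => /(_ _ e0); apply: filterS => y.
  by rewrite ltr_norml => /andP[_ hy]; lra.
move=> /nbhs_ballP[e /= e0 he].
have sub : (`]x - e, x + e[%classic : set mR) `<=` N.
  move=> y /=; rewrite in_itv/= => /andP[y1 y2]; apply: fN => /=; apply/negP; rewrite -ltNge.
  by apply: he; rewrite /ball/= ltr_norml; apply/andP; split; lra.
have : (leb (`](x - e)%R, (x + e)%R[%classic : set mR) <= leb N)%E.
  by apply: le_measure => //; rewrite inE//; exact: measurable_itv.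
rewrite N0 lebesgue_measure_itv/= ifT; last by rewrite lte_fin; lra.
by rewrite -EFinB lee_fin; lra.
Qed.

Lemma Lfun_oo_bounded (f : R -> R) : continuous f -> f \in Lfun leb +oo%E ->
  exists C, forall x, `|f x| <= C.
Proof.
move=> cf; rewrite inE => /andP[_]; rewrite inE/= /finite_norm Lnorm_oo.
have := ess_sup_ge leb (abse \o (EFin \o f)).
case: (ess_sup _ _) => [r||] h oo; last 1 first.
- by exists 0; apply: (continuous_ae_bounded cf); apply: (ae_imp h) => t.
- by exists r; apply: (continuous_ae_bounded cf); apply: (ae_imp h) => t.
- by rewrite ltxx in oo.
Qed.

End functions_on_the_slab.

(** * Transfer of the weak formulation to the extended functions *)

Section reduction_to_the_slab.
Context {R : realType}.
Local Notation mR := (measurableTypeR R).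
Local Notation mR2 := (mR * mR)%type.
Local Notation mR3 := (mR * mR2)%type.
Local Notation leb := (@lebesgue_measure R).
Local Notation leb2 := (@leb2 R).
Local Notation leb3 := (@leb3 R).
Implicit Types (f g : R * (R * R) -> R) (K : R * R -> R) (x : R * R) (th a b : R -> R) (s t T : R).

Lemma ktest_L1 f th a b x l r : csm th -> csupp th l r -> ck a -> ck b -> locT f ->
  L1 leb3 (fun z => f z * ktest th a b x z).
Proof.
move=> cth sth ka kb lf.
have := lf.2 _ _ x (kern1_ck (csm_csupp_ck cth sth)) (kern_ck ka kb).
by congr L1; apply/funext => z; rewrite ktestE; ring.
Qed.

Lemma ktest_indic T th a b x l r (c : R) (z : R * (R * R)) : csupp th l r -> 0 < l -> r < T ->
  (\1_(`]0, T[%classic : set R) : R -> R) z.1 * (c * ktest th a b x z) = c * ktest th a b x z.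
Proof.
move=> sth l0 rT.
have -> : c * ktest th a b x z = th z.1 * (tens2 a b (sub2 x z.2) * c) by rewrite ktestE; ring.
exact: csupp_indic sth l0 rT.
Qed.

Section weak_solutions.
Variables (T : R) (u du : 'I_2 -> R * (R * R) -> R).
Hypotheses (T0 : 0 < T) (hu : weak_solution T u du).

Let u0 := ext T (u 0).
Let u1 := ext T (u 1).
Let v0 := ext T (du 0).

Let u0L : L2 leb3 u0. Proof. exact: LpL2_oo T0 (ws_LooL2 hu 0). Qed.
Let u1L : L2 leb3 u1. Proof. exact: LpL2_oo T0 (ws_LooL2 hu 1). Qed.
Let v0L : L2 leb3 v0. Proof. exact: LpL2_2 (ws_dx1_L2L2 hu 0). Qed.

Lemma ext_weak_dx th l r a b x : csm th -> csupp th l r -> 0 < l -> r < T -> ck a -> ck b ->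
  \int[leb3]_z (u0 z * 'D_(ex 0) (ktest th a b x) z) = - \int[leb3]_z (v0 z * ktest th a b x z).
Proof.
move=> cth sth l0 rT ka kb; have [ca _] := ka; have [cb _] := kb.
have d0 z : 'D_(ex 0) (ktest th a b x) z = - ktest th (derive1 a) b x z.
  exact: (congr1 (fun F => F z) (ktest_d0 x cth ca cb)).
have i1 := ktest_L1 x cth sth (ck_derive ka) kb (locT_L2 u0L).
have i2 := ktest_L1 x cth sth ka kb (locT_L2 v0L).
have := ws_dx1 hu 0 (ktest_test x cth sth l0 rT ka kb).
have e1 z : (\1_(`]0, T[%classic : set R) : R -> R) z.1 * (u0 z * 'D_(ex 0) (ktest th a b x) z) =
    - (u0 z * ktest th (derive1 a) b x z).
  by rewrite d0 !mulrN (ktest_indic _ _ _ _ _ sth l0 rT).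
have j1 : L1 leb3 (fun z => (\1_(`]0, T[%classic : set R) : R -> R) z.1 * (u0 z * 'D_(ex 0) (ktest th a b x) z)).
  by have := L1N i1; congr L1; apply/funext => z; rewrite e1.
have e2 z : (\1_(`]0, T[%classic : set R) : R -> R) z.1 * (v0 z * ktest th a b x z) =
    v0 z * ktest th a b x z.
  exact: ktest_indic sth l0 rT.
have j2 : L1 leb3 (fun z => (\1_(`]0, T[%classic : set R) : R -> R) z.1 * (v0 z * ktest th a b x z)).
  by move: i2; congr L1; apply/funext => z; rewrite e2.
rewrite (slab_int_Rint _ j1); last by move=> z zT; rewrite /u0 ext_in.
rewrite (slab_int_Rint _ j2); last by move=> z zT; rewrite /v0 ext_in.
rewrite -EFinN => -[].
move=> E; transitivity (\int[leb3]_z ((\1_(`]0, T[%classic : set R) : R -> R) z.1 *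
    (u0 z * 'D_(ex 0) (ktest th a b x) z))).
  by apply: eq_Rintegral => z _; rewrite e1 d0 mulrN.
by rewrite E; congr (- _); apply: eq_Rintegral => z _; exact: e2.
Qed.

Lemma ext_weak_div (psi : R * R -> R) : test_fun psi ->
  {ae leb, forall t : R, t \in `]0, T[ ->
    \int[leb2]_x (u0 (t, x) * 'D_(ex2 0) psi x + u1 (t, x) * 'D_(ex2 1) psi x) = 0}.
Proof.
move=> tpsi; apply: (ae_imp (ws_div hu tpsi)) => t ht tT.
rewrite /Rintegral; apply: (etrans _ (congr1 fine (ht tT))); congr fine.
apply: eq_integral => x _; congr EFin.
by rewrite big_ord_recl big_ord1 /u0 /u1 !ext_in//; congr (_ + u _ _ * 'D_(ex2 _) _ _); apply/val_inj.
Qed.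

Variable p : R * (R * R) -> R.
Hypothesis hp : associated_pressure T u p.

Let q := ext T p.
Let qL : L2 leb3 q. Proof. by have [h _] := hp; exact: LpL2_2. Qed.

Lemma ext_weak_eq th l r a b x : csm th -> csupp th l r -> 0 < l -> r < T -> ck a -> ck b ->
  let phi := ktest th a b x in
  \int[leb3]_z (u0 z * 'D_et phi z + (u0 z * u0 z * 'D_(ex 0) phi z + u0 z * u1 z * 'D_(ex 1) phi z)
    + q z * 'D_(ex 0) phi z + u0 z * 'D_(ex 0) ('D_(ex 0) phi) z) = 0.
Proof.
move=> cth sth l0 rT ka kb phi; have [ca _] := ka; have [cb _] := kb.
have d0 z : 'D_(ex 0) phi z = - ktest th (derive1 a) b x z.
  exact: (congr1 (fun F => F z) (ktest_d0 x cth ca cb)).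
have d1 z : 'D_(ex 1) phi z = - ktest th a (derive1 b) x z.
  exact: (congr1 (fun F => F z) (ktest_d1 x cth ca cb)).
have dt z : 'D_et phi z = ktest (derive1 th) a b x z.
  exact: (congr1 (fun F => F z) (ktest_dt x cth ca cb)).
have d00 z : 'D_(ex 0) ('D_(ex 0) phi) z = ktest th (derive1 (derive1 a)) b x z.
  exact: (congr1 (fun F => F z) (ktest_d00 x cth ca cb)).
have kda := ck_derive ka; have kdb := ck_derive kb; have kdda := ck_derive kda.
have cdth := csm_derive1 cth; have sdth := csupp_derive sth.
have L00 := locT_L1 (L2_mul u0L u0L); have L01 := locT_L1 (L2_mul u0L u1L).
have i0 := ktest_L1 x cdth sdth ka kb (locT_L2 u0L).
have i1 := ktest_L1 x cth sth kda kb L00.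
have i2 := ktest_L1 x cth sth ka kdb L01.
have i3 := ktest_L1 x cth sth kda kb (locT_L2 qL).
have i4 := ktest_L1 x cth sth kdda kb (locT_L2 u0L).
pose F z := u0 z * 'D_et phi z + (u0 z * u0 z * 'D_(ex 0) phi z + u0 z * u1 z * 'D_(ex 1) phi z)
    + q z * 'D_(ex 0) phi z + u0 z * 'D_(ex 0) ('D_(ex 0) phi) z.
have e z : (\1_(`]0, T[%classic : set R) : R -> R) z.1 * F z = F z.
  rewrite /F dt d0 d1 d00 !mulrDr !mulrN.
  by rewrite !(ktest_indic _ _ _ _ _ sth l0 rT) (ktest_indic _ _ _ _ _ sdth l0 rT).
have FL : L1 leb3 F.
  have := L1D (L1B (L1B (L1B i0 i1) i2) i3) i4.
  congr L1; apply/funext => z; rewrite /F dt d0 d1 d00.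
  by move: (ktest _ _ _ _ _) (ktest _ _ _ _ _) (ktest _ _ _ _ _) (ktest _ _ _ _ _) => *; ring.
have j : L1 leb3 (fun z => (\1_(`]0, T[%classic : set R) : R -> R) z.1 * F z).
  by move: FL; congr L1; apply/funext => z; rewrite e.
have [_ /(_ 0 phi (ktest_test x cth sth l0 rT ka kb))] := hp.
rewrite (slab_int_Rint _ j).
  by move=> [] <-; apply: eq_Rintegral => z _; rewrite e.
move=> z zT; rewrite big_ord_recl big_ord1 /F /u0 /u1 /q !ext_in//.
by congr (_ + (_ + _ * u _ _ * 'D_(ex _) _ _) + _ + _); apply/val_inj.
Qed.

End weak_solutions.
End reduction_to_the_slab.

Unset Implicit Arguments.

Theorem proposition5p2 (R : realType) (T : R) (hT : 0 < T)
  (u du : 'I_2 -> R * (R * R) -> R) (hu : weak_solution T u du)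
  (p : R * (R * R) -> R) (hp : associated_pressure T u p)
  (u1 : R -> R * R -> R) (hu1 : Cw_representative T (u 0) u1)
  (beta : R -> R)
  (hbeta1 : forall x, derivable beta x 1)
  (hbeta2 : forall x, derivable (derive1 beta) x 1)
  (hbeta2c : continuous (derive1n 2 beta))
  (hbeta0 : beta 0 = 0) (hbeta'0 : (derive1 beta) 0 = 0)
  (hbeta'b : (derive1 beta) \in Lfun lebesgue_measure +oo%E)
  (hbeta''b : (derive1n 2 beta) \in Lfun lebesgue_measure +oo%E)
  (s t : R) (hs : 0 <= s) (hst : s < t) (ht : t <= T) :
  (\int[leb2]_x (beta (u1 t x))%:E
   + slab_int s t (fun z => ((derive1n 2 beta) (u 0 z) * du 0 z ^+ 2)%R)
   = \int[leb2]_x (beta (u1 s x))%:E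
   + slab_int s t (fun z => (p z * (derive1n 2 beta) (u 0 z) * du 0 z)%R))%E.
Proof.
have [[uL uc] uae] := hu1.
pose b1 := derive1 beta; pose b2 := derive1n 2 beta.
have h1 (x : R) : is_derive x (1 : R) beta (b1 x).
  by apply: DeriveDef => //; rewrite /b1 derive1E.
have h2 (x : R) : is_derive x (1 : R) b1 (b2 x).
  by apply: DeriveDef; [exact: hbeta2|rewrite /b2 derive1nS derive1n1 derive1E].
have b1c : continuous b1 by move=> x; exact: is_derive_continuous (h2 x).
have [C1 b1C] := Lfun_oo_bounded b1c hbeta'b.
have [C2 b2C] := Lfun_oo_bounded hbeta2c hbeta''b.
have [hpL _] := hp.
have u0L := LpL2_oo hT (ws_LooL2 hu 0); have u1L := LpL2_oo hT (ws_LooL2 hu 1).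
have v0L := LpL2_2 (ws_dx1_L2L2 hu 0); have qL := LpL2_2 hpL.
have UL r : r \in `[0, T] -> L2 leb2 (u1 r) by move=> rT; apply: Lfun2_L2; exact: uL.
have Uc (w : R * R -> R) : L2 leb2 w -> {within `[0, T], continuous (fun t => \int[leb2]_x (u1 t x * w x))}.
  by move=> wL; apply: uc; exact: L2_Lfun2.
have Uu : {ae lebesgue_measure, forall r : R, r \in `]0, T[ -> {ae leb2, forall x, u1 r x = ext T (u 0) (r, x)}}.
  by apply: (ae_imp uae) => r h rT; apply: (ae_imp (h rT)) => x ->; rewrite ext_in.
have key := renormalized hT u0L u1L v0L qL (@ext_out _ T (u 0)) (@ext_out _ T (u 1)) (@ext_out _ T (du 0))
  (ext_weak_dx hT hu) (ext_weak_div hu) (ext_weak_eq hT hu hp) UL Uc Uu h1 h2 hbeta2c b1C b2C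
  hbeta0 hbeta'0 hs hst ht.
have b1_le (x : R) : `|b1 x| <= C2 * `|x|.
  by have := bounded_derivative_lipschitz x 0 h2 b2C; rewrite (hbeta'0 : b1 0 = 0) !subr0.
have betaL r : r \in `[0, T] -> L1 leb2 (fun x => beta (u1 r x)).
  by move=> rT; exact: L1_quadratic h1 b1_le hbeta0 (UL r rT).
have sI : s \in `[0, T] by rewrite in_itv/= hs (le_trans (ltW hst)).
have tI : t \in `[0, T] by rewrite in_itv/= ht (le_trans hs (ltW hst)).
pose I : R -> R := \1_(`]s, t[%classic : set R).
pose X z := b2 (ext T (u 0) z) * (ext T (du 0) z * ext T p z).
pose Y z := b2 (ext T (u 0) z) * (ext T (du 0) z * ext T (du 0) z).
have mu0 := L2_meas u0L.
have iX : L1 leb3 X := L1_comp_mul hbeta2c b2C mu0 (L2_mul v0L qL).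
have iY : L1 leb3 Y := L1_comp_mul hbeta2c b2C mu0 (L2_mul v0L v0L).
have [mI _ _] := kern1_indic s t.
have iIX : L1 leb3 (fun z => I z.1 * X z).
  by apply: (L1_bound (measurable_fst1 mI) (fun z => indic_norm_le _ z.1)).
have iIY : L1 leb3 (fun z => I z.1 * Y z).
  by apply: (L1_bound (measurable_fst1 mI) (fun z => indic_norm_le _ z.1)).
have stT (z : R * (R * R)) : z.1 \in `]s, t[ -> z.1 \in `]0, T[.
  by rewrite !in_itv/= => /andP[h3 h4]; rewrite (le_lt_trans hs h3) (lt_le_trans h4 ht).
rewrite (slab_int_Rint _ iIY); last first.
  by move=> z zst; rewrite /Y !(ext_in _ (stT z zst)) expr2.
rewrite (slab_int_Rint _ iIX); last first.
  by move=> z zst; rewrite /X !(ext_in _ (stT z zst)) [p z * _]mulrC -mulrA [p z * _]mulrC.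
(* All four terms are now known to be finite, so the extended identity reduces to one between real
   numbers. *)
rewrite (RintE (betaL t tI)) (RintE (betaL s sI)) -!EFinD; congr EFin.
have e : \int[leb3]_z (I z.1 * (X z - Y z)) = \int[leb3]_z (I z.1 * X z) - \int[leb3]_z (I z.1 * Y z).
  by rewrite -(RintB iIX iIY); apply: eq_Rintegral => z _; rewrite mulrBr.
have := etrans key e; lra.
Qed.
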